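(* Let $0<\gamma<1$, $1\le q<2$, and $\omega\in C^\gamma(\overline{\mathbb{R}}^2_+)\cap L^q(\mathbb{R}^2_+)$. Let $$\Psi(x)=\frac1{2\pi}\int_{\mathbb{R}^2_+}\big(\log|x-y|-\log|x-\bar y|\big)\omega(y)\,dy,\qquad x\in\mathbb{R}^2_+,$$ and $u=\nabla^\perp\Psi$. Then the Hessian $\nabla^2\Psi$ satisfies $$[\nabla^2\Psi]_{C^\gamma(\overline{\mathbb{R}}^2_+)}\le C_\gamma\,[\omega]_{C^\gamma(\overline{\mathbb{R}}^2_+)},$$ and consequently $$[\nabla u]_{C^\gamma(\overline{\mathbb{R}}^2_+)}\le C_\gamma\,[\omega]_{C^\gamma(\overline{\mathbb{R}}^2_+)},$$ where $C_\gamma$ depends only on $\gamma$.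
   Context: $\mathbb{R}^2_+=\{(x_1,x_2)\in\mathbb{R}^2: x_2>0\}$, $\overline{\mathbb{R}}^2_+$ its closure; $\nabla^\perp=(\partial_2,-\partial_1)$; $\bar y=(y_1,-y_2)$ for $y=(y_1,y_2)$. The Hölder seminorm is $[f]_{C^\gamma(\Omega)}=\sup_{x\ne y\in\Omega}\frac{|f(x)-f(y)|}{|x-y|^\gamma}$ (for matrix-valued $f$, the Euclidean norm is used), and $C^\gamma(\overline{\mathbb{R}}^2_+)$ consists of the continuous functions on $\overline{\mathbb{R}}^2_+$ with $\|f\|_{C^0}+[f]_{C^\gamma}<\infty$. *)

(* Defs.v *)
From mathcomp Require Import all_boot all_order all_algebra.
From mathcomp Require Import all_classical all_reals all_analysis.

Set Implicit Arguments.
Unset Strict Implicit.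
Unset Printing Implicit Defensive.

Import Order.TTheory GRing.Theory Num.Theory.
Import numFieldNormedType.Exports.

Local Open Scope classical_set_scope.
Local Open Scope ring_scope.

Section HalfPlane.
Variable R : realType.

(* The library norm on [R * R] is the max norm; only its topology is used. *)
Definition enorm (x : R * R) : R := Num.sqrt (x.1 ^+ 2 + x.2 ^+ 2).

Definition frobenius (m n : nat) (A : 'M[R]_(m, n)) : R :=
  Num.sqrt (\sum_i \sum_j A i j ^+ 2).

Definition halfplane : set (R * R) := [set x | 0 < x.2].

Definition reflect2 (y : R * R) : R * R := (y.1, - y.2).

Definition plane_measure :=
  (@lebesgue_measure R \x @lebesgue_measure R)%E.

(* [N] is the norm on the codomain: [Num.norm] for scalars, [frobenius] for
   matrices. *)
Definition holder_seminorm (V : zmodType) (N : V -> R) (gamma : R)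
    (Omega : set (R * R)) (f : R * R -> V) : \bar R :=
  ereal_sup [set r : \bar R | exists x y, [/\ Omega x, Omega y, x <> y &
    r = (N (f x - f y) / enorm (x - y) `^ gamma)%:E]].

Definition sup_norm (Omega : set (R * R)) (f : R * R -> R) : \bar R :=
  ereal_sup [set (`|f x|)%:E | x in Omega].

Definition holder_space (gamma : R) (Omega : set (R * R)) (f : R * R -> R) :=
  {within Omega, continuous f} /\
  (sup_norm Omega f + holder_seminorm Num.norm gamma Omega f < +oo)%E.

(* [f] restricted to [A] is in L^q(A), for the Lebesgue measure. *)
Definition Lq_on (q : R) (A : set (R * R)) (f : R * R -> R) : Prop :=
  (f \_ A : measurableTypeR R * measurableTypeR R -> R)
    \in Lfun plane_measure q%:E.

Definition green_integrand (omega : R * R -> R) (x y : R * R) : R :=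
  (ln (enorm (x - y)) - ln (enorm (x - reflect2 y))) * omega y.

Definition stream (omega : R * R -> R) (x : R * R) : R :=
  (2 * pi)^-1 * \int[plane_measure]_(y in halfplane) green_integrand omega x y.

Definition coord2 (i : 'I_2) (v : R * R) : R := if i == 0 then v.1 else v.2.

Definition basis2 (i : 'I_2) : R * R := ((i == 0)%:R, (i != 0)%:R).

Definition partial (i : 'I_2) (f : R * R -> R) : R * R -> R :=
  fun x => 'D_(basis2 i) f x.

Definition hessian (f : R * R -> R) (x : R * R) : 'M[R]_2 :=
  \matrix_(i, j) partial i (partial j f) x.

Definition perp_gradient (f : R * R -> R) (x : R * R) : R * R :=
  (partial 1 f x, - partial 0 f x).

Definition gradient (u : R * R -> R * R) (x : R * R) : 'M[R]_2 :=
  \matrix_(i, j) partial j (fun z => coord2 i (u z)) x.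

(* ['D_v f] is a total operator with a default value where the derivative does
   not exist, hence this explicit predicate. *)
Definition twice_differentiable_at (f : R * R -> R) (x : R * R) : Prop :=
  differentiable f x /\ forall i, differentiable (partial i f) x.

(* Functions defined on an open set [A] are viewed as functions on [closure A]
   through their continuous extension, which is unique if it exists. *)
Definition continuous_extension (A : set (R * R)) (F G : R * R -> 'M[R]_2) :=
  {within closure A, continuous G} /\ forall x, A x -> G x = F x.

End HalfPlane.

Arguments halfplane : clear implicits.
Arguments plane_measure : clear implicits.

(* Main.v *)
(* Proof idea.  Let f be omega extended by 0 to the plane.  Up to sign and the factor
   1/(2 pi), the first derivatives of Psi at x are V_i(x) -/+ V_i(x'), where x' is the
   reflection of x and V_i is the convolution of f with z_i / |z|^2.  Although f jumps across
   the boundary, it is Hoelder along horizontal lines with the same seminorm as omega.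

   At unit scale, V_1 differs from an affine function, whose slopes are integrals of f
   against the gradient of the regularised kernel z_1 / (1 + |z|^2), by the integral of f
   against a kernel which is O(|z|^-3) at infinity and has mean zero on horizontal lines.
   Subtracting f(0, z_2) bounds this by the horizontal seminorm of f alone.  Rescaling gives
   affine approximations of V_1 to order h^(1 + gamma) at every point and scale h, with a
   uniform constant, and Campanato's argument turns them into V_1 in C^(1, gamma) on the whole
   plane.  No derivative is ever taken under the integral sign.

   For V_2 one exchanges the coordinates; off the boundary f satisfies the required one-point
   Hoelder bound with a constant depending on the point, which gives differentiability only.
   The slopes of V_1 and V_2 at scale h satisfy d_1 V_2 = d_2 V_1 exactly, while
   d_1 V_1 + d_2 V_2 is the integral of f against an approximate identity; in the limit
   d_2 V_2 = kappa f - d_1 V_1, so all second derivatives are Hoelder up to the boundary. *)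
From HB Require Import structures.
Require Import Defs.
From mathcomp Require Import all_boot all_order all_algebra.
From mathcomp Require Import all_classical all_reals all_analysis.
From mathcomp Require Import measurable_realfun ring lra.
Set Implicit Arguments.
Unset Strict Implicit.
Unset Printing Implicit Defensive.
Import Order.TTheory GRing.Theory Num.Theory.
Import numFieldNormedType.Exports.
Local Open Scope classical_set_scope.
Local Open Scope ring_scope.

(** A second differentiation under the integral would produce a kernel of size |z|^-2, which is
    integrable neither at the origin nor at infinity, so some cancellation is indispensable. The one
    used is one-dimensional: on almost every horizontal line the remainder kernel has an explicit
    primitive, a difference of logarithms plus a rational term, which tends to 0 at both ends.
    Integration along the line therefore kills every function of the second coordinate alone, and
    the jump of f with it. What remains is |z_1|^gamma against a kernel of decay |z|^-3, which is
    integrable at infinity because gamma < 1. Regularising with 1 + |z|^2 makes the slopes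
    absolutely convergent integrals and preserves the symmetries under exchange of the coordinates
    that relate the derivatives of V_1 and V_2.

    Apart from measurability, the L^q assumption is used through the convergence of the integral of
    |f| / (1 + |y|). The value of that integral never enters the Hoelder constants, which involve
    the seminorm alone. *)

Lemma eq_ler (R : realType) (x y : R) : x = y -> x <= y.
Proof. by move=> ->. Qed.

(** * Integration on the plane *)

Section PlaneIntegral.
Variable R : realType.
Notation mu := (@lebesgue_measure R).
Notation RT := (measurableTypeR R).
Notation mu2 := (plane_measure R).
Implicit Types (F G : R * R -> R) (p w : R * R) (h : R).

Definition pmeasurable F := measurable_fun [set: RT * RT] (F : RT * RT -> RT).
Definition pintegrable F := mu2.-integrable setT (EFin \o F).
Definition pint F : R := \int[mu2]_y F y.

Lemma pintegrable_le F G : pmeasurable F -> (forall y, `|F y| <= G y) ->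
  pintegrable G -> pintegrable F.
Proof.
move=> mF FG; apply: le_integrable => //; first exact/measurable_EFinP.
by move=> y _ /=; rewrite lee_fin (le_trans (FG y))// ler_norm.
Qed.

Lemma pintegrableD F G : pintegrable F -> pintegrable G ->
  pintegrable (fun y => F y + G y).
Proof.
move=> iF iG; have := integrableD measurableT iF iG.
by apply: eq_integrable => // y _ /=; rewrite EFinD.
Qed.

Lemma pintegrableZ (k : R) F : pintegrable F -> pintegrable (fun y => k * F y).
Proof.
move=> iF; have := integrableZl measurableT k iF.
by apply: eq_integrable => // y _ /=; rewrite EFinM.
Qed.

Lemma pintegrableB F G : pintegrable F -> pintegrable G ->
  pintegrable (fun y => F y - G y).
Proof.
move=> iF iG; have := integrableB measurableT iF iG.
by apply: eq_integrable => // y _ /=; rewrite EFinB.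
Qed.

Lemma pintD F G : pintegrable F -> pintegrable G ->
  pint (fun y => F y + G y) = pint F + pint G.
Proof. by move=> iF iG; rewrite /pint RintegralD. Qed.

Lemma pintB F G : pintegrable F -> pintegrable G ->
  pint (fun y => F y - G y) = pint F - pint G.
Proof. by move=> iF iG; rewrite /pint RintegralB. Qed.

Lemma pintZ (k : R) F : pintegrable F -> pint (fun y => k * F y) = k * pint F.
Proof. by move=> iF; rewrite /pint RintegralZl. Qed.

Lemma eq_pint F G : F =1 G -> pint F = pint G.
Proof. by move=> FG; apply: eq_Rintegral => y _; exact: FG. Qed.

Lemma ler_norm_pint F G : pintegrable F -> pintegrable G ->
  (forall y, `|F y| <= G y) -> `|pint F| <= pint G.
Proof.
move=> iF iG FG; apply: (le_trans (le_normr_Rintegral measurableT iF)).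
by apply: le_Rintegral => //; exact: integrable_norm.
Qed.

Lemma pint_ge0 F : (forall y, 0 <= F y) -> 0 <= pint F.
Proof. by move=> F0; apply: Rintegral_ge0 => y _; exact: F0. Qed.

Definition affine2 p h w : R * R := (p.1 + h * w.1, p.2 + h * w.2).
Definition swap2 w : R * R := (w.2, w.1).

Lemma measurable_affine1 (a h : R) :
  measurable_fun [set: RT] ((fun t => a + h * t) : RT -> RT).
Proof. by apply: measurable_funD => //; apply: measurable_funM. Qed.

Lemma measurable_affine2 p h :
  measurable_fun [set: RT * RT] (affine2 p h : RT * RT -> RT * RT).
Proof.
apply/measurable_fun_pairP; split => /=.
  exact: (measurableT_comp (measurable_affine1 p.1 h)).
exact: (measurableT_comp (measurable_affine1 p.2 h)).
Qed.

Lemma measurable_swap2 :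
  measurable_fun [set: RT * RT] (swap2 : RT * RT -> RT * RT).
Proof.
by apply/measurable_fun_pairP; split => /=; [exact: measurable_snd|exact: measurable_fst].
Qed.

(* The measurability proof cannot be inferred from [pushforward], hence this name. *)
Notation pushm := measure_function_pushforward__canonical__measure_function_Measure.

(** The right-hand side is itself a measure in [A], so by uniqueness it is enough to compare both
    sides on half-open intervals. The planar versions below argue in the same way on rectangles. *)
Lemma lebesgue_measure_affine (a h : R) : 0 < h -> forall A : set RT,
  measurable A -> mu A = (h%:E * mu ((fun t => a + h * t)%R @^-1` A))%E.
Proof.
move=> h0.
have mf : measurable_fun [set: RT] ((fun t => a + h * t) : RT -> RT).
  exact: measurable_affine1.
pose nu := mscale (NngNum (ltW h0)) (pushm mu mf).
have H : forall X, ocitv X -> mu X = nu X.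
  move=> X [[x1 x2] _ <-] /=.
  rewrite /nu /mscale /= /pushforward.
  rewrite (_ : _ @^-1` _ = [set` `]((x1 - a) / h), ((x2 - a) / h)]]); last first.
    apply/seteqP; split => t /=; rewrite !in_itv/=.
      by rewrite ltr_pdivrMr// ler_pdivlMr// ![t * _]mulrC ltrBlDl lerBrDl.
    by rewrite ltr_pdivrMr// ler_pdivlMr// ![t * _]mulrC ltrBlDl lerBrDl.
  rewrite !lebesgue_measure_itv /= !lte_fin ltr_pM2r ?invr_gt0// ltrD2r.
  case: ifPn => _; last by rewrite mule0.
  rewrite -!EFinB -EFinM; congr EFin.
  by field; rewrite gt_eqF.
move=> A mA; exact: (lebesgue_measure_unique H mA).
Qed.

Lemma plane_measure_affine p h : 0 < h -> forall A : set (RT * RT),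
  measurable A -> mu2 A = ((h ^+ 2)%:E * mu2 (affine2 p h @^-1` A))%E.
Proof.
move=> h0.
have h20 : 0 <= h ^+ 2 by rewrite exprn_ge0// ltW.
have ma := measurable_affine2 p h.
pose nu := mscale (NngNum h20) (pushm mu2 ma).
have H : forall A B : set RT, measurable A -> measurable B ->
    nu (A `*` B) = (mu A * mu B)%E.
  move=> A B mA mB; rewrite /nu /mscale /= /pushforward.
  rewrite (lebesgue_measure_affine p.1 h0 mA) (lebesgue_measure_affine p.2 h0 mB).
  have -> : (affine2 p h : RT * RT -> RT * RT) @^-1` (A `*` B) =
    ((fun t => p.1 + h * t) @^-1` A) `*` ((fun t => p.2 + h * t) @^-1` B) by [].
  rewrite /plane_measure product_measure1E; last 2 first.
  - by rewrite -[X in measurable X]setTI; exact: (measurable_affine1 _ _ measurableT).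
  - by rewrite -[X in measurable X]setTI; exact: (measurable_affine1 _ _ measurableT).
  by rewrite expr2 EFinM -!muleA; congr (_ * _)%E; rewrite muleCA.
by move=> A mA; exact: (product_measure_unique H mA).
Qed.

Lemma plane_measure_swap (A : set (RT * RT)) : measurable A ->
  mu2 A = mu2 (swap2 @^-1` A).
Proof.
have ma := measurable_swap2.
have H : forall A B : set RT, measurable A -> measurable B ->
    pushm mu2 ma (A `*` B) = (mu A * mu B)%E.
  move=> {}A B mA mB; rewrite /= /pushforward.
  have -> : (swap2 : RT * RT -> RT * RT) @^-1` (A `*` B) = B `*` A.
    by apply/seteqP; split => -[x y] /= [].
  by rewrite /plane_measure product_measure1E// muleC.
by move=> mA; exact: (product_measure_unique H mA).
Qed.

Lemma ge0_integral_affine2 p h (f : RT * RT -> \bar R) : 0 < h ->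
  measurable_fun setT f -> (forall x, 0 <= f x)%E ->
  (\int[mu2]_x f x = (h ^+ 2)%:E * \int[mu2]_x f (affine2 p h x))%E.
Proof.
move=> h0 mf f0.
have [k hk] : {k : {nonneg R} | k%:num = h ^+ 2}.
  by exists (NngNum (exprn_ge0 2 (ltW h0))).
have ma := measurable_affine2 p h; rewrite -hk.
rewrite (@eq_measure_integral _ _ _ _ (mscale k (pushm mu2 ma))); last first.
  by move=> A mA _; rewrite /= /mscale hk; exact: plane_measure_affine.
rewrite ge0_integral_mscale; [|exact: measurableT|exact: mf|by move=> x _; exact: f0].
have := ge0_integral_pushforward ma (lebesgue_measure \x lebesgue_measure)%E
  measurableT mf (fun x _ => f0 x).
by rewrite preimage_setT => E; rewrite E.
Qed.

Lemma ge0_integral_swap2 (f : RT * RT -> \bar R) :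
  measurable_fun setT f -> (forall x, 0 <= f x)%E ->
  (\int[mu2]_x f x = \int[mu2]_x f (swap2 x))%E.
Proof.
move=> mf f0; have ms := measurable_swap2.
rewrite (@eq_measure_integral _ _ _ _ (pushm mu2 ms)); last first.
  by move=> A mA _; exact: plane_measure_swap.
have := ge0_integral_pushforward ms (lebesgue_measure \x lebesgue_measure)%E
  measurableT mf (fun x _ => f0 x).
rewrite preimage_setT => E.
by apply: (etrans E); reflexivity.
Qed.

Lemma pintegrable_affine2 p h F : 0 < h -> pintegrable F ->
  pintegrable (F \o affine2 p h).
Proof.
move=> h0 /integrableP[mF iF]; apply/integrableP; split.
  by apply: (measurableT_comp mF); exact: measurable_affine2.
move: iF; rewrite (ge0_integral_affine2 p h0)//; last exact: measurableT_comp.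
have [//|] := ltP (\int[mu2]_x `|(EFin \o F \o affine2 p h) x|)%E +oo%E.
rewrite leye_eq => /eqP; rewrite /comp => ->.
by rewrite gt0_muley// lte_fin exprn_gt0.
Qed.

Lemma pintegrable_swap2 F : pintegrable F -> pintegrable (F \o swap2).
Proof.
move=> /integrableP[mF iF]; apply/integrableP; split.
  by apply: (measurableT_comp mF); exact: measurable_swap2.
by move: iF; rewrite ge0_integral_swap2//; exact: measurableT_comp.
Qed.

(** Positive and negative parts are transported separately by the nonnegative case; integrability
    keeps the difference of the two extended reals meaningful. *)
Lemma pint_affine2 p h F : 0 < h -> pintegrable F ->
  pint F = h ^+ 2 * pint (F \o affine2 p h).
Proof.
move=> h0 iF; have iFa := pintegrable_affine2 p h0 iF.
have mF : measurable_fun setT (EFin \o F : RT * RT -> \bar R).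
  exact: measurable_int iF.
rewrite /pint /Rintegral -[h ^+ 2]/(fine (h ^+ 2)%:E) -fineM//; last first.
  exact: integrable_fin_num.
congr fine; rewrite integralE [in RHS]integralE muleBr//; last first.
  apply: fin_num_adde_defl.
  rewrite fin_numN; apply: integrable_neg_fin_num => //; exact: iFa.
have Ep : (\int[mu2]_x (EFin \o (F \o affine2 p h))^\+ x =
    \int[mu2]_x (EFin \o F)^\+ (affine2 p h x))%E.
  by apply: eq_integral => x _; rewrite !funeposE.
have En : (\int[mu2]_x (EFin \o (F \o affine2 p h))^\- x =
    \int[mu2]_x (EFin \o F)^\- (affine2 p h x))%E.
  by apply: eq_integral => x _; rewrite !funenegE.
rewrite [X in (X - _)%E](ge0_integral_affine2 p h0 (measurable_funepos mF) (funepos_ge0 _)).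
rewrite [X in (_ - X)%E = _](ge0_integral_affine2 p h0 (measurable_funeneg mF) (funeneg_ge0 _)).
rewrite -Ep -En; reflexivity.
Qed.

Lemma pint_swap2 F : pintegrable F -> pint F = pint (F \o swap2).
Proof.
move=> iF.
have mF : measurable_fun setT (EFin \o F : RT * RT -> \bar R).
  exact: measurable_int iF.
rewrite /pint /Rintegral; congr fine; rewrite integralE [in RHS]integralE.
have Ep : (\int[mu2]_x (EFin \o (F \o swap2))^\+ x =
    \int[mu2]_x (EFin \o F)^\+ (swap2 x))%E.
  by apply: eq_integral => x _; rewrite !funeposE.
have En : (\int[mu2]_x (EFin \o (F \o swap2))^\- x =
    \int[mu2]_x (EFin \o F)^\- (swap2 x))%E.
  by apply: eq_integral => x _; rewrite !funenegE.
rewrite [X in (X - _)%E](ge0_integral_swap2 (measurable_funepos mF) (funepos_ge0 _)).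
rewrite [X in (_ - X)%E = _](ge0_integral_swap2 (measurable_funeneg mF) (funeneg_ge0 _)).
rewrite -Ep -En; reflexivity.
Qed.

End PlaneIntegral.

(** * Integrals on the line and measurability *)

Section RealLine.
Variable R : realType.
Notation mu := (@lebesgue_measure R).
Notation RT := (measurableTypeR R).

Lemma integral_is_derive (g S : R -> R) (a b : R) : a < b ->
  (forall x, a <= x <= b -> is_derive x 1 S (g x) /\ {for x, continuous g}) ->
  (\int[mu]_(x in `[a, b]) (g x)%:E = (S b - S a)%:E)%E.
Proof.
move=> ab H.
have cS x : a <= x <= b -> {for x, continuous S}.
  move=> /H[dS _]; apply: differentiable_continuous; apply/derivable1_diffP.
  exact: ex_derive.
rewrite (@continuous_FTC2 R g S a b ab)//.
- apply: continuous_in_subspaceT => x; rewrite inE/= in_itv/=.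
  by move=> /H[].
- split.
  + move=> x; rewrite in_itv/= => /andP[ax xb].
    by have [|? _] := H x; [rewrite !ltW|exact: ex_derive].
  + by apply: cvg_at_right_filter; apply: cS; rewrite lexx ltW.
  + by apply: cvg_at_left_filter; apply: cS; rewrite lexx ltW.
- move=> x; rewrite in_itv/= => /andP[ax xb].
  by have [|? _] := H x; [rewrite !ltW|rewrite derive1E derive_val].
Qed.

Lemma bigcup_itv_posE :
  `]0, +oo[%classic = \bigcup_n `[(n.+2%:R^-1)%R, n.+2%:R%R]%classic :> set R.
Proof.
apply/seteqP; split => x /=; rewrite in_itv/= andbT => x0.
- pose m := (Num.truncn x + Num.truncn x^-1)%N.
  have n0 : (0 : R) < m.+2%:R by [].
  exists m => //=; rewrite in_itv/=; apply/andP; split.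
    rewrite -[x]invrK lef_pV2 ?posrE ?invr_gt0//.
    apply: (le_trans (ltW (truncnS_gt x^-1))).
    by rewrite ler_nat ltnS leqW// leq_addl.
  apply: (le_trans (ltW (truncnS_gt x))).
  by rewrite ler_nat ltnS leqW// leq_addr.
- by case: x0 => n _ /=; rewrite in_itv/= => /andP[+ _]; apply: lt_le_trans.
Qed.

(** The half-line is exhausted by the compact intervals [1/n, n] with n >= 2, which stay away from a
    possible singularity of [g] at 0; monotone convergence concludes. *)
Lemma ge0_integral_itv_pos_le (g S : R -> R) (M : R) :
  (forall x : R, 0 < x -> is_derive x 1 S (g x)) ->
  (forall x : R, 0 < x -> {for x, continuous g}) ->
  (forall x : R, 0 < x -> 0 <= g x) ->
  (forall x y : R, 0 < x -> 0 < y -> S y - S x <= M) ->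
  (\int[mu]_(x in `]0%R, +oo[) (g x)%:E <= M%:E)%E.
Proof.
move=> dS cg g0 SM.
have In n : (\int[mu]_(x in `[(n.+2%:R^-1)%R, n.+2%:R%R]) (g x)%:E =
    (S n.+2%:R - S n.+2%:R^-1)%:E)%E.
  apply: integral_is_derive.
    by rewrite invf_plt ?posrE// (@lt_trans _ _ 1) ?invf_lt1// ?ltr1n.
  move=> x /andP[xn _]; have x0 : 0 < x by apply: lt_le_trans xn; rewrite invr_gt0.
  by split; [exact: dS|exact: cg].
have pos n (x : R) : `[(n.+2%:R^-1)%R, n.+2%:R%R]%classic x -> 0 < x.
  by rewrite /= in_itv/= => /andP[+ _]; apply: lt_le_trans; rewrite invr_gt0.
rewrite bigcup_itv_posE.
have cv : (\int[mu]_(x in `[(n.+2%:R^-1)%R, n.+2%:R%R]) (g x)%:E @[n --> \oo] -->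
    \int[mu]_(x in \bigcup_n `[(n.+2%:R^-1)%R, n.+2%:R%R]%classic) (g x)%:E)%E.
  apply: ge0_nondecreasing_set_cvg_integral => [||i|i x /pos x0].
  - move=> n m nm; rewrite subsetEset => x /=; rewrite !in_itv/= => /andP[nx xn].
    apply/andP; split.
      by rewrite (le_trans _ nx)// lef_pV2 ?posrE// ler_nat !ltnS.
    by rewrite (le_trans xn)// ler_nat !ltnS.
  - by move=> i; exact: measurable_itv.
  - apply/measurable_EFinP; apply: subspace_continuous_measurable_fun => //.
    by apply: continuous_in_subspaceT => x; rewrite inE => /pos; exact: cg.
  - by rewrite lee_fin g0.
rewrite -(cvg_lim _ cv)//; apply: lime_le; first exact: cvgP cv.
apply: nearW => n; rewrite In lee_fin SM// invr_gt0//.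
Qed.

(** One-variable factor of the majorants on the plane: it is of order |t|^(-3/4) at 0 and |t|^(-3/4
    - e) at infinity. Using 1 + |t|^(1/4) rather than 1 + |t| gives it an elementary primitive. *)
Definition psi (e t : R) : R :=
  `|t| `^ (- (3 / 4)) * (1 + `|t| `^ 4^-1) `^ (- (4 * e)).

Lemma psi_ge0 e t : 0 <= psi e t.
Proof. by rewrite mulr_ge0// powR_ge0. Qed.

Lemma psiN e t : psi e (- t) = psi e t.
Proof. by rewrite /psi normrN. Qed.

Lemma measurable_psi e : measurable_fun [set: RT] (psi e : RT -> RT).
Proof.
apply: measurable_funM.
  by apply: (measurableT_comp (measurable_powR _)).
apply: (measurableT_comp (measurable_powR _)); apply: measurable_funD => //.
by apply: (measurableT_comp (measurable_powR _)).
Qed.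

(* Up to a constant, [psi e] is the derivative of [- (1 + t^(1/4))^(1 - 4 e)]. *)
Lemma integral_psi_pos_le (e : R) : 1 / 4 < e ->
  (\int[mu]_(t in `]0%R, +oo[) (psi e t)%:E <= ((e - 1 / 4)^-1)%:E)%E.
Proof.
move=> e4; have : 0 < e - 1 / 4 by rewrite subr_gt0.
have [c cE] : {c | c = e - 1 / 4} by exists (e - 1 / 4).
rewrite -cE => c0.
pose S (t : R) : R := - c^-1 * (1 + t `^ 4^-1) `^ (- (4 * c)).
have q1 (t : R) : 1 <= 1 + t `^ 4^-1 by rewrite lerDl powR_ge0.
have q0 (t : R) : 0 < 1 + t `^ 4^-1 by apply: lt_le_trans (q1 t).
have dq (x : R) : 0 < x -> is_derive x 1 (fun t : R => 1 + t `^ 4^-1) (4^-1 * x `^ (- (3 / 4))).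
  move=> x0; have := is_derive1_powR 4^-1 x0.
  have -> : (4^-1 - 1 : R) = - (3 / 4) by field.
  move=> d; have := is_deriveD (is_derive_cst (1 : R) x 1) d.
  by rewrite add0r.
have dpsi (x : R) : 0 < x -> is_derive x 1 S (psi e x).
  move=> x0.
  have := is_derive1_powR (- (4 * c)) (q0 x) => d1.
  have d2 := @is_derive1_comp R (fun t : R => t `^ (- (4 * c)))
    (fun t : R => 1 + t `^ 4^-1) x _ _ d1 (dq x x0).
  have d3 := is_deriveZ (- c^-1) d2.
  apply: (is_derive_eq d3).
  rewrite /psi gtr0_norm// /GRing.scale/=.
  have -> : - (4 * c) - 1 = - (4 * e) by rewrite cE; field.
  by field; rewrite gt_eqF.
have SM (x y : R) : 0 < x -> 0 < y -> S y - S x <= c^-1.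
  move=> x0 y0; rewrite /S.
  have H (t : R) : 0 < t -> 0 <= (1 + t `^ 4^-1) `^ (- (4 * c)) <= 1.
    move=> t0; rewrite powR_ge0/= powRN invf_le1 ?powR_gt0//.
    have c4 : 0 <= 4 * c by rewrite mulr_ge0// ltW.
    by have := ler_powR (q1 t) c4; rewrite powRr0.
  have /andP[Hx0 Hx1] := H _ x0; have /andP[Hy0 Hy1] := H _ y0.
  have ci : 0 <= c^-1 by rewrite invr_ge0 ltW.
  move: (_ `^ _) (_ `^ _) Hx1 Hy0 => P Q P1 Q0.
  by rewrite !mulNr opprK addrC -mulrBr -[leRHS]mulr1 ler_wpM2l// -[leRHS]subr0 lerB.
apply: (@ge0_integral_itv_pos_le (psi e) S).
- move=> x x0; rewrite /psi.
  have cp (a y : R) : 0 < y -> {for y, continuous (fun t : R => t `^ a)}.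
    move=> y0; apply: differentiable_continuous; apply/derivable1_diffP.
    by apply: derivable_powR; rewrite in_itv/= y0.
  have cn : {for x, continuous (fun t : R => `|t|)} by exact: norm_continuous.
  have nx : 0 < `|x| by rewrite normr_gt0 gt_eqF.
  have cpn (a : R) : {for x, continuous (fun t : R => `|t| `^ a)}.
    exact: (@continuous_comp _ _ _ (fun t : R => `|t|) (fun s : R => s `^ a) x cn
      (cp a _ nx)).
  apply: continuousM; first exact: cpn.
  apply: (@continuous_comp _ _ _ (fun t : R => 1 + `|t| `^ 4^-1)
    (fun s : R => s `^ (- (4 * e)))); last by apply: cp; exact: q0.
  by apply: continuousD; [exact: cst_continuous|exact: cpn].
- by move=> x _; exact: psi_ge0.
- exact: SM.
Qed.

Lemma integral_psi_lty (e : R) : 1 / 4 < e ->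
  (\int[mu]_t (psi e t)%:E < +oo)%E.
Proof.
move=> e4.
have mpsi : measurable_fun [set: R] (fun t => (psi e t)%:E).
  by apply/measurable_EFinP; exact: measurable_psi.
have p0 t : (0 <= (psi e t)%:E)%E by rewrite lee_fin psi_ge0.
have Ipos : (\int[mu]_(t in `]0%R, +oo[) (psi e t)%:E < +oo)%E.
  by apply: le_lt_trans (integral_psi_pos_le e4) _; rewrite ltry.
have -> : [set: R] = `]-oo, 0]%classic `|` `]0, +oo[%classic.
  by rewrite -itv_bndbnd_setU// set_itvE.
rewrite ge0_integral_setU//=; last 2 first.
- exact: measurable_funS mpsi.
- by apply/disj_setPS => x [/=]; rewrite !in_itv/= andbT leNgt => /negP.
apply: lte_add_pinfty => //.
have := ge0_integration_by_substitution0 mpsi p0.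
under [X in _ = X -> _]eq_integral do rewrite psiN.
move=> <-; rewrite -integral_itv_obnd_cbnd//.
exact: measurable_funS mpsi.
Qed.

Notation mu2 := (plane_measure R).

Lemma pintegrable_psi2 (e : R) : 1 / 4 < e ->
  pintegrable (fun z : R * R => psi e z.1 * psi e z.2).
Proof.
move=> e4.
have mpsi1 : measurable_fun [set: RT * RT] (fun z : RT * RT => psi e z.1).
  exact: (measurableT_comp (measurable_psi e)).
have mpsi2 : measurable_fun [set: RT * RT] (fun z : RT * RT => psi e z.2).
  exact: (measurableT_comp (measurable_psi e)).
have mF : measurable_fun [set: RT * RT]
    (EFin \o (fun z : RT * RT => psi e z.1 * psi e z.2)).
  by apply/measurable_EFinP; exact: (measurable_funM mpsi1 mpsi2).
apply: (proj2 (integrable12ltyP mu mu mF)).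
under eq_integral => x _.
  under eq_integral => y _.
    rewrite /= ger0_norm ?mulr_ge0 ?psi_ge0// EFinM; over.
  rewrite ge0_integralZl//=; last 3 first.
  - by apply/measurable_EFinP; exact: measurable_psi.
  - by move=> y _; rewrite lee_fin psi_ge0.
  - by rewrite lee_fin psi_ge0.
  over.
have mpsi : measurable_fun [set: RT] (fun t : RT => (psi e t)%:E).
  by apply/measurable_EFinP; exact: measurable_psi.
have ipsi := integral_psi_lty e4.
have psi0 : (0 <= \int[mu]_x (psi e x)%:E)%E.
  by apply: integral_ge0 => x _; rewrite lee_fin psi_ge0.
rewrite ge0_integralZr//=; last by move=> x _; rewrite lee_fin psi_ge0.
by rewrite lte_mul_pinfty// ge0_fin_numE.
Qed.

Lemma pmeasurable_fst : pmeasurable (fun z : R * R => z.1).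
Proof. exact: measurable_fst. Qed.

Lemma pmeasurable_snd : pmeasurable (fun z : R * R => z.2).
Proof. exact: measurable_snd. Qed.

Lemma pmeasurable_cst (c : R) : pmeasurable (fun z : R * R => c).
Proof. exact: measurable_cst. Qed.

Lemma pmeasurableD (F G : R * R -> R) : pmeasurable F -> pmeasurable G ->
  pmeasurable (fun z => F z + G z).
Proof. exact: measurable_funD. Qed.

Lemma pmeasurableB (F G : R * R -> R) : pmeasurable F -> pmeasurable G ->
  pmeasurable (fun z => F z - G z).
Proof. exact: measurable_funB. Qed.

Lemma pmeasurableM (F G : R * R -> R) : pmeasurable F -> pmeasurable G ->
  pmeasurable (fun z => F z * G z).
Proof. exact: measurable_funM. Qed.

Lemma pmeasurableX (F : R * R -> R) n : pmeasurable F ->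
  pmeasurable (fun z => F z ^+ n).
Proof. exact: measurable_funX. Qed.

Lemma pmeasurable_powR (F : R * R -> R) (a : R) : pmeasurable F ->
  pmeasurable (fun z => F z `^ a).
Proof. by move=> mF; apply: (measurableT_comp (measurable_powR a) mF). Qed.

Lemma pmeasurable_ln (F : R * R -> R) : pmeasurable F ->
  pmeasurable (fun z => ln (F z)).
Proof. by move=> mF; apply: (measurableT_comp (@measurable_ln R) mF). Qed.

Lemma pmeasurable_normr (F : R * R -> R) : pmeasurable F ->
  pmeasurable (fun z => `|F z|).
Proof. by move=> mF; apply: (measurableT_comp (@normr_measurable R setT) mF). Qed.

Lemma pmeasurable_sqrt (F : R * R -> R) : pmeasurable F ->
  pmeasurable (fun z => Num.sqrt (F z)).
Proof.
move=> mF.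
have ms : measurable_fun [set: RT] (Num.sqrt : RT -> RT).
  by apply: continuous_measurable_fun; exact: sqrt_continuous.
exact: (measurableT_comp ms mF).
Qed.

(** The real power with exponent -1 is the inverse only at nonnegative arguments, hence the detour
    through the square of [F]; both sides are 0 where [F] vanishes. *)
Lemma pmeasurable_inv (F : R * R -> R) : pmeasurable F ->
  pmeasurable (fun z => (F z)^-1).
Proof.
move=> mF.
have E z : (F z)^-1 = F z * (F z ^+ 2) `^ (-1).
  rewrite powR_inv1 ?sqr_ge0//; have [->|F0] := eqVneq (F z) 0.
    by rewrite invr0 mul0r.
  by field.
rewrite /pmeasurable (_ : (fun z => (F z)^-1) =
    (fun z : RT * RT => F z * (F z ^+ 2) `^ (-1))); last by apply/funext.
by apply: (pmeasurableM mF); apply: pmeasurable_powR; exact: pmeasurableX.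
Qed.

Lemma pmeasurable_affine2 (F : R * R -> R) p (h : R) : pmeasurable F ->
  pmeasurable (F \o affine2 p h).
Proof. by move=> mF; apply: (measurableT_comp mF); exact: measurable_affine2. Qed.

Lemma pmeasurable_swap2 (F : R * R -> R) : pmeasurable F ->
  pmeasurable (F \o @swap2 R).
Proof. by move=> mF; apply: (measurableT_comp mF); exact: measurable_swap2. Qed.

Lemma pmeasurable_enorm (F G : R * R -> R) : pmeasurable F -> pmeasurable G ->
  pmeasurable (fun z => enorm (F z, G z)).
Proof.
move=> mF mG; apply: pmeasurable_sqrt.
by apply: pmeasurableD; exact: pmeasurableX.
Qed.

End RealLine.

(** * The dominating functions *)

Section Radial.
Variable R : realType.
Implicit Types (x y z : R * R) (b e r t : R).

Lemma enorm_ge0 x : 0 <= enorm x.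
Proof. exact: sqrtr_ge0. Qed.

Lemma sqr_enorm x : enorm x ^+ 2 = x.1 ^+ 2 + x.2 ^+ 2.
Proof. by rewrite sqr_sqrtr// addr_ge0// sqr_ge0. Qed.

Lemma enormN x : enorm (- x) = enorm x.
Proof. by rewrite /enorm/= !sqrrN. Qed.

Lemma enormB x y : enorm (x - y) = enorm (y - x).
Proof. by rewrite -enormN opprB. Qed.

Lemma enorm_swap2 x : enorm (swap2 x) = enorm x.
Proof. by rewrite /enorm/= addrC. Qed.

Lemma enorm_eq0 x : (enorm x == 0) = (x == 0).
Proof.
case: x => x1 x2; rewrite /enorm sqrtr_eq0 /=.
apply/idP/eqP => [x0|[-> ->]]; last by rewrite expr0n addr0.
have : x1 ^+ 2 + x2 ^+ 2 == 0 by rewrite eq_le x0 addr_ge0// sqr_ge0.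
by rewrite paddr_eq0 ?sqr_ge0// !sqrf_eq0 => /andP[/eqP -> /eqP ->].
Qed.

Lemma enorm_gt0 x : (0 < enorm x) = (x != 0).
Proof. by rewrite lt_neqAle enorm_ge0 andbT eq_sym enorm_eq0. Qed.

Lemma normr_fst_enorm x : `|x.1| <= enorm x.
Proof. by rewrite -sqrtr_sqr ler_sqrt ?lerDl ?addr_ge0 ?sqr_ge0. Qed.

Lemma normr_snd_enorm x : `|x.2| <= enorm x.
Proof. by rewrite -sqrtr_sqr ler_sqrt ?lerDr ?addr_ge0 ?sqr_ge0. Qed.

Lemma ler_enormD x y : enorm (x + y) <= enorm x + enorm y.
Proof.
rewrite -(@ler_pXn2r _ 2) ?nnegrE ?addr_ge0 ?enorm_ge0//.
rewrite [leRHS]sqrrD !sqr_enorm /=.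
have H : x.1 * y.1 + x.2 * y.2 <= enorm x * enorm y.
  rewrite (le_trans (ler_norm _))// -(@ler_pXn2r _ 2) ?nnegrE ?mulr_ge0 ?enorm_ge0//.
  rewrite exprMn !sqr_enorm real_normK ?num_real//.
  rewrite -subr_ge0 (_ : _ - _ = (x.1 * y.2 - x.2 * y.1) ^+ 2) ?sqr_ge0//; ring.
rewrite -subr_ge0 (_ : _ - _ = (enorm x * enorm y - (x.1 * y.1 + x.2 * y.2)) *+ 2); last by ring.
by rewrite mulrn_wge0// subr_ge0.
Qed.

Lemma enorm_le_norms x : enorm x <= `|x.1| + `|x.2|.
Proof.
rewrite -(@ler_pXn2r _ 2) ?nnegrE ?addr_ge0 ?enorm_ge0//.
rewrite sqr_enorm sqrrD !real_normK ?num_real//.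
by rewrite -addrA lerD2l lerDr mulrn_wge0// mulr_ge0.
Qed.

(* Powers of [0] being [0] here, the summand [1] is what makes [radial b]
   dominate the kernels at the origin too. *)
Definition radial b z := (1 + enorm z `^ (- (3 / 2))) * (1 + enorm z) `^ (- b).

Lemma radial_ge0 b z : 0 <= radial b z.
Proof. by rewrite mulr_ge0 ?addr_ge0 ?powR_ge0. Qed.

Lemma pmeasurable_radial b (F G : R * R -> R) : pmeasurable F -> pmeasurable G ->
  pmeasurable (fun z => radial b (F z, G z)).
Proof.
move=> mF mG; apply: pmeasurableM.
  apply: pmeasurableD; first exact: pmeasurable_cst.
  by apply: pmeasurable_powR; exact: pmeasurable_enorm.
apply: pmeasurable_powR; apply: pmeasurableD; first exact: pmeasurable_cst.
exact: pmeasurable_enorm.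
Qed.

(** The constant comes from 1 + |t|^(1/4) <= 2 (1 + r)^(1/4), raised to the power 4 e. *)
Lemma psi_lower e r t : 0 <= e -> 0 < `|t| <= r ->
  r `^ (- (3 / 4)) * (1 + r) `^ (- e) <= 2 `^ (4 * e) * psi e t.
Proof.
move=> e0 /andP[t0 tr]; have r0 : 0 < r := lt_le_trans t0 tr.
rewrite /psi mulrCA; apply: ler_pM; rewrite ?powR_ge0//.
  rewrite !powRN lef_pV2 ?posrE ?powR_gt0//.
  by apply: ge0_ler_powR; rewrite ?nnegrE// ltW.
have q0 : 0 < 1 + `|t| `^ 4^-1 by rewrite ltr_wpDr ?powR_ge0.
have p0 : 0 < 1 + r by rewrite ltr_wpDr// ltW.
rewrite !powRN ler_pdivlMr ?powR_gt0// mulrC ler_pdivrMr ?powR_gt0//.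
have -> : (1 + r) `^ e = ((1 + r) `^ 4^-1) `^ (4 * e).
  by rewrite -powRrM mulrA mulVf// mul1r.
rewrite -(powRM (4 * e) (ler0n R 2) (powR_ge0 (1 + r) 4^-1)).
apply: ge0_ler_powR; rewrite ?nnegrE ?mulr_ge0 ?addr_ge0 ?powR_ge0//.
rewrite mulr_natl mulr2n lerD//.
  have /ler_powR : 1 <= 1 + r by rewrite lerDl ltW.
  by move=> /(_ 0 4^-1); rewrite powRr0; apply; rewrite invr_ge0.
apply: ge0_ler_powR; rewrite ?nnegrE ?invr_ge0 ?addr_ge0// ?(ltW r0)//.
by rewrite (le_trans tr)// lerDr.
Qed.

(** With r = |z|, the product of the bounds for the two coordinates has r^(-3/2) (1 + r)^(-2 e) on
    the left, and [e] is chosen so that -2 e = 3/2 - b. The factor r^(-3/2) (1 + r)^(3/2) dominates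
    both 1 and r^(-3/2), whence the leading 2. The condition b > 2 amounts to e > 1/4, the range
    where [psi e] is integrable. *)
Lemma radial_le_psi b e z : 2 < b -> e = (b - 3 / 2) / 2 ->
  z.1 != 0 -> z.2 != 0 ->
  radial b z <= 2 * (2 `^ (4 * e)) ^+ 2 * (psi e z.1 * psi e z.2).
Proof.
move=> b2 eE z1 z2.
have e0 : 0 <= e by rewrite eE divr_ge0// subr_ge0 (le_trans _ (ltW b2))// ler_pdivrMr//; lra.
have H1 : 0 < `|z.1| <= enorm z by rewrite normr_gt0 z1 normr_fst_enorm.
have H2 : 0 < `|z.2| <= enorm z by rewrite normr_gt0 z2 normr_snd_enorm.
have := ler_pM _ _ (psi_lower e0 H1) (psi_lower e0 H2).
rewrite !mulr_ge0 ?powR_ge0// => /(_ isT isT) H.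
have r0 : 0 < enorm z by move: H1 => /andP[]; apply: lt_le_trans.
rewrite /radial; move: (enorm z) r0 H => r r0 H.
have q0 : 0 < 1 + r by rewrite ltr_wpDr// ltW.
rewrite -mulrA expr2 mulrACA; apply: (le_trans _ (ler_wpM2l _ H)) => //.
have sq a (t : R) : 0 < t -> t `^ a * t `^ a = t `^ (a + a).
  by move=> t0; rewrite powRD// (gt_eqF t0) implybT.
rewrite mulrACA !sq//.
have -> : - (3 / 4) + - (3 / 4) = - (3 / 2) :> R by field.
have -> : - e + - e = (3 / 2) + - b by rewrite eE; field.
have -> : (1 + r) `^ (3 / 2 + - b) = (1 + r) `^ (3 / 2) * (1 + r) `^ (- b).
  by rewrite powRD// (gt_eqF q0) implybT.
rewrite (mulrA (r `^ _)) (mulrA 2) ler_wpM2r ?powR_ge0//.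
have h1 : 1 <= r `^ (- (3 / 2)) * (1 + r) `^ (3 / 2).
  rewrite powRN ler_pdivlMl ?powR_gt0// mulr1.
  by apply: ge0_ler_powR; rewrite ?nnegrE ?lerDr// ltW.
have h2 : r `^ (- (3 / 2)) <= r `^ (- (3 / 2)) * (1 + r) `^ (3 / 2).
  rewrite ler_peMr ?powR_ge0//.
  have /ler_powR : 1 <= 1 + r by rewrite lerDl ltW.
  by move=> /(_ 0 (3 / 2)); rewrite powRr0; apply.
by rewrite [leRHS]mulr_natl [leRHS]mulr2n lerD.
Qed.

Notation mu := (@lebesgue_measure R).
Notation RT := (measurableTypeR R).
Notation mu2 := (plane_measure R).

(** On the axes one factor is [psi e 0], which is 0 by the convention on powers of 0, while
    [radial b] is positive; the majorisation holds only off this null set. *)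
Let axes : set (RT * RT) := [set 0] `*` setT `|` setT `*` [set 0].

Let measurable_axes : measurable axes.
Proof. by apply: measurableU; apply: measurableX => //; exact: measurable_set1. Qed.

Let axes0 : mu2 axes = 0%E.
Proof.
apply/eqP; rewrite eq_le measure_ge0 andbT.
have /le_trans-> // : (mu2 axes <= mu2 ([set 0%R] `*` setT) + mu2 (setT `*` [set 0%R]))%E.
  by apply: measureU2; apply: measurableX => //; exact: measurable_set1.
rewrite /plane_measure !product_measure1E//=.
by rewrite lebesgue_measure_set1 mule0 mul0e adde0.
Qed.

Lemma pintegrable_radial b : 2 < b -> pintegrable (radial b).
Proof.
move=> b2; pose e := (b - 3 / 2) / 2.
have e4 : 1 / 4 < e by rewrite /e; lra.
have mr : measurable_fun setT (EFin \o radial b : RT * RT -> \bar R).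
  apply/measurable_EFinP.
  rewrite (_ : radial b = (fun z => radial b (z.1, z.2))); last by apply/funext => -[].
  by apply: pmeasurable_radial; [exact: pmeasurable_fst|exact: pmeasurable_snd].
apply: (proj2 (negligible_integrable measurable_axes measurableT mr axes0)).
have ip := pintegrableZ (2 * (2 `^ (4 * e)) ^+ 2) (pintegrable_psi2 e4).
have := integrableS measurableT (measurableC measurable_axes) (@subsetT _ _) ip.
rewrite -setTD; apply: le_integrable.
- exact: measurableD.
- exact: measurable_funS mr.
- move=> z [_ /= zN]; rewrite lee_fin ger0_norm ?radial_ge0//.
  rewrite (le_trans _ (ler_norm _))// (radial_le_psi (e := e))//.
  + by apply/eqP => z0; apply: zN; left.
  + by apply/eqP => z0; apply: zN; right.
Qed.

End Radial.

(** * The Newton kernel *)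

Section Kernels.
Variable R : realType.
Implicit Types (x y z w d : R * R).

(* [newtonK] is the first partial derivative of [ln |z|], and [(ker_a, ker_b)] is
   the gradient of the regularised kernel [z.1 / (1 + |z|^2)], which is even. *)
Definition newtonK z : R := z.1 / (z.1 ^+ 2 + z.2 ^+ 2).
Definition ker_a w : R :=
  (1 + w.2 ^+ 2 - w.1 ^+ 2) / (1 + w.1 ^+ 2 + w.2 ^+ 2) ^+ 2.
Definition ker_b w : R :=
  - (2 * w.1 * w.2) / (1 + w.1 ^+ 2 + w.2 ^+ 2) ^+ 2.
(** Integrated against [f], this gives V(d) - V(0) minus the candidate affine part. The regularised
    gradient agrees with the true one to leading order at infinity, so the kernel decays like
    |w|^-3, while near w = 0 and w = d it is no worse than an inverse distance. *)
Definition taylorK d w : R :=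
  newtonK (d - w) - newtonK (- w) - (ker_a w * d.1 + ker_b w * d.2).

Lemma norm_newtonK z : `|newtonK z| <= (enorm z)^-1.
Proof.
rewrite /newtonK -sqr_enorm; have [->|z0] := eqVneq z 0.
  by rewrite mul0r normr0 invr_ge0 enorm_ge0.
have r0 : 0 < enorm z by rewrite enorm_gt0.
rewrite normrM normfV normrX (ger0_norm (enorm_ge0 z)) ler_pdivrMr ?exprn_gt0//.
by rewrite expr2 mulKf ?gt_eqF// normr_fst_enorm.
Qed.

Lemma ker_ab_denom_gt0 w : 0 < 1 + w.1 ^+ 2 + w.2 ^+ 2.
Proof. by rewrite -addrA ltr_wpDr// addr_ge0// sqr_ge0. Qed.

Lemma norm_ker_a w : `|ker_a w| <= (1 + enorm w ^+ 2)^-1.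
Proof.
have D0 := ker_ab_denom_gt0 w; rewrite sqr_enorm addrA /ker_a.
rewrite normrM normfV normrX (gtr0_norm D0) ler_pdivrMr ?exprn_gt0//.
rewrite expr2 mulKf ?gt_eqF// ler_norml.
by have := sqr_ge0 w.1; have := sqr_ge0 w.2; move=> h1 h2; apply/andP; split; lra.
Qed.

Lemma norm_ker_b w : `|ker_b w| <= (1 + enorm w ^+ 2)^-1.
Proof.
have D0 := ker_ab_denom_gt0 w; rewrite sqr_enorm addrA /ker_b.
rewrite mulNr normrN normrM normfV [X in _ / X]normrX (gtr0_norm D0) ler_pdivrMr ?exprn_gt0//.
rewrite expr2 mulKf ?gt_eqF// ler_norml.
have h1 := sqr_ge0 (w.1 + w.2); have h2 := sqr_ge0 (w.1 - w.2).
rewrite !expr2 in h1 h2 *; apply/andP; split; lra.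
Qed.

(* Real part of [1 / (z + d) - 1 / z + d / z^2 = d^2 / (z^2 (z + d))]. *)
Lemma taylor_newtonK z d : z != 0 -> z + d != 0 ->
  `|newtonK (z + d) - newtonK z -
    ((z.2 ^+ 2 - z.1 ^+ 2) * d.1 - 2 * z.1 * z.2 * d.2) / (z.1 ^+ 2 + z.2 ^+ 2) ^+ 2|
  <= enorm d ^+ 2 / (enorm z ^+ 2 * enorm (z + d)).
Proof.
rewrite -!enorm_gt0 => r0 s0.
have hz := sqr_enorm z; have hs := sqr_enorm (z + d); have hd := sqr_enorm d.
rewrite /newtonK -hz -hs.
move: z d r0 s0 hz hs hd => [z1 z2] [d1 d2] /= r0 s0 hz hs hd.
(* Real and imaginary parts of d^2, and in [W1], [W2] those of z^2 (z + d); the numerator D1 W1 + D2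
   W2 is then bounded by Cauchy-Schwarz. *)
pose D1 := d1 ^+ 2 - d2 ^+ 2; pose D2 := 2 * d1 * d2.
pose W1 := (z1 ^+ 2 - z2 ^+ 2) * (z1 + d1) - 2 * z1 * z2 * (z2 + d2).
pose W2 := (z1 ^+ 2 - z2 ^+ 2) * (z2 + d2) + 2 * z1 * z2 * (z1 + d1).
move: (enorm (z1, z2)) (enorm ((z1, z2) + (d1, d2))) (enorm (d1, d2)) (enorm_ge0 (d1, d2))
  r0 s0 hz hs hd => r s e e0 r0 s0 hz hs hd.
have -> : (z1 + d1) / s ^+ 2 - z1 / r ^+ 2 -
    ((z2 ^+ 2 - z1 ^+ 2) * d1 - 2 * z1 * z2 * d2) / (r ^+ 2) ^+ 2 =
    (D1 * W1 + D2 * W2) / ((r ^+ 2) ^+ 2 * s ^+ 2).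
  have rn : z1 ^+ 2 + z2 ^+ 2 != 0 by rewrite -hz gt_eqF// exprn_gt0.
  have sn : (z1 + d1) ^+ 2 + (z2 + d2) ^+ 2 != 0 by rewrite -hs gt_eqF// exprn_gt0.
  rewrite hz hs /D1 /D2 /W1 /W2; field.
  by apply/andP; split.
have CS : `|D1 * W1 + D2 * W2| <= e ^+ 2 * (r ^+ 2 * s).
  rewrite -(@ler_pXn2r _ 2) ?nnegrE ?mulr_ge0 ?exprn_ge0 ?(ltW r0) ?(ltW s0)//.
  rewrite real_normK ?num_real//.
  have -> : (e ^+ 2 * (r ^+ 2 * s)) ^+ 2 = (D1 ^+ 2 + D2 ^+ 2) * (W1 ^+ 2 + W2 ^+ 2).
    transitivity ((e ^+ 2) ^+ 2 * ((r ^+ 2) ^+ 2 * s ^+ 2)); first by ring.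
    by rewrite hz hs hd /D1 /D2 /W1 /W2; ring.
  rewrite -subr_ge0 (_ : _ - _ = (D1 * W2 - D2 * W1) ^+ 2) ?sqr_ge0//; ring.
rewrite normrM normfV [X in _ / X]ger0_norm ?mulr_ge0 ?exprn_ge0 ?(ltW r0) ?(ltW s0)//.
rewrite ler_pdivrMr ?mulr_gt0 ?exprn_gt0//.
apply: (le_trans CS); apply: eq_ler.
by field; rewrite !gt_eqF.
Qed.

(** With r = |w|, replacing r^-4 by (1 + r^2)^-2 costs at most 3 r^-6, against a numerator of size 2
    r^2; the additional 1 in the numerator of [ker_a] costs r^-4. The total 7 r^-4 is below 8
    r^-3. *)
Lemma ker_ab_far w d : 1 <= enorm w -> enorm d <= 1 ->
  `|ker_a w * d.1 + ker_b w * d.2 -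
    ((w.2 ^+ 2 - w.1 ^+ 2) * d.1 - 2 * w.1 * w.2 * d.2) / (w.1 ^+ 2 + w.2 ^+ 2) ^+ 2|
  <= 8 / enorm w ^+ 3.
Proof.
move=> r1 d1.
have a1 : `|w.2 ^+ 2 - w.1 ^+ 2| <= enorm w ^+ 2.
  rewrite sqr_enorm ler_norml; have := sqr_ge0 w.1; have := sqr_ge0 w.2.
  by move=> h1 h2; apply/andP; split; lra.
have b1 : `|2 * w.1 * w.2| <= enorm w ^+ 2.
  rewrite sqr_enorm ler_norml.
  have h1 := sqr_ge0 (w.1 + w.2); have h2 := sqr_ge0 (w.1 - w.2).
  by rewrite !expr2 in h1 h2 *; apply/andP; split; lra.
have e1 : `|d.1| <= 1 := le_trans (normr_fst_enorm d) d1.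
have e2 : `|d.2| <= 1 := le_trans (normr_snd_enorm d) d1.
rewrite /ker_a /ker_b -sqr_enorm.
have -> : 1 + w.1 ^+ 2 + w.2 ^+ 2 = 1 + enorm w ^+ 2 by rewrite sqr_enorm addrA.
have -> : 1 + w.2 ^+ 2 - w.1 ^+ 2 = 1 + (w.2 ^+ 2 - w.1 ^+ 2) by ring.
move: (enorm w) (w.2 ^+ 2 - w.1 ^+ 2) (2 * w.1 * w.2) (d.1) (d.2) r1 a1 b1 e1 e2.
clear => r A B p q r1 a1 b1 e1 e2.
have r0 : 0 < r by apply: lt_le_trans r1.
pose E := (1 + r ^+ 2) ^- 2 - (r ^+ 2) ^- 2.
have -> : (1 + A) / (1 + r ^+ 2) ^+ 2 * p + - B / (1 + r ^+ 2) ^+ 2 * q -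
   (A * p - B * q) / (r ^+ 2) ^+ 2 = p / (1 + r ^+ 2) ^+ 2 + (A * p - B * q) * E.
  by rewrite /E; ring.
have r2 : r ^+ 2 <= 1 + r ^+ 2 by rewrite lerDr.
have r20 : 0 < r ^+ 2 by rewrite exprn_gt0.
have hE : `|E| <= 3 / (r ^+ 2) ^+ 3.
  rewrite /E distrC ger0_norm; last first.
    rewrite subr_ge0 lef_pV2 ?posrE ?exprn_gt0//; last exact: lt_le_trans r2.
    by rewrite ler_pXn2r ?nnegrE ?(ltW r20)//; exact: le_trans (ltW r20) r2.
  have q0 : 0 < 1 + r ^+ 2 by apply: lt_le_trans r2.
  have rr : 1 <= r ^+ 2 by rewrite exprn_ege1.
  move: (r ^+ 2) r20 q0 rr {r2 r0 r1 a1 b1 E} => s s0 q0 s1.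
  have -> : s ^- 2 - (1 + s) ^- 2 = (1 + 2 * s) / (s ^+ 2 * (1 + s) ^+ 2).
    by field; rewrite !gt_eqF.
  rewrite ler_pdivrMr ?mulr_gt0 ?exprn_gt0// mulrAC ler_pdivlMr ?exprn_gt0//.
  rewrite -subr_ge0 (_ : _ - _ = s ^+ 2 * (3 + 5 * s + s ^+ 2 )); last by ring.
  by rewrite mulr_ge0 ?exprn_ge0 ?addr_ge0 ?mulr_ge0 ?exprn_ge0 ?ltW.
have h1 : `|p / (1 + r ^+ 2) ^+ 2| <= 1 / (r ^+ 2) ^+ 2.
  rewrite normrM; apply: ler_pM => //.
  rewrite ger0_norm ?invr_ge0 ?exprn_ge0//; last exact: le_trans (ltW r20) r2.
  rewrite lef_pV2 ?posrE ?exprn_gt0//; last exact: lt_le_trans r2.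
  by rewrite ler_pXn2r ?nnegrE ?(ltW r20)//; exact: le_trans (ltW r20) r2.
have h2 : `|(A * p - B * q) * E| <= (2 * r ^+ 2) * (3 / (r ^+ 2) ^+ 3).
  rewrite normrM; apply: ler_pM => //.
  rewrite (le_trans (ler_normB _ _))// !normrM mulr_natl mulr2n.
  by apply: lerD; rewrite -[leRHS]mulr1 ler_pM.
apply: (le_trans (ler_normD _ _)); apply: (le_trans (lerD h1 h2)).
have -> : 1 / (r ^+ 2) ^+ 2 + 2 * r ^+ 2 * (3 / (r ^+ 2) ^+ 3) = 7 / r ^+ 4.
  by field; rewrite gt_eqF.
rewrite ler_pdivrMr ?exprn_gt0// mulrAC ler_pdivlMr ?exprn_gt0//.
rewrite [r ^+ 4]exprS [8 * _]mulrA ler_wpM2r ?exprn_ge0 ?(ltW r0)//.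
by rewrite (le_trans _ (ler_peMr _ r1))// ler_nat.
Qed.

Lemma radial_lower b z (M : R) : 0 <= b -> 0 < M -> enorm z <= M ->
  (1 + M) `^ (- b) <= radial b z.
Proof.
move=> b0 M0 zM.
have q0 : 0 < 1 + enorm z by rewrite ltr_wpDr ?enorm_ge0.
apply: (@le_trans _ _ ((1 + enorm z) `^ (- b))).
  rewrite !powRN lef_pV2 ?posrE ?powR_gt0//; last by rewrite ltr_wpDr// ltW.
  by apply: ge0_ler_powR; rewrite ?nnegrE ?lerD2l// ltW// ltr_wpDr// ltW.
by rewrite /radial ler_peMl ?powR_ge0// lerDl powR_ge0.
Qed.

Lemma inv_le_radial b z (M : R) : 0 <= b -> 0 < M -> enorm z <= M ->
  (enorm z)^-1 <= (1 + M) `^ b * radial b z.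
Proof.
move=> b0 M0 zM; have r0 := enorm_ge0 z.
have q0 : 0 < 1 + enorm z by rewrite ltr_wpDr ?enorm_ge0.
have h1 : (enorm z)^-1 <= 1 + enorm z `^ (- (3 / 2)).
  have [z0|z0] := eqVneq (enorm z) 0.
    by rewrite z0 invr0 addr_ge0 ?powR_ge0.
  have rp : 0 < enorm z by rewrite lt_neqAle eq_sym z0.
  have [r1|r1] := leP 1 (enorm z).
    by rewrite (@le_trans _ _ 1) ?invf_le1// lerDl powR_ge0.
  rewrite -powR_inv1// (@le_trans _ _ (enorm z `^ (- (3 / 2))))// ?lerDr//.
  by apply: ger_powR; [rewrite rp ltW|rewrite lerN2; lra].
have h2 : 1 <= (1 + M) `^ b * (1 + enorm z) `^ (- b).
  rewrite powRN ler_pdivlMr ?powR_gt0// mul1r.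
  by apply: ge0_ler_powR; rewrite ?nnegrE ?lerD2l// ltW// ltr_wpDr// ltW.
by rewrite /radial mulrCA (le_trans h1)// ler_peMr// addr_ge0// powR_ge0.
Qed.

Lemma cube_inv_le_radial z : 1 <= enorm z -> (enorm z ^+ 3)^-1 <= 8 * radial 3 z.
Proof.
move=> r1; have r0 : 0 < enorm z by apply: lt_le_trans r1.
have q0 : 0 < 1 + enorm z by rewrite ltr_wpDr ?enorm_ge0.
have h : (enorm z ^+ 3)^-1 <= 8 * (1 + enorm z) `^ (- 3).
  rewrite powR_invn ?(ltW q0)// ler_pdivlMr ?exprn_gt0// mulrC ler_pdivrMr ?exprn_gt0//.
  have -> : 8 * enorm z ^+ 3 = (2 * enorm z) ^+ 3 by ring.
  by rewrite ler_pXn2r ?nnegrE ?mulr_ge0 ?(ltW q0) ?(ltW r0)// mulr_natl mulr2n lerD2r.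
by rewrite (le_trans h)// ler_wpM2l// /radial ler_peMl ?powR_ge0// lerDl powR_ge0.
Qed.

Lemma one_le_radial z : enorm z <= 2 -> 1 <= 27 * radial 3 z.
Proof.
move=> z2; have h := radial_lower (ler0n R 3) (ltr0n R 2) z2.
have e3 : 1 + 2 = 3%:R :> R by ring.
have E : 3%:R ^+ 3 = 27 :> R by ring.
move: h; rewrite e3 (powR_invn 3 (ler0n R 3)) E.
by move: (radial 3 z); clear => p h; lra.
Qed.

Lemma inv_le_radial3 z : enorm z <= 3 -> (enorm z)^-1 <= 64 * radial 3 z.
Proof.
move=> z3; have := inv_le_radial (ler0n R 3) (ltr0n R 3) z3.
have e3 : 1 + 3 = 4%:R :> R by ring.
have E : 4%:R ^+ 3 = 64 :> R by ring.
by rewrite e3 (powR_mulrn 3 (ler0n R 4)) E.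
Qed.

(** For |w| <= 2 the terms are bounded one by one. For |w| > 2 one has |w - d| >= |w| / 2, and both
    the Taylor remainder of the true kernel and the error of the regularisation are O(|w|^-3). The
    constant 400 is not optimised. *)
Lemma norm_taylorK : exists2 C : R, 0 <= C & forall d w, enorm d <= 1 ->
  `|taylorK d w| <= C * (radial 3 w + radial 3 (w - d)).
Proof.
exists 400; first exact: ler0n.
move=> d w d1; have r0 := radial_ge0 3 w; have s0 := radial_ge0 3 (w - d).
have [r2|r2] := leP (enorm w) 2.
- have s3 : enorm (w - d) <= 3.
    by rewrite (le_trans (ler_enormD _ _))// enormN (_ : 3 = 2 + 1 :> R) ?lerD//; ring.
  have h1 : `|newtonK (d - w)| <= 64 * radial 3 (w - d).
    by apply: le_trans (norm_newtonK _) _; rewrite enormB; exact: inv_le_radial3.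
  have h2 : `|newtonK (- w)| <= 64 * radial 3 w.
    apply: le_trans (norm_newtonK _) _; rewrite enormN; apply: inv_le_radial3.
    by rewrite (le_trans r2)// ler_nat.
  have q1 : (1 + enorm w ^+ 2)^-1 <= 1.
    by rewrite invf_le1 ?lerDl ?exprn_ge0 ?enorm_ge0// ltr_wpDr// exprn_ge0 ?enorm_ge0.
  have h3 := one_le_radial r2.
  have h4 : `|ker_a w * d.1 + ker_b w * d.2| <= 2.
    have p1 (u v : R) : `|u| <= 1 -> `|v| <= 1 -> `|u * v| <= 1.
      by move=> u1 v1; rewrite normrM -[leRHS]mulr1 ler_pM.
    rewrite (le_trans (ler_normD _ _))// -[leRHS]/(1 + 1) lerD// p1//.
    + exact: le_trans (norm_ker_a _) q1.
    + exact: le_trans (normr_fst_enorm _) d1.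
    + exact: le_trans (norm_ker_b _) q1.
    + exact: le_trans (normr_snd_enorm _) d1.
  rewrite /taylorK (le_trans (ler_normB _ _))//.
  apply: (le_trans (lerD (le_trans (ler_normB _ _) (lerD h1 h2)) h4)).
  by move: (radial 3 w) (radial 3 (w - d)) r0 s0 h3; clear => p q; lra.
- have w0 : - w != 0 by rewrite oppr_eq0 -enorm_gt0 (lt_trans _ r2).
  have rs : enorm w <= enorm (w - d) + 1.
    by have := ler_enormD (w - d) d; rewrite subrK => /le_trans; apply; rewrite lerD2l.
  have sr : enorm w / 2 <= enorm (w - d).
    by move: (enorm w) (enorm (w - d)) r2 rs; clear => p q; lra.
  have sp : 0 < enorm (w - d) by rewrite (lt_le_trans _ sr)// divr_gt0// (lt_trans _ r2).
  have wd0 : - w + d != 0 by rewrite addrC -enorm_gt0 enormB.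
  have := taylor_newtonK w0 wd0; have := ker_ab_far (ltW (lt_trans _ r2)) d1.
  rewrite ltr1n => /(_ isT); rewrite /= !sqrrN enormN (addrC (- w)) enormB !mulrN.
  rewrite (mulNr (2 * w.1)) opprK.
  move=> k1 k2.
  rewrite /taylorK.
  have -> : newtonK (d - w) - newtonK (- w) - (ker_a w * d.1 + ker_b w * d.2) =
    (newtonK (d - w) - newtonK (- w) -
       ((w.2 ^+ 2 - w.1 ^+ 2) * d.1 - 2 * w.1 * w.2 * d.2) / (w.1 ^+ 2 + w.2 ^+ 2) ^+ 2) -
    (ker_a w * d.1 + ker_b w * d.2 -
       ((w.2 ^+ 2 - w.1 ^+ 2) * d.1 - 2 * w.1 * w.2 * d.2) / (w.1 ^+ 2 + w.2 ^+ 2) ^+ 2).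
    by ring.
  apply: (le_trans (ler_normB _ _)); apply: (le_trans (lerD k2 k1)).
  have k3 : enorm d ^+ 2 / (enorm w ^+ 2 * enorm (w - d)) <= 2 / enorm w ^+ 3.
    have wp : 0 < enorm w by rewrite (lt_trans _ r2).
    rewrite ler_pdivrMr ?mulr_gt0 ?exprn_gt0// mulrAC ler_pdivlMr ?exprn_gt0//.
    apply: (@le_trans _ _ (enorm w ^+ 3)).
      by rewrite ler_piMl ?exprn_ge0 ?enorm_ge0// exprn_ile1 ?enorm_ge0.
    rewrite exprSr mulrCA ler_wpM2l ?exprn_ge0 ?enorm_ge0//.
    by rewrite -ler_pdivrMl// mulrC.
  have k4 : 10 * (enorm w ^+ 3)^-1 <= 10 * (8 * radial 3 w).
    by rewrite ler_wpM2l// cube_inv_le_radial// ltW// (lt_trans _ r2)// ltr1n.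
  apply: (le_trans (lerD k3 (lexx _))); rewrite -mulrDl (_ : 2 + 8 = 10); last by ring.
  apply: (le_trans k4).
  by move: (radial 3 w) (radial 3 (w - d)) r0 s0; clear => p q; lra.
Qed.

End Kernels.

(** * The logarithmic kernel *)

Section LogKernel.
Variable R : realType.
Implicit Types (x y z w d : R * R).

Lemma ln_le_subr1 (t : R) : 0 < t -> ln t <= t - 1.
Proof.
by move=> t0; rewrite -[t in ln t](subrKC 1) le_ln1Dx// ltrBrDl subrr.
Qed.

Lemma dist_ln_le (r s e : R) : 0 < r -> 0 < s -> `|s - r| <= e ->
  `|ln s - ln r| <= e * (r^-1 + s^-1).
Proof.
move=> r0 s0 e1; have e0 : 0 <= e by apply: le_trans e1.
have H (p q : R) : 0 < p -> 0 < q -> `|p - q| <= e -> ln p - ln q <= e * q^-1.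
  move=> p0 q0 pq; rewrite -ln_div ?posrE//.
  apply: (le_trans (ln_le_subr1 (divr_gt0 p0 q0))).
  have -> : p / q - 1 = (p - q) / q by field; rewrite gt_eqF.
  by rewrite ler_wpM2r ?invr_ge0 ?(ltW q0)// (le_trans (ler_norm _)).
have h1 := H s r s0 r0 e1; have h2 := H r s r0 s0; rewrite distrC in h2.
have := h2 e1 => {}h2.
have ri : 0 <= e * r^-1 by rewrite mulr_ge0// invr_ge0 ltW.
have si : 0 <= e * s^-1 by rewrite mulr_ge0// invr_ge0 ltW.
rewrite mulrDr ler_norml; apply/andP; split; last by rewrite (le_trans h1)// lerDl.
by rewrite lerNl opprB (le_trans h2)// lerDr.
Qed.

Lemma dist_enorm x y : `|enorm x - enorm y| <= enorm (x - y).
Proof.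
rewrite ler_norml; apply/andP; split.
  by rewrite lerNl opprB lerBlDr enormB; have := ler_enormD (y - x) x; rewrite subrK.
by rewrite lerBlDr; have := ler_enormD (x - y) y; rewrite subrK.
Qed.

Definition taylor_log d z : R :=
  ln (enorm (z + d)) - ln (enorm z) - (newtonK z * d.1 + newtonK (swap2 z) * d.2).

(* With [1 + u = |z + d|^2 / |z|^2], this is [0 <= u - ln (1 + u) <= u^2 / (1 + u)]. *)
Lemma norm_taylor_log_sqr z d : z != 0 -> z + d != 0 ->
  `|taylor_log d z| <= (enorm d * ((enorm z)^-1 + (enorm (z + d))^-1)) ^+ 2.
Proof.
rewrite -!enorm_gt0 => r0 s0.
have hz := sqr_enorm z; have hs := sqr_enorm (z + d); have hd := sqr_enorm d.
have de : `|enorm (z + d) - enorm z| <= enorm d.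
  by rewrite (le_trans (dist_enorm _ _))// addrAC subrr add0r.
rewrite /taylor_log /newtonK /= (addrC (z.2 ^+ 2)) -hz.
have -> : z.1 / enorm z ^+ 2 * d.1 + z.2 / enorm z ^+ 2 * d.2 =
    (enorm (z + d) ^+ 2 - enorm z ^+ 2 - enorm d ^+ 2) / 2 / enorm z ^+ 2.
  by rewrite hs hz hd /=; field; rewrite -hz gt_eqF// exprn_gt0.
move: (enorm z) (enorm (z + d)) (enorm d) (enorm_ge0 d) r0 s0 de.
clear => r s e e0 r0 s0 de.
have q0 : 0 < s ^+ 2 / r ^+ 2 by rewrite divr_gt0// exprn_gt0.
have lq : ln (s ^+ 2 / r ^+ 2) = 2 * (ln s - ln r).
  by rewrite ln_div ?posrE ?exprn_gt0// !lnXn// -mulrnBl mulr_natl.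
have up := ln_le_subr1 q0.
have q0' : 0 < (s ^+ 2 / r ^+ 2)^-1 by rewrite invr_gt0.
have lo := ln_le_subr1 q0'; rewrite lnV ?posrE// in lo.
have E1 : (s ^+ 2 - r ^+ 2 - e ^+ 2) / 2 / r ^+ 2 =
    (s ^+ 2 / r ^+ 2 - 1) / 2 - e ^+ 2 / r ^+ 2 / 2.
  by field; rewrite gt_eqF.
have E2 : s ^+ 2 / r ^+ 2 + (s ^+ 2 / r ^+ 2)^-1 - 2 = ((s - r) * (r^-1 + s^-1)) ^+ 2.
  by field; rewrite !gt_eqF.
have E3 : ((s - r) * (r^-1 + s^-1)) ^+ 2 <= (e * (r^-1 + s^-1)) ^+ 2.
  rewrite !exprMn ler_wpM2r ?sqr_ge0//.
  by rewrite -[(s - r) ^+ 2]real_normK ?num_real// ler_pXn2r ?nnegrE.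
have E4 : e ^+ 2 / r ^+ 2 <= (e * (r^-1 + s^-1)) ^+ 2.
  rewrite -exprVn -exprMn ler_pXn2r ?nnegrE ?mulr_ge0 ?addr_ge0 ?invr_ge0 ?(ltW r0) ?(ltW s0)//.
  by rewrite ler_wpM2l// lerDl invr_ge0 ltW.
have E5 : 0 <= e ^+ 2 / r ^+ 2 by rewrite divr_ge0// exprn_ge0// ltW.
rewrite E1 {E1}; rewrite lq in up lo.
move: (s ^+ 2 / r ^+ 2) ((s ^+ 2 / r ^+ 2)^-1) (e ^+ 2 / r ^+ 2)
  ((e * (r^-1 + s^-1)) ^+ 2) (((s - r) * (r^-1 + s^-1)) ^+ 2) (ln s) (ln r) up lo E2 E3 E4 E5.
clear => q qi g X Y ls lr up lo E2 E3 E4 E5.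
by rewrite ler_norml; apply/andP; split; lra.
Qed.

Lemma norm_taylor_log_lin z d : z != 0 -> z + d != 0 ->
  `|taylor_log d z| <= 3 * (enorm d * ((enorm z)^-1 + (enorm (z + d))^-1)).
Proof.
rewrite -!enorm_gt0 => r0 s0.
have de : `|enorm (z + d) - enorm z| <= enorm d.
  by rewrite (le_trans (dist_enorm _ _))// addrAC subrr add0r.
have h1 := dist_ln_le r0 s0 de.
have k1 : `|newtonK z * d.1| <= enorm d * (enorm z)^-1.
  by rewrite normrM mulrC ler_pM// ?norm_newtonK// normr_fst_enorm.
have k2 : `|newtonK (swap2 z) * d.2| <= enorm d * (enorm z)^-1.
  rewrite normrM mulrC ler_pM// ?normr_snd_enorm//.
  by rewrite (le_trans (norm_newtonK _))// enorm_swap2.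
have s1 : 0 <= enorm d * (enorm (z + d))^-1.
  by rewrite mulr_ge0 ?enorm_ge0// invr_ge0 enorm_ge0.
rewrite mulrDr in h1 *.
apply: (le_trans (ler_normB _ _)).
apply: (le_trans (lerD h1 (le_trans (ler_normD _ _) (lerD k1 k2)))).
move: (enorm d / enorm z) (enorm d / enorm (z + d)) s1; clear => p q q0; lra.
Qed.

(* Interpolates between the two previous bounds, so that the singularity is
   integrable and the remainder is still [o(|d|)]. *)
Lemma norm_taylor_log z d : z != 0 -> z + d != 0 ->
  `|taylor_log d z| <= 12 * (enorm d `^ (3 / 2) *
    (enorm z `^ (- (3 / 2)) + enorm (z + d) `^ (- (3 / 2)))).
Proof.
move=> z0 zd0; have h1 := norm_taylor_log_sqr z0 zd0.
have h2 := norm_taylor_log_lin z0 zd0.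
move: z0 zd0 h1 h2; rewrite -!enorm_gt0.
move: (enorm z) (enorm (z + d)) (enorm d) (enorm_ge0 d) (`|taylor_log d z|).
clear => r s e e0 q r0 s0 h1 h2.
pose X := r^-1 + s^-1.
have X0 : 0 <= X by rewrite addr_ge0// invr_ge0 ltW.
have t0 : 0 <= e * X by rewrite mulr_ge0.
have h3 : q <= 3 * (e * X) `^ (3 / 2).
  rewrite -/X in h1 h2; move: (e * X) t0 h1 h2; clear => t t0 h1 h2.
  have tp : 0 <= t `^ (3 / 2) by rewrite powR_ge0.
  have [t1|t1] := leP 1 t.
    apply: (le_trans h2); rewrite ler_wpM2l//.
    by apply: le1r_powR => //; lra.
  apply: (le_trans h1).
  have [t00|tn0] := eqVneq t 0; first by rewrite t00 expr0n/= mulr_ge0// powR_ge0.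
  have tt : t ^+ 2 <= t `^ (3 / 2).
    rewrite -powR_mulrn//; apply: ger_powR; last by lra.
    by rewrite lt_neqAle eq_sym tn0 t0 ltW.
  by apply: (le_trans tt); rewrite ler_peMl// ler1n.
have h4 : X `^ (3 / 2) <= 4 * (r `^ (- (3 / 2)) + s `^ (- (3 / 2))).
  have H (a b : R) : 0 < a -> a <= b -> (a^-1 + b^-1) `^ (3 / 2) <= 4 * a `^ (- (3 / 2)).
    move=> a0 ab; have b0 : 0 < b := lt_le_trans a0 ab.
    apply: (@le_trans _ _ ((2 * a^-1) `^ (3 / 2))).
      apply: ge0_ler_powR; rewrite ?nnegrE ?mulr_ge0 ?addr_ge0 ?invr_ge0 ?(ltW a0) ?(ltW b0)//.
      by rewrite mulr_natl mulr2n lerD2l lef_pV2 ?posrE.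
    rewrite powRM ?invr_ge0 ?(ltW a0)//.
    have -> : a^-1 `^ (3 / 2) = a `^ (- (3 / 2)).
      by rewrite -powR_inv1 ?(ltW a0)// -powRrM mulN1r.
    rewrite ler_wpM2r ?powR_ge0//.
    have -> : 4 = 2 `^ 2%:R :> R by rewrite powR_mulrn// expr2 -natrM.
    by apply: ler_powR; [rewrite ler1n|lra].
  have [rs|rs] := leP r s.
    by rewrite (le_trans (H _ _ r0 rs))// ler_wpM2l// lerDl powR_ge0.
  by rewrite /X addrC (le_trans (H _ _ s0 (ltW rs)))// ler_wpM2l// lerDr powR_ge0.
apply: (le_trans h3); rewrite powRM//.
have -> : 12 * (e `^ (3 / 2) * (r `^ (- (3 / 2)) + s `^ (- (3 / 2)))) =
   3 * (e `^ (3 / 2) * (4 * (r `^ (- (3 / 2)) + s `^ (- (3 / 2))))) by ring.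
by rewrite ler_wpM2l// ler_wpM2l// powR_ge0.
Qed.

End LogKernel.

(** * Kernels with mean zero on lines *)

Section NullIntegrals.
Variable R : realType.
Notation mu := (@lebesgue_measure R).
Notation RT := (measurableTypeR R).
Notation mu2 := (plane_measure R).
Implicit Types (F G : R * R -> R) (x y : R * R).

Let measurable_pair_set x y : measurable ([set x; y] : set (RT * RT)).
Proof.
have m1 (z : RT * RT) : measurable [set z].
  case: z => a b; rewrite (_ : [set (a, b)] = [set a] `*` [set b]).
    by apply: measurableX; exact: measurable_set1.
  by apply/seteqP; split => -[u v] /= [-> ->].
by apply: measurableU; exact: m1.
Qed.

Let pair_set0 x y : mu2 [set x; y] = 0%E.
Proof.
have m1 (z : RT * RT) : measurable [set z] /\ mu2 [set z] = 0%E.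
  case: z => a b; rewrite (_ : [set (a, b)] = [set a] `*` [set b]).
    split; first by apply: measurableX; exact: measurable_set1.
    by rewrite /plane_measure product_measure1E//= lebesgue_measure_set1 mul0e.
  by apply/seteqP; split => -[u v] /= [-> ->].
have [mx x0] := m1 x; have [my y0] := m1 y.
apply/eqP; rewrite eq_le measure_ge0 andbT.
have /le_trans-> // : (mu2 ([set x] `|` [set y]) <= mu2 [set x] + mu2 [set y])%E.
  exact: measureU2.
by rewrite [X in (X + _)%E]x0 [X in (_ + X)%E]y0 adde0.
Qed.

Lemma pintegrable_le_off x y F G : pmeasurable F ->
  (forall z, z <> x -> z <> y -> `|F z| <= G z) -> pintegrable G -> pintegrable F.
Proof.
move=> mF FG iG.
have mF' : measurable_fun setT (EFin \o F : RT * RT -> \bar R) by exact/measurable_EFinP.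
apply: (proj2 (negligible_integrable (measurable_pair_set x y) measurableT mF' (pair_set0 x y))).
have := integrableS measurableT (measurableC (measurable_pair_set x y)) (@subsetT _ _) iG.
rewrite -setTD; apply: le_integrable.
- exact: measurableD.
- exact: measurable_funS mF'.
- move=> z [_ /= zN]; rewrite lee_fin (le_trans _ (ler_norm _))// FG//.
  + by move=> zx; apply: zN; left.
  + by move=> zy; apply: zN; right.
Qed.

Lemma ler_norm_pint_off x y F G : pintegrable F -> pintegrable G ->
  (forall z, z <> x -> z <> y -> `|F z| <= G z) -> `|pint F| <= pint G.
Proof.
move=> iF iG FG.
have mN := measurable_pair_set x y; have N0 := pair_set0 x y.
have mD : measurable ([set: RT * RT] `\` [set x; y]) by exact: measurableD.
have E H : pintegrable H -> pint H = \int[mu2]_(z in [set: RT * RT] `\` [set x; y]) H z.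
  move=> iH; rewrite /pint /Rintegral.
  by have := negligible_integral mN measurableT iH N0 => /= ->.
rewrite !E//.
have iF' := integrableS measurableT mD (@subsetT _ _) iF.
have iG' := integrableS measurableT mD (@subsetT _ _) iG.
apply: (le_trans (le_normr_Rintegral mD iF')).
apply: le_Rintegral => //; first exact: integrable_norm.
move=> z [_ /= zN]; apply: FG.
- by move=> zx; apply: zN; left.
- by move=> zy; apply: zN; right.
Qed.

Lemma bigcup_itv_symE : \bigcup_n `[- n.+2%:R, n.+2%:R]%classic = [set: R].
Proof.
apply/seteqP; split => // x _; exists (Num.truncn `|x|) => //=.
rewrite in_itv/= -ler_norml (le_trans (ltW (truncnS_gt _)))//.
by rewrite ler_nat.
Qed.

(** Over [-n, n] the integral is S(n) - S(-n) = O(1/n), and integrability of [g] allows the passage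
    to the limit. *)
Lemma integral_derive_tends0 (g S : R -> R) (C : R) :
  mu.-integrable setT (EFin \o g) ->
  (forall t : R, is_derive t 1 S (g t)) -> continuous g ->
  (forall t : R, 2 <= `|t| -> `|S t| <= C / `|t|) ->
  (\int[mu]_t (g t)%:E = 0)%E.
Proof.
move=> ig dS cg SC.
(* The shift in [n.+2] keeps the endpoints in the range |t| >= 2 where the decay of [S] is
   assumed. *)
pose F n := `[(- n.+2%:R)%R, n.+2%:R%R]%classic : set RT.
have mF n : measurable (F n) by exact: measurable_itv.
have ndF : nondecreasing_seq F.
  move=> n m nm; rewrite subsetEset => x; rewrite /F /= !in_itv/= -!ler_norml.
  by move=> /le_trans; apply; rewrite ler_nat !ltnS.
have mg : measurable_fun setT (EFin \o g : RT -> \bar R) by exact: measurable_int ig.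
have UF : \bigcup_n F n = [set: RT] by exact: bigcup_itv_symE.
have cvp : (\int[mu]_(x in F n) (EFin \o g)^\+ x @[n --> \oo] -->
    \int[mu]_x (EFin \o g)^\+ x)%E.
  rewrite -UF; apply: ge0_nondecreasing_set_cvg_integral => // i.
  exact: measurable_funS (measurable_funepos mg).
have cvn : (\int[mu]_(x in F n) (EFin \o g)^\- x @[n --> \oo] -->
    \int[mu]_x (EFin \o g)^\- x)%E.
  rewrite -UF; apply: ge0_nondecreasing_set_cvg_integral => // i.
  exact: measurable_funS (measurable_funeneg mg).
have cv : (\int[mu]_(x in F n) (g x)%:E @[n --> \oo] --> \int[mu]_x (g x)%:E)%E.
  rewrite integralE; under eq_fun do rewrite integralE.
  apply: cvgeB; [|exact: cvp|exact: cvn].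
  apply: fin_num_adde_defl; rewrite fin_numN.
  by apply: integrable_neg_fin_num => //; exact: ig.
have In n : (\int[mu]_(x in F n) (g x)%:E = (S n.+2%:R - S (- n.+2%:R))%:E)%E.
  apply: integral_is_derive; last by move=> t _; split; [exact: dS|exact: cg].
  by rewrite gtrN.
have cv0 : (S n.+2%:R - S (- n.+2%:R)) @[n --> \oo] --> (0 : R).
  have c1 : (2 * C) * harmonic n @[n --> \oo] --> (0 : R).
    rewrite -[X in _ --> X](mulr0 (2 * C)); apply: cvgMr; exact: cvg_harmonic.
  apply: norm_cvg0; apply: (squeeze_cvgr _ (cvg_cst 0) c1).
  apply: nearW => n; rewrite normr_ge0/= (le_trans (ler_normB _ _))//.
  have n2 : 2 <= n.+2%:R :> R by rewrite ler_nat.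
  have n0 : 0 < n.+2%:R :> R by [].
  have C0 : 0 <= C.
    have := le_trans (normr_ge0 _) (SC 2 _); rewrite ger0_norm// lexx => /(_ isT).
    by rewrite pmulr_lge0// invr_gt0.
  have h1 : `|S n.+2%:R| <= C * harmonic n.
    apply: le_trans (SC _ _) _; rewrite ger0_norm//.
    by rewrite ler_wpM2l// /harmonic lef_pV2 ?posrE// ler_nat.
  have h2 : `|S (- n.+2%:R)| <= C * harmonic n.
    apply: le_trans (SC _ _) _; rewrite normrN ger0_norm//.
    by rewrite ler_wpM2l// /harmonic lef_pV2 ?posrE// ler_nat.
  by rewrite (le_trans (lerD h1 h2))// -mulrDl mulr_natl mulr2n.
have cv0' : (\int[mu]_(x in F n) (g x)%:E @[n --> \oo] --> 0%:E)%E.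
  by under eq_fun do rewrite In; apply: cvg_EFin => //; exact: nearW.
exact: (cvg_unique _ cv cv0').
Qed.

(** Fubini with the first coordinate integrated first. The ordinates [c1] and [c2] are those of the
    singularities of the kernel; the two exempted lines do not affect the outer integral. *)
Lemma pint_null_lines F (c1 c2 : R) : pintegrable F ->
  (forall v, v != c1 -> v != c2 -> exists S : R -> R, exists C : R,
    [/\ forall t : R, is_derive t 1 S (F (t, v)), continuous (fun t => F (t, v)) &
        forall t : R, 2 <= `|t| -> `|S t| <= C / `|t|]) ->
  pint F = 0.
Proof.
move=> iF H; rewrite /pint /Rintegral.
have E := @integral21_prod_meas1 _ _ RT RT R mu mu _ iF.
have -> : (\int[mu2]_x (F x)%:E)%E = 0%E; last by [].
apply: (etrans (esym E)).
rewrite -[RHS](@integral0 _ RT R mu setT).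
have M := @measurable_fubini_G _ _ RT RT R mu mu _ iF.
have Z : measurable_fun [set: RT] (cst 0%E : RT -> \bar R) by exact: measurable_cst.
have AE := @ae_eq_integral _ RT R mu setT (cst 0%E) (fubini_G mu (EFin \o F)) measurableT M Z.
apply: AE.
have A := @ae_integrable2 _ _ RT RT R mu mu _ iF.
have B : {ae mu, forall v : RT, v != c1 /\ v != c2}.
  exists [set c1; c2]; split.
  - by apply: measurableU; exact: measurable_set1.
  - apply/eqP; rewrite eq_le measure_ge0 andbT.
    have /le_trans-> // : (mu ([set c1] `|` [set c2]) <= mu [set c1] + mu [set c2])%E.
      by apply: measureU2; exact: measurable_set1.
    by rewrite !lebesgue_measure_set1 adde0.
  - move=> v /= /not_andP[] /negP; rewrite negbK => /eqP ->; [by left|by right].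
apply: filterS2 A B => v iv [v1 v2] _.
have [S [C [dS cF SC]]] := H v v1 v2.
exact: (integral_derive_tends0 iv dS cF SC).
Qed.

End NullIntegrals.

(** * The Newton potential *)

Section NewtonPotential.
Variable R : realType.
Notation RT := (measurableTypeR R).
Implicit Types (f : R * R -> R) (x y z w d p : R * R).

(* The last condition is all that is used of membership in [L^q], [q < 2]. *)
Definition admissible f :=
  [/\ pmeasurable f, exists B : R, forall y, `|f y| <= B &
      pintegrable (fun y => `|f y| / (1 + enorm y))].

Lemma pmeasurable_enorm_id : pmeasurable (@enorm R).
Proof.
rewrite (_ : @enorm R = fun z => enorm (z.1, z.2)); last by apply/funext => -[].
by apply: pmeasurable_enorm; [exact: pmeasurable_fst|exact: pmeasurable_snd].
Qed.

Lemma pmeasurable_newtonK : pmeasurable (@newtonK R).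
Proof.
apply: pmeasurableM; first exact: pmeasurable_fst.
apply: pmeasurable_inv; apply: pmeasurableD; apply: pmeasurableX.
  exact: pmeasurable_fst.
exact: pmeasurable_snd.
Qed.

Lemma pmeasurable_subl (F : R * R -> R) x : pmeasurable F ->
  pmeasurable (fun y => F (x - y)).
Proof.
move=> mF; apply: (measurableT_comp (f := F) mF).
apply/measurable_fun_pairP; split => /=.
  by apply: measurable_funB; [exact: measurable_cst|exact: measurable_fst].
by apply: measurable_funB; [exact: measurable_cst|exact: measurable_snd].
Qed.

Lemma pmeasurable_ker_denom :
  pmeasurable (fun w : R * R => ((1 + w.1 ^+ 2 + w.2 ^+ 2) ^+ 2)^-1).
Proof.
apply: pmeasurable_inv; apply: pmeasurableX; apply: pmeasurableD.
  apply: pmeasurableD; first exact: pmeasurable_cst.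
  by apply: pmeasurableX; exact: pmeasurable_fst.
by apply: pmeasurableX; exact: pmeasurable_snd.
Qed.

Lemma pmeasurable_ker_a : pmeasurable (@ker_a R).
Proof.
apply: pmeasurableM; last exact: pmeasurable_ker_denom.
apply: pmeasurableB; last by apply: pmeasurableX; exact: pmeasurable_fst.
apply: pmeasurableD; first exact: pmeasurable_cst.
by apply: pmeasurableX; exact: pmeasurable_snd.
Qed.

Lemma pmeasurable_ker_b : pmeasurable (@ker_b R).
Proof.
apply: pmeasurableM; last exact: pmeasurable_ker_denom.
rewrite (_ : (fun _ => _) = (fun w : R * R => (-2 * w.1) * w.2)); last first.
  by apply/funext => w; rewrite !mulNr.
apply: pmeasurableM; last exact: pmeasurable_snd.
by apply: pmeasurableM; [exact: pmeasurable_cst|exact: pmeasurable_fst].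
Qed.

Lemma radialN (b : R) x : radial b (- x) = radial b x.
Proof. by rewrite /radial enormN. Qed.

Lemma radial_affine2 (b : R) x y : radial b (x - y) = (radial b \o affine2 (- x) 1) y.
Proof. by rewrite -radialN opprB /= /affine2 !mul1r addrC; case: x y => ? ? [? ?]. Qed.

Lemma pintegrable_radial_shift (b : R) x : 2 < b -> pintegrable (fun y => radial b (x - y)).
Proof.
move=> b2; have := pintegrable_affine2 (- x) ltr01 (pintegrable_radial b2).
by rewrite (_ : _ \o _ = (fun y => radial b (x - y)))//; apply/funext => y; rewrite radial_affine2.
Qed.

Lemma pint_radial_shift (b : R) x : 2 < b ->
  pint (fun y => radial b (x - y)) = pint (@radial R b).
Proof.
move=> b2; rewrite (pint_affine2 (- x) ltr01 (pintegrable_radial b2)) expr1n mul1r.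
by apply: eq_pint => y; exact: radial_affine2.
Qed.

(** Here [t] stands for the value of a singular kernel at x - y; it will be |x - y|^-1 or |x -
    y|^(-3/2). Near the singularity [f] is bounded by [B]; far from it, |y| <= |x| + |x - y| gives 1
    / |x - y| <= (2 + |x|) / (1 + |y|). *)
Lemma potential_dominated f (B t : R) x y : 0 <= t ->
  (enorm (x - y) <= 3 -> t <= 64 * radial 3 (x - y)) ->
  (1 <= enorm (x - y) -> t <= (enorm (x - y))^-1) -> `|f y| <= B ->
  t * `|f y| <= 64 * B * radial 3 (x - y) + (2 + enorm x) * (`|f y| / (1 + enorm y)).
Proof.
move=> t0 tn tf fB; have f0 := normr_ge0 (f y).
have q0 : 0 < 1 + enorm y by rewrite ltr_wpDr ?enorm_ge0.
have p2 : 0 <= (2 + enorm x) * (`|f y| / (1 + enorm y)).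
  by rewrite mulr_ge0 ?divr_ge0 ?addr_ge0 ?enorm_ge0// ltW.
have p1 : 0 <= 64 * B * radial 3 (x - y).
  by rewrite mulr_ge0 ?radial_ge0// mulr_ge0 ?ler0n// (le_trans f0).
have [r3|r3] := leP (enorm (x - y)) 3.
  apply: (@le_trans _ _ (64 * B * radial 3 (x - y))); last by rewrite lerDl.
  have h := ler_pM t0 f0 (tn r3) fB.
  by apply: (le_trans h); rewrite mulrAC.
apply: (@le_trans _ _ ((2 + enorm x) * (`|f y| / (1 + enorm y)))); last by rewrite lerDr.
rewrite mulrCA [leLHS]mulrC ler_wpM2l//.
have r1 : 1 <= enorm (x - y) by rewrite (le_trans _ (ltW r3))// ler1n.
apply: (le_trans (tf r1)); have r0 : 0 < enorm (x - y) by apply: lt_le_trans r1.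
rewrite ler_pdivlMr// mulrC ler_pdivrMr//.
have h1 : enorm y <= enorm x + enorm (x - y).
  by have := ler_enormD x (y - x); rewrite subrKC (enormB y).
have h2 : enorm x <= enorm x * enorm (x - y) by rewrite ler_peMr ?enorm_ge0.
rewrite mulrDl; move: (enorm x) (enorm y) (enorm (x - y)) (enorm x * enorm (x - y)) r1 h1 h2.
by clear => a b c e; lra.
Qed.

Lemma pintegrable_dominated f (B M : R) x : admissible f ->
  pintegrable (fun y => 64 * B * radial 3 (x - y) + (2 + M) * (`|f y| / (1 + enorm y))).
Proof.
move=> [mf _ fi]; apply: pintegrableD; apply: pintegrableZ => //.
by apply: pintegrable_radial_shift; rewrite ltr_nat.
Qed.

Lemma pintegrable_newton f x : admissible f ->
  pintegrable (fun y => newtonK (x - y) * f y).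
Proof.
move=> af; have [mf [B fB] fi] := af.
apply: (pintegrable_le _ _ (pintegrable_dominated B (enorm x) x af)).
  by apply: pmeasurableM => //; exact: (pmeasurable_subl _ pmeasurable_newtonK).
move=> y; rewrite normrM.
apply: (@le_trans _ _ ((enorm (x - y))^-1 * `|f y|)).
  by rewrite ler_wpM2r// norm_newtonK.
apply: potential_dominated => //; first by rewrite invr_ge0 enorm_ge0.
exact: inv_le_radial3.
Qed.

Lemma inv_1D_enorm_sqr w : (1 + enorm w ^+ 2)^-1 <= 2 / (1 + enorm w).
Proof.
have r0 := enorm_ge0 w; move: (enorm w) r0 => r r0.
have q0 : 0 < 1 + r ^+ 2 by rewrite ltr_wpDr// sqr_ge0.
have p0 : 0 < 1 + r by rewrite ltr_wpDr.
rewrite ler_pdivlMr// mulrC ler_pdivrMr// -subr_ge0.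
rewrite (_ : _ - _ = (r - 1) ^+ 2 + r *+ 1 + r ^+ 2); last by ring.
by rewrite !addr_ge0// sqr_ge0.
Qed.

Lemma pintegrable_bounded_ker (k f : R * R -> R) : admissible f -> pmeasurable k ->
  (forall w, `|k w| <= (1 + enorm w ^+ 2)^-1) -> pintegrable (fun w => k w * f w).
Proof.
move=> [mf _ fi] mk hk.
apply: (pintegrable_le _ _ (pintegrableZ 2 fi)); first exact: pmeasurableM.
move=> w; rewrite normrM mulrCA mulrC ler_wpM2l//.
exact: le_trans (hk w) (inv_1D_enorm_sqr w).
Qed.

Definition newton_pot f x : R := pint (fun y => newtonK (x - y) * f y).
(** With [coef_b], the slopes of the affine approximation at the origin and at unit scale; another
    point [p] and scale [h] are reached by composing [f] with [affine2 p h]. *)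
Definition coef_a f : R := pint (fun w => ker_a w * f w).
Definition coef_b f : R := pint (fun w => ker_b w * f w).

Lemma pintegrable_ker_a f : admissible f -> pintegrable (fun w => ker_a w * f w).
Proof.
by move=> af; apply: pintegrable_bounded_ker => //;
  [exact: pmeasurable_ker_a|exact: norm_ker_a].
Qed.

Lemma pintegrable_ker_b f : admissible f -> pintegrable (fun w => ker_b w * f w).
Proof.
by move=> af; apply: pintegrable_bounded_ker => //;
  [exact: pmeasurable_ker_b|exact: norm_ker_b].
Qed.

Lemma newton_taylorE f d : admissible f ->
  pintegrable (fun w => taylorK d w * f w) /\
  newton_pot f d - newton_pot f 0 - (coef_a f * d.1 + coef_b f * d.2) =
  pint (fun w => taylorK d w * f w).
Proof.
move=> af.
have i1 := pintegrable_newton d af; have i2 := pintegrable_newton 0 af.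
have ia := pintegrable_ker_a af; have ib := pintegrable_ker_b af.
have i3 := pintegrableZ d.1 ia; have i4 := pintegrableZ d.2 ib.
have E : (fun w => taylorK d w * f w) = (fun w => (newtonK (d - w) * f w - newtonK (0 - w) * f w) -
    (d.1 * (ker_a w * f w) + d.2 * (ker_b w * f w))).
  by apply/funext => w; rewrite /taylorK sub0r; ring.
rewrite E; split; first by apply: pintegrableB; [exact: pintegrableB|exact: pintegrableD].
rewrite pintB; [|exact: pintegrableB|exact: pintegrableD].
rewrite pintB// pintD// (pintZ _ ia) (pintZ _ ib).
by rewrite (mulrC d.1) (mulrC d.2).
Qed.

End NewtonPotential.

(** * Affine approximation of the Newton potential at unit scale *)

Section UnitEstimate.
Variable R : realType.
Notation RT := (measurableTypeR R).
Implicit Types (f : R * R -> R) (x y z w d p : R * R).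

(** Since |w.1| <= 2 (1 + |z|) both for z = w and for z = w - d, the Hoelder weight costs only the
    exponent [g] in the decay, and 3 - g is still larger than 2. *)
Lemma radial_weight (g : R) d w (K : R) : 0 < g -> g < 1 -> enorm d <= 1 ->
  0 <= K -> K <= radial 3 w + radial 3 (w - d) ->
  K * `|w.1| `^ g <= 2 * (radial (3 - g) w + radial (3 - g) (w - d)).
Proof.
move=> g0 g1 d1 K0 KE.
have W z : `|w.1| <= 2 * (1 + enorm z) ->
    radial 3 z * `|w.1| `^ g <= 2 * radial (3 - g) z.
  move=> wz; have q0 : 0 < 1 + enorm z by rewrite ltr_wpDr ?enorm_ge0.
  have h : `|w.1| `^ g <= 2 * (1 + enorm z) `^ g.
    apply: (@le_trans _ _ ((2 * (1 + enorm z)) `^ g)).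
      by apply: ge0_ler_powR; rewrite ?nnegrE ?mulr_ge0// ltW.
    rewrite powRM ?(ltW q0)// ler_wpM2r ?powR_ge0//.
    by rewrite -[leRHS](powRr1 (ler0n R 2)) ler_powR ?ler1n// ltW.
  rewrite /radial (_ : - (3 - g) = - 3 + g); last by ring.
  rewrite (powRD (r := -3) (s := g)); last by rewrite (gt_eqF q0) implybT.
  rewrite -!mulrA [leRHS]mulrCA ler_wpM2l ?addr_ge0 ?powR_ge0//.
  by rewrite [leRHS]mulrCA ler_wpM2l ?powR_ge0.
have h1 : radial 3 w * `|w.1| `^ g <= 2 * radial (3 - g) w.
  apply: W; have := normr_fst_enorm w; have := enorm_ge0 w.
  by move: (enorm w) (`|w.1|); clear => a b; lra.
have h2 : radial 3 (w - d) * `|w.1| `^ g <= 2 * radial (3 - g) (w - d).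
  apply: W; have := normr_fst_enorm w; have := enorm_ge0 (w - d).
  have : enorm w <= enorm (w - d) + 1.
    by have := ler_enormD (w - d) d; rewrite subrK => /le_trans; apply; rewrite lerD2l.
  by move: (enorm w) (`|w.1|) (enorm (w - d)) ; clear => a b c; lra.
rewrite mulrDr; apply: le_trans (lerD h1 h2).
by rewrite -mulrDl ler_wpM2r// powR_ge0.
Qed.

(** The logarithms are primitives of the two values of [newtonK]. For the rational term, the
    gradient of z.1 / (1 + |z|^2) is also the horizontal derivative of the pair (z.1, z.2) / (1 +
    |z|^2). *)
Definition primitive_taylorK d (v t : R) : R :=
  (ln (t ^+ 2 + v ^+ 2) - ln ((d.1 - t) ^+ 2 + (d.2 - v) ^+ 2)) / 2 -
  (t * d.1 + v * d.2) / (1 + t ^+ 2 + v ^+ 2).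

Lemma is_derive_primitive_taylorK d (v t : R) : v != 0 -> v != d.2 ->
  is_derive t 1 (primitive_taylorK d v) (taylorK d (t, v)).
Proof.
move=> v0 vd.
have p1 : 0 < t ^+ 2 + v ^+ 2 by rewrite ltr_wpDl ?sqr_ge0// lt_neqAle eq_sym sqrf_eq0 v0 sqr_ge0.
have p2 : 0 < (d.1 - t) ^+ 2 + (d.2 - v) ^+ 2.
  by rewrite ltr_wpDl ?sqr_ge0// lt_neqAle eq_sym sqrf_eq0 subr_eq0 eq_sym vd sqr_ge0.
have p3 : 0 < 1 + t ^+ 2 + v ^+ 2 by rewrite -addrA ltr_wpDr// addr_ge0// sqr_ge0.
have dq1 : is_derive t 1 (fun t : R => t ^+ 2 + v ^+ 2) (2 * t).
  by apply: is_derive_eq; rewrite /GRing.scale/=; ring.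
have dq2 : is_derive t 1 (fun t : R => (d.1 - t) ^+ 2 + (d.2 - v) ^+ 2) (- 2 * (d.1 - t)).
  by apply: is_derive_eq; rewrite /GRing.scale/=; ring.
have dq3 : is_derive t 1 (fun t : R => 1 + t ^+ 2 + v ^+ 2) (2 * t).
  by apply: is_derive_eq; rewrite /GRing.scale/=; ring.
have dn : is_derive t 1 (fun t : R => t * d.1 + v * d.2) d.1.
  by apply: is_derive_eq; rewrite /GRing.scale/=; ring.
have dl1 := @is_derive1_comp R (@ln R) (fun t : R => t ^+ 2 + v ^+ 2) t _ _
  (is_derive1_ln p1) dq1.
have dl2 := @is_derive1_comp R (@ln R) (fun t : R => (d.1 - t) ^+ 2 + (d.2 - v) ^+ 2) t _ _
  (is_derive1_ln p2) dq2.
have D := is_deriveB (is_deriveZ 2^-1 (is_deriveB dl1 dl2))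
  (is_deriveM dn (@is_deriveV R (fun s : R => 1 + s ^+ 2 + v ^+ 2) t _ 1 (lt0r_neq0 p3) dq3)).
rewrite (_ : primitive_taylorK d v = 2^-1 \*:
   (((@ln R) \o (fun t : R => t ^+ 2 + v ^+ 2)) -
    ((@ln R) \o (fun t : R => (d.1 - t) ^+ 2 + (d.2 - v) ^+ 2))) -
   (fun t : R => t * d.1 + v * d.2) * (fun t : R => (1 + t ^+ 2 + v ^+ 2)^-1)); last first.
  by apply/funext => s; rewrite /primitive_taylorK /= mulrC.
apply: (is_derive_eq D).
rewrite /taylorK /newtonK /ker_a /ker_b /GRing.scale/= !sqrrN.
by field; rewrite !gt_eqF.
Qed.

Lemma continuous_taylorK_line d (v : R) : v != 0 -> v != d.2 ->
  continuous (fun t => taylorK d (t, v)).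
Proof.
move=> v0 vd.
have cid : continuous (fun t : R => t) by move=> t; exact: cvg_id.
have cc (c : R) : continuous (fun t : R => c) by move=> t; exact: cvg_cst.
have cD (p q : R -> R) : continuous p -> continuous q -> continuous (fun t => p t + q t).
  by move=> cp cq t; exact: (cvgD (cp t) (cq t)).
have cN (q : R -> R) : continuous q -> continuous (fun t => - q t).
  by move=> cq t; exact: (cvgN (cq t)).
have cM (p q : R -> R) : continuous p -> continuous q -> continuous (fun t => p t * q t).
  by move=> cp cq t; exact: (cvgM (cp t) (cq t)).
have cX (q : R -> R) : continuous q -> continuous (fun t => q t ^+ 2).
  by move=> cq t; exact: (cvgM (cq t) (cq t)).
have cV (q : R -> R) : continuous q -> (forall t, 0 < q t) -> continuous (fun t => (q t)^-1).
  by move=> cq q0 t; exact: (cvgV (lt0r_neq0 (q0 t)) (cq t)).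
have p1 (t : R) : 0 < (- t) ^+ 2 + (- v) ^+ 2.
  by rewrite !sqrrN ltr_wpDl ?sqr_ge0// lt_neqAle eq_sym sqrf_eq0 v0 sqr_ge0.
have p2 (t : R) : 0 < (d.1 - t) ^+ 2 + (d.2 - v) ^+ 2.
  by rewrite ltr_wpDl ?sqr_ge0// lt_neqAle eq_sym sqrf_eq0 subr_eq0 eq_sym vd sqr_ge0.
have p3 (t : R) : 0 < (1 + t ^+ 2 + v ^+ 2) ^+ 2.
  by rewrite exprn_gt0// -addrA ltr_wpDr// addr_ge0// sqr_ge0.
have c3 : continuous (fun t : R => ((1 + t ^+ 2 + v ^+ 2) ^+ 2)^-1).
  apply: (cV (fun t : R => (1 + t ^+ 2 + v ^+ 2) ^+ 2) _ p3).
  apply: (cX (fun t : R => 1 + t ^+ 2 + v ^+ 2)); apply: (cD _ _ _ (cc _)).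
  by apply: (cD _ _ (cc _)); exact: (cX _ cid).
have cq1 : continuous (fun t : R => (- t) ^+ 2 + (- v) ^+ 2).
  exact: (cD _ _ (cX _ (cN _ cid)) (cc _)).
have cd1 : continuous (fun t : R => d.1 - t) by exact: (cD _ _ (cc _) (cN _ cid)).
have cq2 : continuous (fun t : R => (d.1 - t) ^+ 2 + (d.2 - v) ^+ 2).
  exact: (cD _ _ (cX _ cd1) (cc _)).
have ca : continuous (fun t : R => ker_a (t, v)).
  exact: (cM _ _ (cD _ _ (cc (1 + v ^+ 2)) (cN _ (cX _ cid))) c3).
have cb : continuous (fun t : R => ker_b (t, v)).
  exact: (cM _ _ (cN _ (cM _ _ (cM _ _ (cc 2) cid) (cc v))) c3).
have cK1 : continuous (fun t : R => newtonK (d - (t, v))).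
  exact: (cM _ _ cd1 (cV _ cq2 p2)).
have cK2 : continuous (fun t : R => newtonK (- (t, v))).
  exact: (cM _ _ (cN _ cid) (cV _ cq1 p1)).
exact: (cD _ _ (cD _ _ cK1 (cN _ cK2))
  (cN _ (cD _ _ (cM _ _ ca (cc d.1)) (cM _ _ cb (cc d.2))))).
Qed.

(** The lengths |w| and |w - d| differ by at most 1 and are at least |t| and |t| / 2, so their
    logarithms differ by at most 3 / |t|; the rational term contributes 1 / |t|. *)
Lemma primitive_taylorK_decay d (v t : R) : enorm d <= 1 -> v != 0 -> v != d.2 ->
  2 <= `|t| -> `|primitive_taylorK d v t| <= 4 / `|t|.
Proof.
move=> d1 v0 vd t2.
have t0 : 0 < `|t| by apply: lt_le_trans t2.
pose w : R * R := (t, v).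
have rt : `|t| <= enorm w := normr_fst_enorm w.
have r0 : 0 < enorm w by apply: lt_le_trans rt.
have rs : enorm w <= enorm (w - d) + 1.
  by have := ler_enormD (w - d) d; rewrite subrK => /le_trans; apply; rewrite lerD2l.
have st : `|t| / 2 <= enorm (w - d).
  by move: (enorm w) (enorm (w - d)) `|t| rs rt t2; clear => a b c; lra.
have s0 : 0 < enorm (w - d) by apply: lt_le_trans st; rewrite divr_gt0.
have ds : `|enorm w - enorm (w - d)| <= 1.
  by rewrite (le_trans (dist_enorm _ _))// opprB addrC subrK.
have := dist_ln_le s0 r0 ds; rewrite mul1r => hl.
have e1 : (enorm w)^-1 <= `|t|^-1 by rewrite lef_pV2 ?posrE.
have e2 : (enorm (w - d))^-1 <= 2 * `|t|^-1.
  by rewrite -[leRHS]invrK invfM invrK lef_pV2 ?posrE// ?mulr_gt0 ?invr_gt0// mulrC.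
rewrite /primitive_taylorK.
have -> : t ^+ 2 + v ^+ 2 = enorm w ^+ 2 by rewrite sqr_enorm.
have -> : (d.1 - t) ^+ 2 + (d.2 - v) ^+ 2 = enorm (w - d) ^+ 2.
  by rewrite enormB sqr_enorm.
have -> : 1 + t ^+ 2 + v ^+ 2 = 1 + enorm w ^+ 2 by rewrite sqr_enorm addrA.
rewrite !lnXn// -mulrnBl -[_ *+ 2]mulr_natr mulfK//.
have h3 : `|(t * d.1 + v * d.2) / (1 + enorm w ^+ 2)| <= `|t|^-1.
  have q0 : 0 < 1 + enorm w ^+ 2 by rewrite ltr_wpDr// sqr_ge0.
  have cs : `|t * d.1 + v * d.2| <= enorm w.
    rewrite -(@ler_pXn2r _ 2) ?nnegrE ?enorm_ge0// real_normK ?num_real//.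
    apply: (@le_trans _ _ (enorm w ^+ 2 * enorm d ^+ 2)).
      rewrite !sqr_enorm -subr_ge0 (_ : _ - _ = (t * d.2 - v * d.1) ^+ 2) ?sqr_ge0//=.
      by ring.
    by rewrite ler_piMr ?sqr_ge0// exprn_ile1 ?enorm_ge0.
  rewrite normrM normfV (gtr0_norm q0) ler_pdivrMr// (le_trans cs)//.
  rewrite ler_pdivlMl//; apply: (@le_trans _ _ (enorm w * enorm w)).
    by rewrite ler_wpM2r// enorm_ge0.
  by rewrite expr2 lerDr.
apply: (le_trans (ler_normB _ _)); apply: (le_trans (lerD hl h3)).
by move: (enorm w)^-1 (enorm (w - d))^-1 `|t|^-1 e1 e2; clear => a b c; lra.
Qed.

(* [taylorK d] has mean zero on almost every horizontal line, so [f w] may be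
   replaced by [f w - f (0, w.2)]. *)
Lemma newton_pot_unit_estimate (g : R) : 0 < g -> g < 1 ->
  exists2 C : R, 0 <= C & forall f (A : R), admissible f ->
    (forall w, `|f w - f (0, w.2)| <= A * `|w.1| `^ g) ->
    forall d, enorm d <= 1 ->
    `|newton_pot f d - newton_pot f 0 - (coef_a f * d.1 + coef_b f * d.2)| <= C * A.
Proof.
move=> g0 g1; have [K K0 HK] := norm_taylorK R.
have g2 : 2 < 3 - g by rewrite ltrBrDl -ltrBrDr (_ : 3 - 2 = 1 :> R)//; ring.
pose I : R := pint (@radial R (3 - g)).
have I0 : 0 <= I by apply: pint_ge0 => y; exact: radial_ge0.
exists (K * 2 * (I + I)); first by rewrite !mulr_ge0// addr_ge0.
move=> f A af fA d d1; have [mf [B fB] fi] := af.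
have A0 : 0 <= A.
  by have := le_trans (normr_ge0 _) (fA (1, 0)); rewrite /= normr1 powR1 mulr1.
have [iT ->] := newton_taylorE d af.
pose f0 (w : R * R) := f (0, w.2).
have mf0 : pmeasurable f0.
  apply: (measurableT_comp (f := f) mf); apply/measurable_fun_pairP; split => /=.
    exact: measurable_cst.
  exact: measurable_snd.
have mT : pmeasurable (taylorK d).
  apply: pmeasurableB.
    apply: pmeasurableB; first exact: (pmeasurable_subl d (@pmeasurable_newtonK R)).
    have := pmeasurable_subl 0 (@pmeasurable_newtonK R).
    by rewrite (_ : (fun y => newtonK (0 - y)) = (fun y => newtonK (- y)))//;
      apply/funext => y; rewrite sub0r.
  apply: pmeasurableD; apply: pmeasurableM; try exact: pmeasurable_cst.
    exact: pmeasurable_ker_a.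
  exact: pmeasurable_ker_b.
have ir (b : R) : 2 < b -> pintegrable (fun w => radial b w + radial b (w - d)).
  move=> b2; apply: pintegrableD; first exact: pintegrable_radial.
  have := pintegrable_radial_shift d b2.
  by rewrite (_ : (fun y => radial b (d - y)) = (fun y => radial b (y - d)))//;
    apply/funext => y; rewrite -radialN opprB.
have b3 : 2 < 3 :> R by rewrite ltr_nat.
have iT0 : pintegrable (fun w => taylorK d w * f0 w).
  apply: (pintegrable_le _ _ (pintegrableZ (B * K) (ir 3 b3))); first exact: pmeasurableM.
  move=> w; rewrite normrM mulrC -mulrA; apply: ler_pM => //; first exact: fB.
  exact: HK.
have T0 : pint (fun w => taylorK d w * f0 w) = 0.
  apply: (pint_null_lines (c1 := 0) (c2 := d.2)) => // v v0 vd.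
  exists (fun t => f (0, v) * primitive_taylorK d v t), (`|f (0, v)| * 4).
  split.
  - move=> t; have D := is_deriveZ (f (0, v)) (is_derive_primitive_taylorK t v0 vd).
    by apply: (is_derive_eq D); rewrite /f0 /GRing.scale/= mulrC.
  - move=> t; have h := @continuous_taylorK_line d v v0 vd t.
    exact: (cvgM h (cvg_cst (f (0, v)))).
  - move=> t t2; rewrite normrM -mulrA ler_wpM2l//.
    exact: primitive_taylorK_decay.
rewrite -[X in `|X|]subr0 -T0 -pintB//.
have -> : K * 2 * (I + I) * A =
    pint (fun w => (A * K * 2) * (radial (3 - g) w + radial (3 - g) (w - d))).
  rewrite pintZ; last exact: ir.
  have -> : pint (fun w => radial (3 - g) w + radial (3 - g) (w - d)) = I + I.
    have i1 := pintegrable_radial g2; have i2 := pintegrable_radial_shift d g2.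
    rewrite (@eq_pint _ _ (fun w => radial (3 - g) w + radial (3 - g) (d - w))); last first.
      by move=> w; rewrite -(radialN _ (d - w)) opprB.
    by rewrite (pintD i1 i2) (pint_radial_shift d g2).
  by ring.
apply: ler_norm_pint.
- exact: pintegrableB.
- by apply: pintegrableZ; exact: ir.
- move=> w; rewrite -mulrBr normrM.
  apply: (@le_trans _ _ (K * (radial 3 w + radial 3 (w - d)) * (A * `|w.1| `^ g))).
    by apply: ler_pM => //; exact: HK.
  have h := @radial_weight g d w (radial 3 w + radial 3 (w - d)) g0 g1 d1.
  rewrite addr_ge0 ?radial_ge0// lexx in h; have {h} h := h isT isT.
  rewrite mulrACA (mulrC K A) -[leRHS]mulrA ler_wpM2l// mulr_ge0//.
Qed.

End UnitEstimate.

(** * Rescaling and Campanato's argument *)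

Section Campanato.
Variable R : realType.
Implicit Types (f V : R * R -> R) (x y z w d p : R * R) (g h s M : R).

Lemma affine2_0 p h : affine2 p h 0 = p.
Proof. by rewrite /affine2 /= !mulr0 !addr0; case: p. Qed.

Lemma affine2B p h x y : affine2 p h x - affine2 p h y = (h * (x.1 - y.1), h * (x.2 - y.2)).
Proof. by rewrite /affine2 /=; congr (_, _) => /=; ring. Qed.

Lemma enorm_homog h x : 0 <= h -> enorm (h * x.1, h * x.2) = h * enorm x.
Proof.
move=> h0; rewrite /enorm /= !exprMn -mulrDr sqrtrM ?sqr_ge0//.
by rewrite sqrtr_sqr ger0_norm.
Qed.

Lemma newtonK_homog h x : 0 < h -> newtonK (h * x.1, h * x.2) = h^-1 * newtonK x.
Proof.
move=> h0; rewrite /newtonK /= !exprMn -mulrDr invfM expr2 invfM.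
rewrite mulrACA; congr (_ * _); rewrite mulrA mulrV ?unitfE ?gt_eqF// mul1r //.
Qed.

Lemma admissible_affine2 f p h : 0 < h -> admissible f -> admissible (f \o affine2 p h).
Proof.
move=> h0 [mf [B fB] fi]; split; first exact: pmeasurable_affine2.
  by exists B => y; exact: fB.
apply: (pintegrable_le _ _
  (pintegrableZ (1 + enorm p + h) (pintegrable_affine2 p h0 fi))).
  apply: pmeasurableM; first by apply: pmeasurable_normr; exact: pmeasurable_affine2.
  apply: pmeasurable_inv; apply: pmeasurableD; first exact: pmeasurable_cst.
  exact: pmeasurable_enorm_id.
move=> w /=.
have q0 : 0 < 1 + enorm w by rewrite ltr_wpDr ?enorm_ge0.
have q1 : 0 < 1 + enorm (affine2 p h w) by rewrite ltr_wpDr ?enorm_ge0.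
rewrite ger0_norm ?divr_ge0 ?(ltW q0)// mulrCA ler_wpM2l//.
rewrite ler_pdivlMr// mulrC ler_pdivrMr//.
have e : affine2 p h w = p + (h * w.1, h * w.2) by case: (p).
have := ler_enormD p (h * w.1, h * w.2); rewrite -e enorm_homog ?(ltW h0)//.
have := enorm_ge0 p; have := enorm_ge0 w.
move: (enorm w) (enorm p) (enorm (affine2 p h w)) h0; clear => a b c h0 a0 b0 cE.
have ab : 0 <= b * a by rewrite mulr_ge0.
have ha : 0 <= h * a by rewrite mulr_ge0// ltW.
by rewrite !mulrDl !mulrDr !mul1r !mulr1; lra.
Qed.

(** The Jacobian contributes h^2 and the kernel, homogeneous of degree -1, contributes h^-1. *)
Lemma newton_pot_affine2 f p h d : 0 < h -> admissible f ->
  newton_pot f (affine2 p h d) = h * newton_pot (f \o affine2 p h) d.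
Proof.
move=> h0 af; rewrite /newton_pot.
rewrite (pint_affine2 p h0 (pintegrable_newton _ af)).
rewrite -(pintZ _ (pintegrable_newton d (admissible_affine2 p h0 af))) expr2 -mulrA.
rewrite -pintZ; last exact: pintegrable_affine2 (pintegrable_newton _ af).
rewrite -pintZ; last first.
  by apply: pintegrableZ; apply: pintegrable_affine2 => //; exact: pintegrable_newton.
apply: eq_pint => w /=; rewrite affine2B (newtonK_homog (d - w))//.
by rewrite mulrA !mulrA mulfK ?gt_eqF//.
Qed.

(** A one-point condition: increments are taken only along horizontal lines, which never cross the
    boundary of the half-plane, and only from the vertical line through [p]. *)
Definition holder_line f p g A := forall y, `|f y - f (p.1, y.2)| <= A * `|y.1 - p.1| `^ g.

Lemma newton_pot_local g : 0 < g -> g < 1 ->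
  exists2 C : R, 0 <= C & forall f A p, admissible f -> holder_line f p g A ->
    forall h d, 0 < h -> enorm d <= h ->
    `|newton_pot f (p + d) - newton_pot f p -
      (coef_a (f \o affine2 p h) * d.1 + coef_b (f \o affine2 p h) * d.2)| <=
    C * A * (h * h `^ g).
Proof.
move=> g0 g1; have [C C0 HC] := newton_pot_unit_estimate g0 g1.
exists C => // f A p af fA h d h0 dh.
pose e : R * R := (d.1 / h, d.2 / h).
have hn : h != 0 by rewrite gt_eqF.
have pe : p + d = affine2 p h e.
  by rewrite /affine2 /e /= !(mulrCA h) !divff// !mulr1; case: (p) (d).
have e1 : enorm e <= 1.
  rewrite /e !(mulrC _ h^-1) enorm_homog ?invr_ge0 ?(ltW h0)//.
  by rewrite ler_pdivrMl// mulr1.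
have lA w : `|(f \o affine2 p h) w - (f \o affine2 p h) (0, w.2)| <= (A * h `^ g) * `|w.1| `^ g.
  have := fA (affine2 p h w); rewrite /affine2 /= mulr0 addr0 (addrC p.1) addrK.
  by rewrite normrM gtr0_norm// powRM ?(ltW h0)// mulrA.
have := HC _ _ (admissible_affine2 p h0 af) lA e e1.
have -> : newton_pot f (p + d) = h * newton_pot (f \o affine2 p h) e.
  by rewrite pe newton_pot_affine2.
have -> : newton_pot f p = h * newton_pot (f \o affine2 p h) 0.
  by rewrite -newton_pot_affine2// affine2_0.
move: (newton_pot _ e) (newton_pot _ 0) (coef_a _) (coef_b _) => v v0 a b H.
have -> : h * v - h * v0 - (a * d.1 + b * d.2) = h * (v - v0 - (a * e.1 + b * e.2)).
  by rewrite /e /=; field.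
rewrite normrM gtr0_norm//.
have -> : C * A * (h * h `^ g) = h * (C * (A * h `^ g)) by ring.
by rewrite ler_wpM2l// ltW.
Qed.

(** Completeness in the form that yields a limit as h -> 0 together with its rate: the supremum of
    the lower functions lies below all the upper ones. *)
Lemma squeeze_point (l u : R -> R) :
  (forall s h, 0 < s -> 0 < h -> l s <= u h) ->
  exists G, forall h, 0 < h -> l h <= G <= u h.
Proof.
move=> lu; pose E := [set l h | h in [set h | 0 < h]].
have E0 : E !=set0 by exists (l 1), 1 => //=.
have Eu h : 0 < h -> ubound E (u h) by move=> h0 _ [s s0 <-]; exact: lu.
exists (sup E) => h h0; apply/andP; split.
  apply: sup_upper_bound; last by exists h.
  by split => //; exists (u 1); exact: Eu.
by apply: ge_sup => //; exact: Eu.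
Qed.

Lemma dyadic_lower s h : 0 < s -> 0 < h -> exists n, h / 2 ^+ n <= s.
Proof.
move=> s0 h0; exists (Num.truncn (h / s)).
rewrite ler_pdivrMr ?exprn_gt0// mulrC -ler_pdivrMr//.
apply: (le_trans (ltW (truncnS_gt (h / s)))).
by rewrite -natrX ler_nat; exact: ltn_expl.
Qed.

(* The solution of [D = 4 + D 2^(-g)]. *)
Definition dyadic_const g := 4 / (1 - 2^-1 `^ g).

Lemma dyadic_const_gt0 g : 0 < g -> 0 < dyadic_const g.
Proof.
move=> g0; have e1 : 1 `^ g = 1 :> R by rewrite powR1.
rewrite divr_gt0// subr_gt0 -[ltRHS]e1 gt0_ltr_powR ?nnegrE ?invr_ge0//.
by rewrite invf_lt1// ltr1n.
Qed.

Lemma dyadic_constE g : 0 < g -> 4 + dyadic_const g * 2^-1 `^ g = dyadic_const g.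
Proof.
move=> g0; have q : 1 - 2^-1 `^ g != 0.
  have := dyadic_const_gt0 g0; rewrite /dyadic_const pmulr_rgt0// invr_gt0.
  by move/gt_eqF => ->.
by rewrite /dyadic_const; field.
Qed.

(* Campanato's argument: the affine approximations at scales [h] and [h / 2]
   differ by [O(h^g)], so their slopes form a Cauchy family as [h -> 0]. *)
Lemma slopes_cauchy (r : R -> R) g M : 0 < g -> 0 <= M ->
  (forall s h, 0 < s -> s <= h -> `|r s - r h| * s <= 2 * M * (h * h `^ g)) ->
  forall s h, 0 < s -> s <= h -> `|r s - r h| <= dyadic_const g * M * h `^ g.
Proof.
move=> g0 M0 H.
have H2 s h : 0 < s -> s <= h -> h / 2 <= s -> `|r s - r h| <= 4 * M * h `^ g.
  move=> s0 sh hs; have := H s h s0 sh; rewrite -ler_pdivlMr// => /le_trans; apply.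
  rewrite ler_pdivrMr//.
  have hg : 0 <= M * h `^ g by rewrite mulr_ge0// powR_ge0.
  have -> : 2 * M * (h * h `^ g) = (2 * (M * h `^ g)) * h by ring.
  have -> : 4 * M * h `^ g * s = (2 * (M * h `^ g)) * (2 * s) by ring.
  have hg2 : 0 <= 2 * (M * h `^ g) by rewrite mulr_ge0.
  by rewrite ler_wpM2l// mulrC -ler_pdivrMr.
(* Induction on the number of halvings that bring [h] below [s]. One halving costs 4 M h^g, and the
   defining equation of [dyadic_const] makes the sum close up with the same constant. *)
suff K n : forall s h, 0 < s -> s <= h -> h / 2 ^+ n <= s ->
    `|r s - r h| <= dyadic_const g * M * h `^ g.
  move=> s h s0 sh; have [n hn] := dyadic_lower s0 (lt_le_trans s0 sh).
  exact: (K n).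
elim: n => [|n IH] s h s0 sh hs.
  have -> : s = h by apply/eqP; rewrite eq_le sh -[h]divr1.
  by rewrite subrr normr0 mulr_ge0 ?powR_ge0// mulr_ge0// ltW ?dyadic_const_gt0.
have h0 : 0 < h := lt_le_trans s0 sh.
have D4 : 4 <= dyadic_const g.
  rewrite -(dyadic_constE g0) lerDl mulr_ge0 ?powR_ge0//.
  by rewrite ltW ?dyadic_const_gt0.
have [hs2|hs2] := leP (h / 2) s.
  apply: (le_trans (H2 _ _ s0 sh hs2)).
  by rewrite ler_wpM2r ?powR_ge0// ler_wpM2r.
have h20 : 0 < h / 2 by rewrite divr_gt0.
have h2h : h / 2 <= h by rewrite ler_pdivrMr// ler_peMr ?ler1n// ltW.
have := IH s (h / 2) s0 (ltW hs2); rewrite -mulrA -invfM -exprS => /(_ hs) i1.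
have i2 := H2 (h / 2) h h20 h2h (lexx _).
rewrite -(subrKA (r (h / 2))); apply: (le_trans (ler_normD _ _)).
apply: (le_trans (lerD i1 i2)); rewrite powRM ?(ltW h0) ?invr_ge0//.
rewrite -[in leRHS](dyadic_constE g0) le_eqVlt; apply/orP; left; apply/eqP.
by ring.
Qed.

(** With D = dyadic_const g * M, every r s - D s^g lies below every r h + D h^g, whichever of the
    two scales is larger; a number separating the two families is the limit. *)
Lemma slopes_limit (r : R -> R) g M : 0 < g -> 0 <= M ->
  (forall s h, 0 < s -> s <= h -> `|r s - r h| * s <= 2 * M * (h * h `^ g)) ->
  exists G, forall h, 0 < h -> `|r h - G| <= dyadic_const g * M * h `^ g.
Proof.
move=> g0 M0 H; have K := slopes_cauchy g0 M0 H.
set D := dyadic_const g * M; have D0 : 0 <= D by rewrite mulr_ge0// ltW ?dyadic_const_gt0.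
have [s h s0 h0|G HG] := @squeeze_point (fun s => r s - D * s `^ g) (fun h => r h + D * h `^ g).
  rewrite lerBlDr -addrA -lerBlDl (le_trans (ler_norm _))//.
  have a1 : 0 <= D * s `^ g by rewrite mulr_ge0// powR_ge0.
  have a2 : 0 <= D * h `^ g by rewrite mulr_ge0// powR_ge0.
  have [sh|sh] := leP s h.
    by rewrite (le_trans (K _ _ s0 sh))// lerDl.
  by rewrite distrC (le_trans (K _ _ h0 (ltW sh)))// lerDr.
exists G => h h0; have /andP[h1 h2] := HG h h0.
by rewrite ler_norml; apply/andP; split; [rewrite lerBrDr addrC lerBlDl addrC; lra|lra].
Qed.

(** Subtracting the approximations at scales s <= h for the same |d| <= s compares their linear
    parts, and d = (s, 0), d = (0, s) isolate the two slopes. In the last bound the scale is h =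
    |d|; replacing each slope by its limit adds one [dyadic_const g]. *)
Lemma campanato V p (r1 r2 : R -> R) g M : 0 < g -> 0 <= M ->
  (forall h d, 0 < h -> enorm d <= h ->
    `|V (p + d) - V p - (r1 h * d.1 + r2 h * d.2)| <= M * (h * h `^ g)) ->
  exists G1 G2 : R,
    [/\ forall h, 0 < h -> `|r1 h - G1| <= dyadic_const g * M * h `^ g,
        forall h, 0 < h -> `|r2 h - G2| <= dyadic_const g * M * h `^ g &
        forall d, `|V (p + d) - V p - (G1 * d.1 + G2 * d.2)| <=
          (1 + 2 * dyadic_const g) * M * (enorm d * enorm d `^ g)].
Proof.
move=> g0 M0 H.
have mono s h : 0 < s -> s <= h -> M * (s * s `^ g) <= M * (h * h `^ g).
  move=> s0 sh; rewrite ler_wpM2l// ler_pM ?powR_ge0// ?(ltW s0)//.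
  by apply: ge0_ler_powR; rewrite ?nnegrE ?(ltW s0) ?(le_trans (ltW s0) sh)// ltW.
have step s h d : 0 < s -> s <= h -> enorm d <= s ->
    `|(r1 s - r1 h) * d.1 + (r2 s - r2 h) * d.2| <= 2 * M * (h * h `^ g).
  move=> s0 sh ds; have h0 := lt_le_trans s0 sh.
  have i1 := H h d h0 (le_trans ds sh).
  have i2 := le_trans (H s d s0 ds) (mono s h s0 sh).
  have := le_trans (ler_normB _ _) (lerD i1 i2).
  have -> : V (p + d) - V p - (r1 h * d.1 + r2 h * d.2) -
    (V (p + d) - V p - (r1 s * d.1 + r2 s * d.2)) =
    (r1 s - r1 h) * d.1 + (r2 s - r2 h) * d.2 by ring.
  by move=> /le_trans; apply; apply: eq_ler; ring.
have [s h s0 sh|G1 HG1] := slopes_limit (r := r1) g0 M0.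
  have := step s h (s, 0) s0 sh; rewrite /= mulr0 addr0 normrM (gtr0_norm s0); apply.
  by rewrite /enorm/= expr0n addr0 sqrtr_sqr gtr0_norm.
have [s h s0 sh|G2 HG2] := slopes_limit (r := r2) g0 M0.
  have := step s h (0, s) s0 sh; rewrite /= mulr0 add0r normrM (gtr0_norm s0); apply.
  by rewrite /enorm/= expr0n add0r sqrtr_sqr gtr0_norm.
exists G1, G2; split => // d.
have [d0|dn0] := eqVneq d 0.
  by rewrite d0 addr0 subrr /= !mulr0 addr0 subr0 normr0 (_ : enorm 0 = 0) ?mul0r ?mulr0//;
     apply/eqP; rewrite enorm_eq0.
have h0 : 0 < enorm d by rewrite enorm_gt0.
have i := H _ _ h0 (lexx (enorm d)).
have i1 := HG1 _ h0; have i2 := HG2 _ h0.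
have j1 : `|(r1 (enorm d) - G1) * d.1| <= dyadic_const g * M * (enorm d * enorm d `^ g).
  rewrite normrM (mulrC (enorm d)) mulrA ler_pM//; exact: normr_fst_enorm.
have j2 : `|(r2 (enorm d) - G2) * d.2| <= dyadic_const g * M * (enorm d * enorm d `^ g).
  rewrite normrM (mulrC (enorm d)) mulrA ler_pM//; exact: normr_snd_enorm.
have -> : V (p + d) - V p - (G1 * d.1 + G2 * d.2) =
   (V (p + d) - V p - (r1 (enorm d) * d.1 + r2 (enorm d) * d.2)) +
   ((r1 (enorm d) - G1) * d.1 + (r2 (enorm d) - G2) * d.2) by ring.
apply: (le_trans (ler_normD _ _)).
apply: (le_trans (lerD i (le_trans (ler_normD _ _) (lerD j1 j2)))).
by apply: eq_ler; ring.
Qed.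

(** With h = |p - q| and |e| = h, V(q + e) is expanded at [q] and at [p], and V(q) at [p]; what is
    left is the difference of the two gradients applied to [e]. The constant is 6 = 1 + 1 + 4, the 4
    bounding 2 * 2^g for the displacement of length at most 2 h. *)
Lemma whitney_holder V (G1 G2 : R * R -> R) g M : 0 < g -> g < 1 -> 0 <= M ->
  (forall p d, `|V (p + d) - V p - (G1 p * d.1 + G2 p * d.2)| <=
     M * (enorm d * enorm d `^ g)) ->
  forall p q, `|G1 p - G1 q| <= 6 * M * enorm (p - q) `^ g /\
    `|G2 p - G2 q| <= 6 * M * enorm (p - q) `^ g.
Proof.
move=> g0 g1 M0 H p q; have [->|pq] := eqVneq p q.
  by rewrite !subrr normr0 mulr_ge0 ?powR_ge0// mulr_ge0.
have h0 : 0 < enorm (p - q) by rewrite enorm_gt0 subr_eq0.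
set h := enorm (p - q) in h0 *.
pose v := q - p.
have vh : enorm v = h by rewrite /v enormB.
have key e : enorm e = h ->
    `|(G1 p - G1 q) * e.1 + (G2 p - G2 q) * e.2| <= 6 * M * h `^ g * h.
  move=> eh.
  have i1 := H q e; have i2 := H p (v + e); have i3 := H p v.
  rewrite eh in i1; rewrite vh in i3.
  have i2' : `|V (p + (v + e)) - V p - (G1 p * (v + e).1 + G2 p * (v + e).2)| <=
      M * (4 * (h * h `^ g)).
    apply: (le_trans i2); apply: (ler_wpM2l M0).
    have ve : enorm (v + e) <= 2 * h.
      by rewrite (le_trans (ler_enormD _ _))// vh eh mulr_natl mulr2n.
    have vg : enorm (v + e) `^ g <= 2 * h `^ g.
      apply: (@le_trans _ _ ((2 * h) `^ g)).
        by apply: ge0_ler_powR; rewrite ?nnegrE ?enorm_ge0 ?mulr_ge0// ltW.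
      rewrite powRM ?(ltW h0)// ler_wpM2r ?powR_ge0//.
      by rewrite -[leRHS](powRr1 (ler0n R 2)) ler_powR ?ler1n// ltW.
    apply: (le_trans (ler_pM (enorm_ge0 _) (powR_ge0 _ _) ve vg)).
    by apply: eq_ler; ring.
  have pv : p + v = q by rewrite /v subrKC.
  rewrite addrA pv in i2'; rewrite pv in i3.
  have E : (G1 p - G1 q) * e.1 + (G2 p - G2 q) * e.2 =
    (V (q + e) - V q - (G1 q * e.1 + G2 q * e.2) - - (V q - V p - (G1 p * v.1 + G2 p * v.2))) -
    (V (q + e) - V p - (G1 p * (v + e).1 + G2 p * (v + e).2)).
    by rewrite /=; ring.
  have j3 : `|- (V q - V p - (G1 p * v.1 + G2 p * v.2))| <= M * (h * h `^ g) by rewrite normrN.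
  rewrite E; apply: (le_trans (le_trans (ler_normB _ _)
    (lerD (le_trans (ler_normB _ _) (lerD i1 j3)) i2'))).
  by apply: eq_ler; ring.
split.
- have := key (h, 0); rewrite /= mulr0 addr0 normrM (gtr0_norm h0) ler_pM2r//; apply.
  by rewrite /enorm/= expr0n addr0 sqrtr_sqr gtr0_norm.
- have := key (0, h); rewrite /= mulr0 add0r normrM (gtr0_norm h0) ler_pM2r//; apply.
  by rewrite /enorm/= expr0n add0r sqrtr_sqr gtr0_norm.
Qed.

End Campanato.

(** * Differentiability *)

Section Differentiability.
Variable R : realType.
Implicit Types (f V : R * R -> R) (x y z w d p : R * R).

Definition lin2 (G1 G2 : R) d : R := G1 * d.1 + G2 * d.2.

Lemma lin2_is_linear (G1 G2 : R) : linear (lin2 G1 G2).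
Proof.
move=> k [u1 u2] [v1 v2]; rewrite /lin2 /= -!/(k * _).
rewrite (_ : k *: u1 = k * u1)// (_ : k *: u2 = k * u2)//.
rewrite (_ : k *: _ = k * (G1 * u1 + G2 * u2))//.
by ring.
Qed.

HB.instance Definition _ (G1 G2 : R) :=
  GRing.isLinear.Build R (R * R)%type R _ (lin2 G1 G2) (lin2_is_linear G1 G2).

Lemma continuous_lin2 (G1 G2 : R) : continuous (lin2 G1 G2).
Proof.
move=> d; apply: cvgD.
  by apply: cvgM; [exact: cvg_cst|exact: cvg_fst].
by apply: cvgM; [exact: cvg_cst|exact: cvg_snd].
Qed.

Lemma norm_fst_le d : `|d.1| <= `|d|.
Proof. by rewrite prod_normE le_max lexx. Qed.

Lemma norm_snd_le d : `|d.2| <= `|d|.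
Proof. by rewrite prod_normE le_max lexx orbT. Qed.

Lemma enorm_le_norm d : enorm d <= 2 * `|d|.
Proof.
rewrite (le_trans (enorm_le_norms d))// mulr_natl mulr2n lerD//.
  exact: norm_fst_le.
exact: norm_snd_le.
Qed.

Lemma differentiable_taylor V x (G1 G2 C a : R) : 0 < a -> 0 <= C ->
  (forall d, enorm d <= 1 ->
    `|V (x + d) - V x - (G1 * d.1 + G2 * d.2)| <= C * (enorm d * enorm d `^ a)) ->
  [/\ differentiable V x, partial 0 V x = G1 & partial 1 V x = G2].
Proof.
move=> a0 C0 H.
pose L : {linear (R * R)%type -> R} := lin2 G1 G2.
have K : V \o shift x = cst (V x) + L +o_ (0 : (R * R)%type) id.
  apply/eqaddoP => _/posnumP[e].
  (* Solves (2 C + 1) q^a = e, the 1 covering the case C = 0. The radius q / 2 and the factor 2 C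
     come from passing between the Euclidean norm and the max norm by [enorm_le_norm]. *)
  pose q := (e%:num / (2 * C + 1)) `^ a^-1.
  have D0 : 0 < 2 * C + 1 by rewrite ltr_wpDl// mulr_ge0.
  have e0 : 0 < e%:num / (2 * C + 1) by rewrite divr_gt0.
  have q0 : 0 < q by rewrite powR_gt0.
  have qa : q `^ a = e%:num / (2 * C + 1).
    by rewrite /q -powRrM mulVf ?gt_eqF// powRr1// ltW.
  rewrite near_simpl; apply/nbhs_normP; exists (Num.min (q / 2) 2^-1) => /=.
    by rewrite lt_min divr_gt0// invr_gt0 /=.
  move=> d /=; rewrite sub0r normrN lt_min => /andP[dq d1].
  have dd := enorm_le_norm d.
  have ed1 : enorm d <= 1.
    by rewrite (le_trans dd)// mulrC -ler_pdivlMr// mul1r ltW.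
  have edq : enorm d <= q.
    by rewrite (le_trans dd)// mulrC -ler_pdivlMr// ltW.
  have -> : (V \o shift x - (cst (V x) + L)) d =
     V (x + d) - V x - (G1 * d.1 + G2 * d.2).
    by rewrite /L /= !fctE /lin2 /= (addrC d x); ring.
  apply: (le_trans (H d ed1)).
  have ea : enorm d `^ a <= e%:num / (2 * C + 1).
    by rewrite -qa; apply: ge0_ler_powR; rewrite ?nnegrE ?enorm_ge0 ?(ltW a0) ?(ltW q0).
  have s1 : C * (enorm d * enorm d `^ a) <= C * ((2 * `|d|) * (e%:num / (2 * C + 1))).
    by rewrite ler_wpM2l// ler_pM ?enorm_ge0 ?powR_ge0.
  apply: (le_trans s1).
  have -> : C * (2 * `|d| * (e%:num / (2 * C + 1))) =
    (2 * C / (2 * C + 1)) * (e%:num * `|d|) by field; rewrite gt_eqF.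
  rewrite ler_piMl ?mulr_ge0// ler_pdivrMr// mul1r.
  by rewrite lerDl.
have dE : 'd V x = lin2 G1 G2 :> (R * R -> R).
  exact: (diff_unique (df := L) (@continuous_lin2 G1 G2) K).
have dV : differentiable V x.
  apply/diff_locallyP; split; first by rewrite dE; exact: continuous_lin2.
  by rewrite dE.
split => //; rewrite /partial /basis2 deriveE// dE /lin2 /=.
  by rewrite mulr1 mulr0 addr0.
by rewrite mulr0 mulr1 add0r.
Qed.

End Differentiability.

(** * The logarithmic potential *)

Section LogPotential.
Variable R : realType.
Implicit Types (f V : R * R -> R) (x y z w d p : R * R).

Lemma admissible_swap2 f : admissible f -> admissible (f \o @swap2 R).
Proof.
move=> [mf [B fB] fi]; split; first exact: pmeasurable_swap2.
  by exists B => y; exact: fB.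
have := pintegrable_swap2 fi.
by rewrite (_ : _ \o _ = (fun y => `|(f \o @swap2 R) y| / (1 + enorm y)))//;
  apply/funext => y /=; rewrite enorm_swap2.
Qed.

(** Convolution of [f] with z.2 / |z|^2, encoded by exchanging the coordinates so that every
    estimate on [newton_pot] transfers to it. *)
Definition newton_pot2 f x := newton_pot (f \o @swap2 R) (swap2 x).

Lemma pintegrable_newton2 f x : admissible f ->
  pintegrable (fun y => newtonK (swap2 (x - y)) * f y).
Proof.
move=> af; have := pintegrable_swap2 (pintegrable_newton (swap2 x) (admissible_swap2 af)).
rewrite (_ : _ \o _ = (fun y => newtonK (swap2 (x - y)) * f y))//.
by apply/funext => -[y1 y2].
Qed.

Lemma newton_pot2E f x : admissible f ->
  newton_pot2 f x = pint (fun y => newtonK (swap2 (x - y)) * f y).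
Proof.
move=> af; rewrite (pint_swap2 (pintegrable_newton2 x af)).
by apply: eq_pint => -[y1 y2].
Qed.

Lemma powR_le_radial3 z : enorm z <= 3 -> enorm z `^ (- (3 / 2)) <= 64 * radial 3 z.
Proof.
move=> z3; have h := radial_lower (b := 3) (ler0n R 3) (ltr0n R 3).
have q0 : 0 < 1 + enorm z by rewrite ltr_wpDr ?enorm_ge0.
have hz : 1 <= 64 * (1 + enorm z) `^ (- 3).
  rewrite powR_invn ?(ltW q0)// ler_pdivlMr ?exprn_gt0// mul1r.
  have -> : 64 = 4 ^+ 3 :> R by ring.
  rewrite ler_pXn2r ?nnegrE ?(ltW q0)//.
  by move: (enorm z) z3; clear => r; lra.
rewrite /radial mulrCA; apply: (@le_trans _ _ (1 + enorm z `^ (- (3 / 2)))).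
  by rewrite lerDr.
by rewrite ler_peMr// addr_ge0// powR_ge0.
Qed.

Definition dominator f (B : R) x y :=
  64 * B * radial 3 (x - y) + (2 + enorm x) * (`|f y| / (1 + enorm y)).

Lemma inv_dominated f B x y : `|f y| <= B ->
  (enorm (x - y))^-1 * `|f y| <= dominator f B x y.
Proof.
move=> fB; apply: potential_dominated => //; first by rewrite invr_ge0 enorm_ge0.
exact: inv_le_radial3.
Qed.

Lemma powR_dominated f B x y : `|f y| <= B ->
  enorm (x - y) `^ (- (3 / 2)) * `|f y| <= dominator f B x y.
Proof.
move=> fB; apply: potential_dominated => //; first exact: powR_ge0.
  exact: powR_le_radial3.
move=> r1; rewrite -(powR_inv1 (enorm_ge0 (x - y))); apply: (ler_powR r1); lra.
Qed.

Lemma pint_dominator f B x : admissible f ->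
  pint (dominator f B x) = 64 * B * pint (@radial R 3) +
    (2 + enorm x) * pint (fun y => `|f y| / (1 + enorm y)).
Proof.
move=> [mf _ fi]; have b3 : 2 < 3 :> R by rewrite ltr_nat.
have i1 := pintegrable_radial_shift x b3.
rewrite (pintD (pintegrableZ (64 * B) i1) (pintegrableZ (2 + enorm x) fi)).
by rewrite (pintZ _ i1) (pintZ _ fi) pint_radial_shift.
Qed.

Lemma pmeasurable_ln_enorm x : pmeasurable (fun y => ln (enorm (x - y))).
Proof.
apply: pmeasurable_ln.
exact: (pmeasurable_subl x (@pmeasurable_enorm_id R)).
Qed.

Lemma sub_neq0 x y : y <> x -> x - y != 0.
Proof. by move=> yx; rewrite subr_eq0; apply/eqP => xy; apply: yx. Qed.

Lemma pintegrable_log_diff f x x' : admissible f ->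
  pintegrable (fun y => (ln (enorm (x - y)) - ln (enorm (x' - y))) * f y).
Proof.
move=> af; have [mf [B fB] fi] := af.
apply: (pintegrable_le_off (x := x) (y := x') _ _
  (pintegrableZ (enorm (x - x')) (pintegrableD
    (pintegrable_dominated B (enorm x) x af) (pintegrable_dominated B (enorm x') x' af)))).
  by apply: pmeasurableM => //; apply: pmeasurableB; exact: pmeasurable_ln_enorm.
move=> y /sub_neq0 yx /sub_neq0 yx'.
rewrite normrM distrC.
have h := dist_ln_le (r := enorm (x - y)) (s := enorm (x' - y)) (e := enorm (x - x')).
rewrite !enorm_gt0 in h; have {}h := h yx yx'.
have hh : `|enorm (x' - y) - enorm (x - y)| <= enorm (x - x').
  by rewrite (le_trans (dist_enorm _ _))// opprB addrA subrK enormB.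
apply: (le_trans (ler_wpM2r (normr_ge0 _) (h hh))).
rewrite -[leLHS]mulrA; apply: ler_wpM2l; first exact: enorm_ge0.
rewrite mulrDl.
by apply: lerD; exact: inv_dominated.
Qed.

Lemma taylor_log_integral f (B : R) x d : admissible f -> (forall y, `|f y| <= B) ->
  pintegrable (fun y => taylor_log d (x - y) * f y) /\
  `|pint (fun y => taylor_log d (x - y) * f y)| <=
    12 * enorm d `^ (3 / 2) * (pint (dominator f B x) + pint (dominator f B (x + d))).
Proof.
move=> af fB; have [mf _ fi] := af.
pose G y := 12 * enorm d `^ (3 / 2) * (dominator f B x y + dominator f B (x + d) y).
have i1 := pintegrable_dominated B (enorm x) x af.
have i2 := pintegrable_dominated B (enorm (x + d)) (x + d) af.
have iG : pintegrable G by exact: pintegrableZ (pintegrableD i1 i2).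
have FG y : y <> x -> y <> x + d -> `|taylor_log d (x - y) * f y| <= G y.
  move=> /sub_neq0 yx /sub_neq0 yxd; rewrite addrAC in yxd.
  rewrite normrM; apply: (le_trans (ler_wpM2r (normr_ge0 _) (norm_taylor_log yx yxd))).
  rewrite /G -!mulrA; apply: ler_wpM2l; first exact: ler0n.
  apply: ler_wpM2l; first exact: powR_ge0.
  rewrite mulrDl; apply: lerD; first exact: powR_dominated.
  by rewrite addrAC; exact: powR_dominated.
have mF : pmeasurable (fun y => taylor_log d (x - y) * f y).
  apply: pmeasurableM => //; apply: pmeasurableB.
    apply: pmeasurableB; last exact: pmeasurable_ln_enorm.
    have := pmeasurable_ln_enorm (x + d).
    by rewrite (_ : (fun y => ln (enorm (x + d - y))) = (fun y => ln (enorm (x - y + d))))//;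
      apply/funext => y; rewrite addrAC.
  apply: pmeasurableD; apply: pmeasurableM; try exact: pmeasurable_cst.
    exact: (pmeasurable_subl x (@pmeasurable_newtonK R)).
  exact: (pmeasurable_subl x (pmeasurable_swap2 (@pmeasurable_newtonK R))).
have iF := pintegrable_le_off mF FG iG; split => //.
have := ler_norm_pint_off iF iG FG.
by rewrite /G pintZ ?(pintD i1 i2)//; exact: pintegrableD.
Qed.

(** The reflection is moved from the integration variable to [x], which does not change the
    distance. The two logarithms stay under one integral because neither need be integrable against
    an admissible [f]. *)
Definition log_pot f x :=
  pint (fun y => (ln (enorm (x - y)) - ln (enorm (reflect2 x - y))) * f y).

Lemma enorm_reflect2 x : enorm (reflect2 x) = enorm x.
Proof. by rewrite /enorm/= sqrrN. Qed.

(** The logarithmic remainder is taken at [x] with displacement [d] and at [reflect2 x] with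
    displacement [reflect2 d]. The reflection reverses d.2, so the horizontal slopes are subtracted
    and the vertical ones added. The exponent 1/2 is what is left of 3/2 in [norm_taylor_log]. *)
Lemma log_pot_taylor f x : admissible f ->
  exists2 C : R, 0 <= C & forall d, enorm d <= 1 ->
  `|log_pot f (x + d) - log_pot f x -
     ((newton_pot f x - newton_pot f (reflect2 x)) * d.1 +
      (newton_pot2 f x + newton_pot2 f (reflect2 x)) * d.2)| <=
  C * (enorm d * enorm d `^ 2^-1).
Proof.
move=> af; have [mf [B fB] fi] := af.
have B0 : 0 <= B := le_trans (normr_ge0 _) (fB 0).
pose I3 := pint (@radial R 3); pose F := pint (fun y => `|f y| / (1 + enorm y)).
have I30 : 0 <= I3 by apply: pint_ge0 => y; exact: radial_ge0.
have F0 : 0 <= F.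
  by apply: pint_ge0 => y; rewrite divr_ge0// addr_ge0// enorm_ge0.
(* Common bound for the integrals of the dominators at the four points [x], [x + d] and their
   reflections, all of norm at most |x| + 1; hence 48 = 4 * 12 below. *)
pose J := 64 * B * I3 + (3 + enorm x) * F.
have J0 : 0 <= J.
  by rewrite addr_ge0// !mulr_ge0 ?addr_ge0 ?enorm_ge0// ler0n.
have HJ z : enorm z <= enorm x + 1 -> pint (dominator f B z) <= J.
  move=> zx; rewrite pint_dominator// lerD2l ler_wpM2r// -/F.
  by move: (enorm z) (enorm x) zx; clear => a b; lra.
exists (48 * J); first by rewrite mulr_ge0// ler0n.
move=> d d1.
have e32 : enorm d `^ (3 / 2) = enorm d * enorm d `^ 2^-1.
  rewrite -[X in _ = X * _](powRr1 (enorm_ge0 d)) -powRD; last first.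
    by apply/implyP => /eqP; lra.
  by congr (_ `^ _); field.
have [iT1 hT1] := taylor_log_integral x d af fB.
have [iT2 hT2] := taylor_log_integral (reflect2 x) (reflect2 d) af fB.
rewrite enorm_reflect2 e32 in hT2; rewrite e32 in hT1.
have xd : enorm (x + d) <= enorm x + 1.
  by rewrite (le_trans (ler_enormD _ _))// lerD2l.
have rxd : reflect2 x + reflect2 d = reflect2 (x + d).
  by rewrite /reflect2 /= opprD; case: (x) (d).
rewrite rxd in hT2.
have k1 := HJ x; rewrite lerDl ler01 in k1; have {}k1 := k1 isT.
have k2 := HJ (x + d) xd.
have k3 := HJ (reflect2 x); rewrite enorm_reflect2 lerDl ler01 in k3; have {}k3 := k3 isT.
have k4 := HJ (reflect2 (x + d)); rewrite enorm_reflect2 in k4; have {}k4 := k4 xd.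
have D0 : 0 <= 12 * (enorm d * enorm d `^ 2^-1).
  by rewrite !mulr_ge0 ?enorm_ge0 ?powR_ge0// ler0n.
have h1 := le_trans hT1 (ler_wpM2l D0 (lerD k1 k2)).
have h2 := le_trans hT2 (ler_wpM2l D0 (lerD k3 k4)).
have a1 := pintegrable_log_diff (x + d) (reflect2 (x + d)) af.
have a2 := pintegrable_log_diff x (reflect2 x) af.
have b1 := pintegrable_newton x af; have b2 := pintegrable_newton (reflect2 x) af.
have c1 := pintegrable_newton2 x af; have c2 := pintegrable_newton2 (reflect2 x) af.
have E : log_pot f (x + d) - log_pot f x -
     ((newton_pot f x - newton_pot f (reflect2 x)) * d.1 +
      (newton_pot2 f x + newton_pot2 f (reflect2 x)) * d.2) =
    pint (fun y => taylor_log d (x - y) * f y) -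
    pint (fun y => taylor_log (reflect2 d) (reflect2 x - y) * f y).
  rewrite -(pintB iT1 iT2) !newton_pot2E// /newton_pot /log_pot.
  rewrite -(pintB a1 a2) -(pintB b1 b2) -(pintD c1 c2) !(mulrC _ d.1) !(mulrC _ d.2).
  have b3 := pintegrableB b1 b2; have c3 := pintegrableD c1 c2.
  have a3 := pintegrableB a1 a2.
  rewrite -(pintZ _ b3) -(pintZ _ c3).
  have b4 := pintegrableZ d.1 b3; have c4 := pintegrableZ d.2 c3.
  rewrite -(pintD b4 c4) -(pintB a3 (pintegrableD b4 c4)).
  apply: eq_pint => y.
  have e1 : x - y + d = x + d - y by rewrite addrAC.
  have e2 : reflect2 x - y + reflect2 d = reflect2 (x + d) - y by rewrite addrAC rxd.
  by rewrite /taylor_log e1 e2 /=; ring.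
rewrite E; apply: (le_trans (ler_normB _ _)); apply: (le_trans (lerD h1 h2)).
by apply: eq_ler; ring.
Qed.

End LogPotential.

(** * Second derivatives *)

Section PotentialGradient.
Variable R : realType.
Implicit Types (f V : R * R -> R) (x y z w d p q : R * R) (g h : R).

Lemma powR_small_eq0 (e K g : R) : 0 < g -> 0 <= K -> 0 <= e ->
  (forall h : R, 0 < h -> e <= K * h `^ g) -> e = 0.
Proof.
move=> g0 K0 e0 H; apply/eqP; rewrite eq_le e0 andbT leNgt; apply/negP => ep.
have D0 : 0 < 2 * K + 1 by rewrite ltr_wpDl// mulr_ge0.
have q0 : 0 < e / (2 * K + 1) by rewrite divr_gt0.
have := H ((e / (2 * K + 1)) `^ g^-1); rewrite powR_gt0// -powRrM mulVf ?gt_eqF//.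
rewrite powRr1 ?(ltW q0)// => /(_ isT); rewrite mulrCA -ler_pdivrMl// mulVf ?gt_eqF//.
rewrite leNgt ltr_pdivrMr// mul1r => /negP; apply.
by move: K D0 K0 {H q0}; clear => K D0 K0; lra.
Qed.

Lemma approx_unique (g K K' x y : R) (z : R -> R) : 0 < g ->
  0 <= K -> 0 <= K' ->
  (forall h, 0 < h -> `|z h - x| <= K * h `^ g) ->
  (forall h, 0 < h -> `|z h - y| <= K' * h `^ g) -> x = y.
Proof.
move=> g0 K0 K0' Hx Hy; apply/eqP; rewrite -subr_eq0 -normr_eq0; apply/eqP.
apply: (powR_small_eq0 g0 (addr_ge0 K0 K0')) => // h h0.
rewrite -(subrKA (z h)) (le_trans (ler_normD _ _))// mulrDl lerD//.
  by rewrite distrC; exact: Hx.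
exact: Hy.
Qed.

Lemma holder_line_ge0 f p g A : holder_line f p g A -> 0 <= A.
Proof.
move=> /(_ (p.1 + 1, p.2)) /=; rewrite (addrC p.1) addrK normr1 powR1 mulr1.
exact: le_trans.
Qed.

Lemma newton_pot_campanato g : 0 < g -> g < 1 ->
  exists2 C : R, 0 <= C & forall f A p, admissible f -> holder_line f p g A ->
  exists G1 G2 : R,
    [/\ forall h, 0 < h -> `|coef_a (f \o affine2 p h) - G1| <= C * A * h `^ g,
        forall h, 0 < h -> `|coef_b (f \o affine2 p h) - G2| <= C * A * h `^ g &
        forall d, `|newton_pot f (p + d) - newton_pot f p - (G1 * d.1 + G2 * d.2)| <=
          C * A * (enorm d * enorm d `^ g)].
Proof.
move=> g0 g1; have [C C0 HC] := newton_pot_local g0 g1.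
have D0 := ltW (dyadic_const_gt0 g0).
exists ((1 + 2 * dyadic_const g) * C).
  by rewrite mulr_ge0// addr_ge0// mulr_ge0.
move=> f A p af fA; have A0 := holder_line_ge0 fA.
have CA0 : 0 <= C * A by rewrite mulr_ge0.
have [G1 [G2 [h1 h2 h3]]] := campanato g0 CA0 (HC f A p af fA).
have le1 : dyadic_const g * (C * A) <= (1 + 2 * dyadic_const g) * C * A.
  rewrite -[leRHS]mulrA ler_wpM2r//.
  by move: (dyadic_const g) D0; clear => D D0; lra.
exists G1, G2; split.
- by move=> h h0; rewrite (le_trans (h1 h h0))// ler_wpM2r// powR_ge0.
- by move=> h h0; rewrite (le_trans (h2 h h0))// ler_wpM2r// powR_ge0.
- by move=> d; have := h3 d; rewrite (mulrA _ C A).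
Qed.

(** Divergence of the regularised field z / (1 + |z|^2): a positive integrable kernel, whose
    rescalings form an approximate identity up to the factor [kappa]. *)
Definition ker_sum w : R := ker_a w + ker_a (swap2 w).
(* The value is [2 pi], but only its finiteness matters. *)
Definition kappa : R := pint ker_sum.

Lemma ker_sumE w : ker_sum w = 2 / (1 + enorm w ^+ 2) ^+ 2.
Proof.
rewrite /ker_sum /ker_a /= sqr_enorm; have D := ker_ab_denom_gt0 w.
have -> : 1 + w.2 ^+ 2 + w.1 ^+ 2 = 1 + w.1 ^+ 2 + w.2 ^+ 2 by ring.
rewrite addrA -mulrDl [in RHS]expr2 expr2.
by field; rewrite gt_eqF.
Qed.

Lemma pmeasurable_ker_sum : pmeasurable ker_sum.
Proof.
apply: pmeasurableD; first exact: pmeasurable_ker_a.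
by apply: pmeasurable_swap2; exact: pmeasurable_ker_a.
Qed.

Lemma ker_sum_weight g w : 0 <= g -> g < 1 ->
  `|ker_sum w| * enorm w `^ g <= 8 * radial (3 - g) w.
Proof.
move=> g0 g1; rewrite ker_sumE.
have r0 := enorm_ge0 w; have q0 : 0 < 1 + enorm w by rewrite ltr_wpDr.
have p0 : 0 < 1 + enorm w ^+ 2 by rewrite ltr_wpDr// sqr_ge0.
have k0 : 0 <= 2 / (1 + enorm w ^+ 2) ^+ 2 by rewrite divr_ge0// exprn_ge0// ltW.
rewrite ger0_norm//.
have h1 : 2 / (1 + enorm w ^+ 2) ^+ 2 <= 8 * (1 + enorm w) `^ (- 3).
  rewrite powR_invn ?(ltW q0)//; move: (enorm w) r0 q0 p0; clear => r r0 q0 p0.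
  rewrite ler_pdivrMr ?exprn_gt0// mulrAC ler_pdivlMr ?exprn_gt0// -subr_ge0.
  (* Sum-of-squares certificate for 2 (1 + r)^3 <= 8 (1 + r^2)^2. *)
  rewrite (_ : _ - _ = 6 * (1 - r / 2) ^+ 2 +
     r ^+ 2 * ((r - 1) ^+ 2 + 15 / 2 + 7 * r ^+ 2)); last by field.
  apply: addr_ge0 (mulr_ge0 (ler0n R 6) (sqr_ge0 _)) (mulr_ge0 (sqr_ge0 _) _).
  apply: addr_ge0 (mulr_ge0 (ler0n R 7) (sqr_ge0 r)).
  exact: addr_ge0 (sqr_ge0 _) (divr_ge0 (ler0n R 15) (ler0n R 2)).
have h2 : enorm w `^ g <= (1 + enorm w) `^ g.
  by apply: ge0_ler_powR; rewrite ?nnegrE ?lerDr// ltW.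
apply: (le_trans (ler_pM k0 (powR_ge0 _ _) h1 h2)).
rewrite -mulrA -powRD; last by rewrite (gt_eqF q0) implybT.
have -> : - 3 + g = - (3 - g) by ring.
by rewrite ler_wpM2l// /radial ler_peMl ?powR_ge0// lerDl powR_ge0.
Qed.

Lemma pintegrable_ker_sum_weight g : 0 <= g -> g < 1 ->
  pintegrable (fun w => ker_sum w * enorm w `^ g).
Proof.
move=> g0 g1; have g2 : 2 < 3 - g by lra.
apply: (pintegrable_le _ _ (pintegrableZ 8 (pintegrable_radial g2))).
  apply: pmeasurableM; first exact: pmeasurable_ker_sum.
  by apply: pmeasurable_powR; exact: pmeasurable_enorm_id.
by move=> w; rewrite normrM (ger0_norm (powR_ge0 _ _)); exact: ker_sum_weight.
Qed.

Lemma pintegrable_ker_sum : pintegrable ker_sum.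
Proof.
have := pintegrable_ker_sum_weight (lexx 0) ltr01.
by rewrite (_ : (fun w => _) = ker_sum)//; apply/funext => w; rewrite powRr0 mulr1.
Qed.

Lemma ker_sum_ge0 w : 0 <= ker_sum w.
Proof. by rewrite ker_sumE divr_ge0// exprn_ge0// addr_ge0// sqr_ge0. Qed.

Lemma coef_b_swap2 f : admissible f -> coef_b (f \o @swap2 R) = coef_b f.
Proof.
move=> af; rewrite /coef_b (pint_swap2 (pintegrable_ker_b af)).
apply: eq_pint => w /=; congr (_ * _); rewrite /ker_b /=.
by rewrite (addrAC 1 (w.2 ^+ 2)) (mulrAC 2 w.2).
Qed.

Lemma coef_a_swap2 f : admissible f ->
  pintegrable (fun w => ker_a (swap2 w) * f w) /\
  coef_a (f \o @swap2 R) = pint (fun w => ker_a (swap2 w) * f w).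
Proof.
move=> af; have i := pintegrable_swap2 (pintegrable_ker_a (admissible_swap2 af)).
have E : (fun w => ker_a w * (f \o @swap2 R) w) \o @swap2 R =
    (fun w => ker_a (swap2 w) * f w) by apply/funext => -[w1 w2].
split; first by rewrite -E.
by rewrite /coef_a (pint_swap2 (pintegrable_ker_a (admissible_swap2 af))) E.
Qed.

(** The two slopes add up to the integral of [ker_sum] against f(p + h w); subtracting kappa f(p)
    leaves the increments of [f] at [p], at most A h^g |w|^g. *)
Lemma coef_trace f (A g : R) p h : 0 < g -> g < 1 -> 0 < h -> admissible f ->
  (forall y, `|f y - f p| <= A * enorm (y - p) `^ g) ->
  `|coef_a (f \o affine2 p h) + coef_a (f \o affine2 p h \o @swap2 R) - kappa * f p| <=
  A * pint (fun w => ker_sum w * enorm w `^ g) * h `^ g.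
Proof.
move=> g0 g1 h0 af fA; have afh := admissible_affine2 p h0 af.
have [i2 E2] := coef_a_swap2 afh; have i1 := pintegrable_ker_a afh.
have i3 := pintegrable_ker_sum; have i4 := pintegrable_ker_sum_weight (ltW g0) g1.
rewrite E2 /coef_a /kappa mulrC -(pintD i1 i2) -(pintZ (f p) i3).
have i5 := pintegrableZ (f p) i3; have i12 := pintegrableD i1 i2.
rewrite -(pintB i12 i5) -mulrA (mulrC (pint _)) mulrA -(pintZ _ i4).
apply: ler_norm_pint; [exact: pintegrableB|exact: pintegrableZ|].
move=> w; rewrite (_ : _ - _ = ker_sum w * (f (affine2 p h w) - f p)); last first.
  by rewrite /ker_sum /=; ring.
rewrite normrM (ger0_norm (ker_sum_ge0 w)) mulrCA; apply: ler_wpM2l; first exact: ker_sum_ge0.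
apply: (le_trans (fA _)); rewrite -mulrA.
rewrite -{2}(affine2_0 p h) affine2B /= !subr0 (enorm_homog w (ltW h0)).
by rewrite powRM ?enorm_ge0// ltW.
Qed.

(* [newton_pot f] and [newton_pot2 f] are, up to sign, the real and imaginary
   parts of the Cauchy transform of [f]: this is why only three of the four
   derivatives below are independent, and why the last one involves [f] itself. *)
Lemma potential_gradient g : 0 < g -> g < 1 ->
  exists2 C : R, 0 <= C & forall f A, admissible f -> (forall p, holder_line f p g A) ->
  exists G1 G2 : R * R -> R,
    [/\ forall p d, `|newton_pot f (p + d) - newton_pot f p -
            (G1 p * d.1 + G2 p * d.2)| <= C * A * (enorm d * enorm d `^ g),
        forall p q, `|G1 p - G1 q| <= C * A * enorm (p - q) `^ g /\
                    `|G2 p - G2 q| <= C * A * enorm (p - q) `^ g &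
        forall p A', (forall y, `|f y - f p| <= A' * enorm (y - p) `^ g) ->
          (forall y, `|f y - f (y.1, p.2)| <= A' * `|y.2 - p.2| `^ g) ->
          exists2 C' : R, 0 <= C' & forall d,
            `|newton_pot2 f (p + d) - newton_pot2 f p -
              (G2 p * d.1 + (kappa * f p - G1 p) * d.2)| <=
            C' * (enorm d * enorm d `^ g)].
Proof.
move=> g0 g1; have [C C0 HC] := newton_pot_campanato g0 g1.
(* The factor 6 is the loss in [whitney_holder]; the Taylor bound itself holds with [C]. *)
exists (6 * C); first by rewrite mulr_ge0// ler0n.
move=> f A af fA; have A0 := holder_line_ge0 (fA 0).
have CA0 : 0 <= C * A by rewrite mulr_ge0.
have /choice[G HG] : forall p, exists G : R * R,
    [/\ forall h, 0 < h -> `|coef_a (f \o affine2 p h) - G.1| <= C * A * h `^ g,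
        forall h, 0 < h -> `|coef_b (f \o affine2 p h) - G.2| <= C * A * h `^ g &
        forall d, `|newton_pot f (p + d) - newton_pot f p - (G.1 * d.1 + G.2 * d.2)| <=
          C * A * (enorm d * enorm d `^ g)].
  by move=> p; have [G1 [G2 ?]] := HC f A p af (fA p); exists (G1, G2).
exists (fun p => (G p).1), (fun p => (G p).2).
have HG3 p d : `|newton_pot f (p + d) - newton_pot f p - ((G p).1 * d.1 + (G p).2 * d.2)| <=
    C * A * (enorm d * enorm d `^ g) by have [] := HG p.
split.
- move=> p d; apply: (le_trans (HG3 p d)); apply: ler_wpM2r.
    by rewrite mulr_ge0 ?enorm_ge0 ?powR_ge0.
  by rewrite -mulrA ler_peMl// ler1n.
- by move=> p q; have := whitney_holder g0 g1 CA0 HG3 p q; rewrite (mulrA 6).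
move=> p A' fp fl; have [a1 a2 _] := HG p.
have asw := admissible_swap2 af.
have A'0 : 0 <= A'.
  have := le_trans (normr_ge0 _) (fl (p.1, p.2 + 1)).
  by rewrite /= (addrC p.2) addrK normr1 powR1 mulr1.
have fl' : holder_line (f \o @swap2 R) (swap2 p) g A' by move=> y; exact: (fl (swap2 y)).
have [H1 [H2 [b1 b2 b3]]] := HC _ A' (swap2 p) asw fl'.
have CA'0 : 0 <= C * A' by rewrite mulr_ge0.
(* As [ker_b] is symmetric in the coordinates, both numbers are limits of the same slopes. *)
have E2 : H2 = (G p).2.
  apply: (approx_unique (z := fun h => coef_b (f \o affine2 p h)) g0 CA'0 CA0) => // h h0.
  by rewrite -(coef_b_swap2 (admissible_affine2 p h0 af)); exact: b2.
pose J := pint (fun w => ker_sum w * enorm w `^ g).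
have J0 : 0 <= J by apply: pint_ge0 => w; rewrite mulr_ge0 ?ker_sum_ge0 ?powR_ge0.
have E1 : H1 = kappa * f p - (G p).1.
  have K0 : 0 <= A' * J + C * A by rewrite addr_ge0// mulr_ge0.
  apply: (approx_unique (z := fun h => coef_a (f \o affine2 p h \o @swap2 R)) g0 CA'0 K0).
    by move=> h h0; exact: b1.
  move=> h h0; have t := coef_trace g0 g1 h0 af fp; have s := a1 h h0.
  rewrite mulrDl -/J in t *.
  rewrite (_ : _ - _ = (coef_a (f \o affine2 p h) + coef_a (f \o affine2 p h \o @swap2 R) -
     kappa * f p) - (coef_a (f \o affine2 p h) - (G p).1)); last by ring.
  by apply: (le_trans (ler_normB _ _)); exact: lerD.
exists (C * A') => // d.
have := b3 (swap2 d); rewrite E1 E2 enorm_swap2 /newton_pot2 /=.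
by rewrite (addrC (_ * d.2)).
Qed.

End PotentialGradient.

(** * The half-plane *)

Section HalfPlane.
Variable R : realType.
Notation RT := (measurableTypeR R).
Notation mu2 := (plane_measure R).
Implicit Types (f omega : R * R -> R) (x y z w d p q : R * R) (g : R).

Lemma holder_seminorm_ub (V : zmodType) (N : V -> R) g (S : set (R * R))
    (F : R * R -> V) x y : S x -> S y -> x <> y ->
  ((N (F x - F y) / enorm (x - y) `^ g)%:E <= holder_seminorm N g S F)%E.
Proof. by move=> Sx Sy xy; apply: ereal_sup_ubound; exists x, y; split. Qed.

(** Two distinct points make both suprema range over nonempty sets of nonnegative values, so
    finiteness of the sum forces each term to be finite. *)
Lemma holder_space_bounds g (S : set (R * R)) omega x0 y0 :
  S x0 -> S y0 -> x0 <> y0 -> holder_space g S omega ->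
  exists A B : R, [/\ 0 <= A, holder_seminorm Num.norm g S omega = A%:E,
    forall x y, S x -> S y -> `|omega x - omega y| <= A * enorm (x - y) `^ g &
    forall x, S x -> `|omega x| <= B].
Proof.
move=> Sx0 Sy0 xy0 [_ fin].
have s0 : (0 <= sup_norm S omega)%E.
  by apply: (@le_trans _ _ (`|omega x0|)%:E); [rewrite lee_fin|apply: ereal_sup_ubound; exists x0].
have h0 : (0 <= holder_seminorm Num.norm g S omega)%E.
  apply: le_trans (holder_seminorm_ub Num.norm g omega Sx0 Sy0 xy0).
  by rewrite lee_fin divr_ge0// powR_ge0.
have sf : sup_norm S omega \is a fin_num.
  by rewrite ge0_fin_numE// (le_lt_trans _ fin)// leeDl.
have hf : holder_seminorm Num.norm g S omega \is a fin_num.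
  by rewrite ge0_fin_numE// (le_lt_trans _ fin)// leeDr.
exists (fine (holder_seminorm Num.norm g S omega)), (fine (sup_norm S omega)); split.
- exact: fine_ge0.
- by rewrite fineK.
- move=> x y Sx Sy; have [->|/eqP xy] := eqVneq x y.
    by rewrite subrr normr0 mulr_ge0 ?powR_ge0// fine_ge0.
  have e0 : 0 < enorm (x - y) `^ g.
    by rewrite powR_gt0// enorm_gt0 subr_eq0; exact/eqP.
  by rewrite -ler_pdivrMr// -lee_fin fineK//; exact: holder_seminorm_ub.
- move=> x Sx; rewrite -lee_fin fineK//; apply: ereal_sup_ubound; by exists x.
Qed.

Definition half_extension omega : R * R -> R := omega \_ (halfplane R).

Lemma half_extensionE omega y : half_extension omega y = if 0 < y.2 then omega y else 0.
Proof.
rewrite /half_extension patchE; case: ifPn => [|].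
  by rewrite inE /halfplane /= => ->.
by rewrite notin_setE /halfplane /= => /negP/negbTE ->.
Qed.

Lemma measurable_halfplane : measurable (halfplane R : set (RT * RT)).
Proof.
rewrite (_ : halfplane R = [set: RT] `*` `]0, +oo[%classic); last first.
  by apply/seteqP; split => y /=; rewrite /halfplane /= in_itv/= andbT => //; case.
by apply: measurableX => //; exact: measurable_itv.
Qed.

(** A pointwise substitute for the Hoelder inequality, with t = |f y| and a = 2 / q. If t <= (1 +
    |y|)^(-a), then t / (1 + |y|) <= (1 + |y|)^(-(1 + a)), integrable since 1 + a > 2. Otherwise
    t^(q - 1) >= (1 + |y|)^(-a (q - 1)) >= 1 / (1 + |y|), because 1 - a (q - 1) = (2 - q) / q >= 0,
    so that t / (1 + |y|) <= t^q. *)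
Lemma admissible_half_extension (q B : R) omega : 1 <= q -> q < 2 ->
  (forall x, halfplane R x -> `|omega x| <= B) -> Lq_on q (halfplane R) omega ->
  admissible (half_extension omega).
Proof.
move=> q1 q2 oB Lq.
have mf : pmeasurable (half_extension omega).
  by move: Lq; rewrite /Lq_on inE => /andP[/[!inE]/= mf _].
have fB y : `|half_extension omega y| <= `|B|.
  rewrite half_extensionE; case: ifPn => y2; last by rewrite normr0.
  by rewrite (le_trans (oB y y2))// ler_norm.
split => //; first by exists `|B|.
have iq : pintegrable (fun y => `|half_extension omega y| `^ q).
  exact: (Lfun_integrable q1 Lq).
have q0 : 0 < q by rewrite (lt_le_trans _ q1).
pose a := 2 / q; have a2 : 2 < 1 + a.
  by rewrite /a -ltrBlDl ltr_pdivlMr//; lra.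
apply: (pintegrable_le _ _ (pintegrableD iq (pintegrable_radial a2))).
  apply: pmeasurableM; first exact: pmeasurable_normr.
  apply: pmeasurable_inv; apply: pmeasurableD; first exact: pmeasurable_cst.
  exact: pmeasurable_enorm_id.
move=> y; have r1 : 1 <= 1 + enorm y by rewrite lerDl enorm_ge0.
have r0 : 0 < 1 + enorm y by rewrite (lt_le_trans _ r1).
rewrite ger0_norm ?divr_ge0 ?(ltW r0)//.
have rad : (1 + enorm y) `^ (- (1 + a)) <= radial (1 + a) y.
  by rewrite /radial ler_peMl ?powR_ge0// lerDl powR_ge0.
move: (`|half_extension omega y|) (normr_ge0 (half_extension omega y)) => t t0.
have tq : 0 <= t `^ q := powR_ge0 _ _.
have [ta|ta] := leP t ((1 + enorm y) `^ (- a)).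
  apply: (@le_trans _ _ (radial (1 + a) y)); last by rewrite lerDr.
  apply: le_trans rad; rewrite (_ : - (1 + a) = - a + -1); last by ring.
  rewrite powRD; last by rewrite (gt_eqF r0) implybT.
  by rewrite powR_inv1 ?(ltW r0)// ler_wpM2r// invr_ge0 ltW.
apply: (@le_trans _ _ (t `^ q)); last by rewrite lerDl radial_ge0.
have tp : 0 < t by rewrite (le_lt_trans _ ta)// powR_ge0.
rewrite ler_pdivrMr//.
have -> : t `^ q = t * t `^ (q - 1) by rewrite mulr_powRB1.
rewrite -mulrA ler_peMr//.
have h : ((1 + enorm y) `^ (- a)) `^ (q - 1) <= t `^ (q - 1).
  by apply: ge0_ler_powR; rewrite ?nnegrE ?subr_ge0 ?powR_ge0// ltW.
apply: (@le_trans _ _ (((1 + enorm y) `^ (- a)) `^ (q - 1) * (1 + enorm y))); last first.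
  by rewrite ler_wpM2r// ltW.
rewrite -powRrM -[X in _ * X]powRr1 ?(ltW r0)// -powRD; last by rewrite (gt_eqF r0) implybT.
have ex : - a * (q - 1) + 1 = (2 - q) / q by rewrite /a; field; rewrite gt_eqF.
have ex0 : 0 <= - a * (q - 1) + 1 by rewrite ex divr_ge0 ?subr_ge0// ltW.
by have := ler_powR r1 ex0; rewrite powRr0.
Qed.

Lemma enorm_reflect2_sub x y : enorm (x - reflect2 y) = enorm (reflect2 x - y).
Proof. by rewrite /enorm /= -sqrrN; congr (Num.sqrt (_ + _)); ring. Qed.

Lemma restrict_green omega x :
  (green_integrand omega x) \_ (halfplane R) =
  (fun y => (ln (enorm (x - y)) - ln (enorm (reflect2 x - y))) * half_extension omega y).
Proof.
apply/funext => y; rewrite patchE /half_extension patchE /green_integrand.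
by case: ifPn => _; [rewrite enorm_reflect2_sub|rewrite mulr0].
Qed.

Lemma integrable_green omega x : admissible (half_extension omega) ->
  mu2.-integrable (halfplane R) (EFin \o green_integrand omega x).
Proof.
move=> af; apply: (proj2 (integrable_mkcond _ measurable_halfplane)).
by rewrite restrict_EFin restrict_green; exact: pintegrable_log_diff.
Qed.

Lemma stream_log_pot omega :
  stream omega = fun x => (2 * pi)^-1 * log_pot (half_extension omega) x.
Proof.
apply/funext => x; rewrite /stream /log_pot /pint; congr (_ * _).
by rewrite Rintegral_mkcond restrict_green.
Qed.

(** If [y] and [z] are separated by the boundary, then |y - z| >= |p.2|, and the jump, at most |B|,
    is absorbed by the second constant. Allowing any [z] at the height of [p] covers both increments
    required by [potential_gradient]: from [p] itself and along vertical lines. *)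
Lemma half_extension_holder omega (A B g : R) p z y : 0 < g -> 0 <= A ->
  (forall x y, halfplane R x -> halfplane R y ->
    `|omega x - omega y| <= A * enorm (x - y) `^ g) ->
  (forall x, halfplane R x -> `|omega x| <= B) ->
  z.2 = p.2 -> p.2 != 0 ->
  `|half_extension omega y - half_extension omega z| <=
    (A + `|B| / `|p.2| `^ g) * enorm (y - z) `^ g.
Proof.
move=> g0 A0 oA oB zp p0.
have e0 : 0 <= enorm (y - z) `^ g by exact: powR_ge0.
have pp : 0 < `|p.2| by rewrite normr_gt0.
have b0 : 0 <= `|B| / `|p.2| `^ g by rewrite divr_ge0// powR_ge0.
have far : `|p.2| <= enorm (y - z) -> `|B| <= (A + `|B| / `|p.2| `^ g) * enorm (y - z) `^ g.
  move=> pe; rewrite mulrDl.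
  apply: (@le_trans _ _ (`|B| / `|p.2| `^ g * enorm (y - z) `^ g)); last first.
    by rewrite lerDr mulr_ge0.
  rewrite mulrAC ler_pdivlMr ?powR_gt0// ler_wpM2l//.
  by apply: ge0_ler_powR; rewrite ?nnegrE ?enorm_ge0// ltW.
have near : A * enorm (y - z) `^ g <= (A + `|B| / `|p.2| `^ g) * enorm (y - z) `^ g.
  by rewrite ler_wpM2r// lerDl.
have d2 : `|y.2 - z.2| <= enorm (y - z) := normr_snd_enorm (y - z).
rewrite !half_extensionE; have [y2|y2] := ltP 0 y.2; have [z2|z2] := ltP 0 z.2.
- exact: le_trans (oA _ _ y2 z2) near.
- rewrite subr0; apply: (le_trans (le_trans (oB _ y2) (ler_norm _))); apply: far.
  apply: le_trans d2; rewrite -zp (ler0_norm z2) ger0_norm; last by lra.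
  by lra.
- rewrite sub0r normrN; apply: (le_trans (le_trans (oB _ z2) (ler_norm _))); apply: far.
  apply: le_trans d2; rewrite -zp (gtr0_norm z2) distrC ger0_norm; last by lra.
  by lra.
- by rewrite subrr normr0 mulr_ge0// addr_ge0.
Qed.

Definition mat2 (a b c d : R) : 'M[R]_2 :=
  \matrix_(i, j) if i == 0 then if j == 0 then a else b
                 else if j == 0 then c else d.

Lemma ord2_cases (i : 'I_2) : i = 0 \/ i = 1.
Proof. by case: i => [[|[|m]]] // im; [left|right]; apply/val_inj. Qed.

Lemma mat2_eq (M : 'M[R]_2) (a b c d : R) : M 0 0 = a -> M 0 1 = b -> M 1 0 = c -> M 1 1 = d ->
  mat2 a b c d = M.
Proof.
move=> <- <- <- <-; apply/matrixP => i j; rewrite mxE.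
by have [->|->] := ord2_cases i; have [->|->] := ord2_cases j.
Qed.

Lemma frobenius_mat2B (a b c d a' b' c' d' t : R) : 0 <= t ->
  `|a - a'| <= t -> `|b - b'| <= t -> `|c - c'| <= t -> `|d - d'| <= t ->
  frobenius (mat2 a b c d - mat2 a' b' c' d') <= 2 * t.
Proof.
move=> t0 ha hb hc hd.
have H (M : 'M[R]_2) : (forall i j, `|M i j| <= t) -> frobenius M <= 2 * t.
  move=> HM; rewrite /frobenius -[leRHS](@ger0_norm R (2 * t)) ?mulr_ge0// -sqrtr_sqr.
  rewrite ler_sqrt ?sqr_ge0// (_ : (2 * t) ^+ 2 = \sum_(i < 2) \sum_(j < 2) t ^+ 2); last first.
    by rewrite !big_ord_recl !big_ord0; ring.
  apply: ler_sum => i _; apply: ler_sum => j _.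
  by rewrite -[leLHS]real_normK ?num_real// ler_pXn2r ?nnegrE.
apply: H => i j; rewrite !mxE.
by have [->|->] := ord2_cases i; have [->|->] := ord2_cases j.
Qed.

Lemma mat2_holder g (K : R) (S : set (R * R)) (a b c d : R * R -> R) : 0 < g -> 0 <= K ->
  (forall x y, S x -> S y -> [/\ `|a x - a y| <= K * enorm (x - y) `^ g,
     `|b x - b y| <= K * enorm (x - y) `^ g, `|c x - c y| <= K * enorm (x - y) `^ g &
     `|d x - d y| <= K * enorm (x - y) `^ g]) ->
  {within S, continuous (fun x => mat2 (a x) (b x) (c x) (d x))} /\
  (holder_seminorm (@frobenius R 2 2) g S (fun x => mat2 (a x) (b x) (c x) (d x)) <=
    (2 * K)%:E)%E.
Proof.
move=> g0 K0 H; split.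
- apply/subspace_continuousP => x Sx; apply/cvg_ballP => e e0.
  rewrite near_withinE.
  pose q := (e / (K + 1)) `^ g^-1.
  have D0 : 0 < K + 1 by rewrite ltr_wpDl.
  have e1 : 0 < e / (K + 1) by rewrite divr_gt0.
  have q0 : 0 < q by rewrite powR_gt0.
  have qg : q `^ g = e / (K + 1).
    by rewrite /q -powRrM mulVf ?gt_eqF// powRr1// ltW.
  rewrite near_simpl; apply/(@nbhs_normP R (R * R)%type); exists (q / 2) => /=.
    by rewrite divr_gt0.
  move=> y /= xy Sy.
  have eq : enorm (x - y) <= q.
    by rewrite (le_trans (enorm_le_norm _))// mulrC -ler_pdivlMr// ltW.
  have eg : K * enorm (x - y) `^ g < e.
    apply: (@le_lt_trans _ _ (K * (e / (K + 1)))).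
      rewrite ler_wpM2l// -qg; apply: ge0_ler_powR;
        by rewrite ?nnegrE ?enorm_ge0 ?(ltW g0) ?(ltW q0).
    by rewrite mulrCA -[ltRHS]mulr1 ltr_pM2l// ltr_pdivrMr// mul1r ltrDl.
  have [ha hb hc hd] := H x y Sx Sy.
  split => // i j; rewrite -ball_normE /= !mxE.
  by have [->|->] := ord2_cases i; have [->|->] := ord2_cases j => /=;
    apply: le_lt_trans eg.
- apply: ge_ereal_sup => _ [x [y [Sx Sy xy ->]]].
  have e0 : 0 < enorm (x - y) `^ g.
    by rewrite powR_gt0// enorm_gt0 subr_eq0; exact/eqP.
  rewrite lee_fin ler_pdivrMr// -mulrA.
  have [ha hb hc hd] := H x y Sx Sy.
  by apply: frobenius_mat2B => //; rewrite mulr_ge0// ltW.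
Qed.

End HalfPlane.

(** * Reflection and the derivatives of the stream function *)

Section Dirichlet.
Variable R : realType.
Implicit Types (f : R * R -> R) (x d : R * R) (g : R).

Lemma taylor_reflect (V : R * R -> R) x d (G1 G2 C g : R) :
  (forall d, `|V (reflect2 x + d) - V (reflect2 x) - (G1 * d.1 + G2 * d.2)| <=
     C * (enorm d * enorm d `^ g)) ->
  `|V (reflect2 (x + d)) - V (reflect2 x) - (G1 * d.1 - G2 * d.2)| <=
     C * (enorm d * enorm d `^ g).
Proof.
move=> H; have := H (reflect2 d); rewrite enorm_reflect2.
have -> : reflect2 x + reflect2 d = reflect2 (x + d).
  by rewrite /reflect2 /= opprD; case: (x) (d).
by rewrite /= mulrN.
Qed.

Lemma partialN (i : 'I_2) (F : R * R -> R) x : differentiable F x ->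
  partial i (fun z => - F z) x = - partial i F x.
Proof.
move=> dF; have h : derivable F x (basis2 R i) by exact: diff_derivable.
by rewrite /partial -(deriveN h).
Qed.

Lemma log_pot_differentiable (c : R) f x : admissible f ->
  [/\ differentiable (fun z => c * log_pot f z) x,
      partial 0 (fun z => c * log_pot f z) x =
        c * (newton_pot f x - newton_pot f (reflect2 x)) &
      partial 1 (fun z => c * log_pot f z) x =
        c * (newton_pot2 f x + newton_pot2 f (reflect2 x))].
Proof.
move=> af; have [C C0 HC] := log_pot_taylor x af.
apply: (@differentiable_taylor R _ x _ _ (`|c| * C) 2^-1) => //.
  by rewrite mulr_ge0.
move=> d d1; rewrite -[leRHS]mulrA; apply: le_trans (ler_wpM2l (normr_ge0 c) (HC d d1)).
rewrite -normrM; set L1 := log_pot f (x + d); set L0 := log_pot f x.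
set P := newton_pot f x - _; set Q := newton_pot2 f x + _.
have -> : c * L1 - c * L0 - (c * P * d.1 + c * Q * d.2) =
    c * (L1 - L0 - (P * d.1 + Q * d.2)) by ring.
exact: lexx.
Qed.

End Dirichlet.

Theorem proposition3p2 (R : realType) (gamma : R)
    (hgamma0 : 0 < gamma) (hgamma1 : gamma < 1) :
  exists C : R, forall (q : R) (omega : R * R -> R),
    1 <= q -> q < 2 ->
    holder_space gamma (closure (halfplane R)) omega ->
    Lq_on q (halfplane R) omega ->
    let Psi := stream omega in
    let u := perp_gradient Psi in
    let omega_seminorm :=
      holder_seminorm Num.norm gamma (closure (halfplane R)) omega in
    [/\ forall x, halfplane R x ->
          (plane_measure R).-integrable (halfplane R)
            (EFin \o green_integrand omega x),
        forall x, halfplane R x -> twice_differentiable_at Psi x,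
        exists H : R * R -> 'M[R]_2,
          continuous_extension (halfplane R) (hessian Psi) H /\
          (holder_seminorm (@frobenius R 2 2) gamma (closure (halfplane R)) H
             <= C%:E * omega_seminorm)%E
      & exists G : R * R -> 'M[R]_2,
          continuous_extension (halfplane R) (gradient u) G /\
          (holder_seminorm (@frobenius R 2 2) gamma (closure (halfplane R)) G
             <= C%:E * omega_seminorm)%E].
Proof.
have [K K0 HK] := potential_gradient hgamma0 hgamma1.
pose c : R := (2 * pi)^-1.
(* Bound for each entry of the Hessian: 2 K for the values of [G1] or [G2] at a point and at its
   reflection, [kappa] for the term in [omega]. The final 2 passes from the entries to the Frobenius
   norm of a 2 by 2 matrix. *)
pose M := `|c| * (`|kappa R| + 2 * K).
have M0 : 0 <= M by rewrite mulr_ge0// addr_ge0// mulr_ge0.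
exists (2 * M) => q omega q1 q2 ho Lq Psi u omega_seminorm.
have cl x : halfplane R x -> closure (halfplane R) x by apply: subset_closure.
have [A [B [A0 hA oA oB]]] : exists A B : R, [/\ 0 <= A,
    holder_seminorm Num.norm gamma (closure (halfplane R)) omega = A%:E,
    forall x y, closure (halfplane R) x -> closure (halfplane R) y ->
      `|omega x - omega y| <= A * enorm (x - y) `^ gamma &
    forall x, closure (halfplane R) x -> `|omega x| <= B].
  apply: (holder_space_bounds (x0 := (0, 1)) (y0 := (0, 2))) ho.
  - by apply: cl; rewrite /halfplane /=.
  - by apply: cl; rewrite /halfplane /=.
  - by case => /eqP; rewrite -subr_eq0 (_ : 1 - 2 = -1 :> R) ?oppr_eq0 ?oner_eq0//; ring.
pose f := half_extension omega.
have oB' x : halfplane R x -> `|omega x| <= B by move=> /cl; exact: oB.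
have oA' x y : halfplane R x -> halfplane R y ->
    `|omega x - omega y| <= A * enorm (x - y) `^ gamma.
  by move=> /cl hx /cl hy; exact: oA.
have af : admissible f := admissible_half_extension q1 q2 oB' Lq.
have fline p : holder_line f p gamma A.
  move=> y; rewrite /f !half_extensionE /=; case: ifPn => y2; last first.
    by rewrite subrr normr0 mulr_ge0// powR_ge0.
  apply: (le_trans (oA' _ _ _ _)) => //.
  rewrite (_ : enorm _ = `|y.1 - p.1|)//.
  by rewrite /enorm /= subrr expr0n addr0 sqrtr_sqr.
have [G1 [G2 [g1 gh g2]]] := HK f A af fline.
have fpt p : p.2 != 0 -> exists2 C' : R, 0 <= C' & forall d,
    `|newton_pot2 f (p + d) - newton_pot2 f p -
      (G2 p * d.1 + (kappa R * f p - G1 p) * d.2)| <= C' * (enorm d * enorm d `^ gamma).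
  move=> p0; apply: (g2 p (A + `|B| / `|p.2| `^ gamma)) => y.
    exact: half_extension_holder.
  have := @half_extension_holder R omega A B gamma p (y.1, p.2) y hgamma0 A0 oA' oB' erefl p0.
  rewrite (_ : enorm (y - (y.1, p.2)) = `|y.2 - p.2|)//.
  by rewrite /enorm /= subrr expr0n add0r sqrtr_sqr.
have Psi1 : partial 0 Psi = fun x => c * (newton_pot f x - newton_pot f (reflect2 x)).
  apply/funext => x; rewrite /Psi stream_log_pot.
  by have [] := log_pot_differentiable c x af.
have Psi2 : partial 1 Psi = fun x => c * (newton_pot2 f x + newton_pot2 f (reflect2 x)).
  apply/funext => x; rewrite /Psi stream_log_pot.
  by have [] := log_pot_differentiable c x af.
pose h11 x := c * (G1 x - G1 (reflect2 x)).
pose h12 x := c * (G2 x + G2 (reflect2 x)).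
(* Written with [omega] and not [f]: they agree in the open half-plane, but [f] is 0 on the
   boundary, where only [omega] gives the continuous extension. *)
pose h22 x := c * (kappa R * omega x) - h11 x.
have D1 x : halfplane R x -> [/\ differentiable (partial 0 Psi) x,
    partial 0 (partial 0 Psi) x = h11 x & partial 1 (partial 0 Psi) x = h12 x].
  move=> x2; rewrite Psi1.
  apply: (@differentiable_taylor R _ x _ _ (`|c| * (K * A + K * A)) gamma) => //.
    by rewrite mulr_ge0// addr_ge0// mulr_ge0.
  move=> d _; have t1 := g1 x d; have t2 := taylor_reflect d (g1 (reflect2 x)).
  have := ler_wpM2l (normr_ge0 c) (le_trans (ler_normB _ _) (lerD t1 t2)).
  rewrite -normrM -mulrDl mulrA; apply: le_trans.
  by rewrite /h11 /h12; apply: eq_ler; congr (`|_|); ring.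
have D2 x : halfplane R x -> [/\ differentiable (partial 1 Psi) x,
    partial 0 (partial 1 Psi) x = h12 x & partial 1 (partial 1 Psi) x = h22 x].
  move=> x2; rewrite Psi2.
  have x2n : x.2 != 0 by rewrite gt_eqF.
  have rx2n : (reflect2 x).2 != 0 by rewrite /= oppr_eq0.
  have [C1 C10 t1] := fpt x x2n; have [C2 C20 t2] := fpt (reflect2 x) rx2n.
  have fx : f x = omega x by rewrite /f half_extensionE x2.
  (* The reflected point lies outside the support, so it contributes no [kappa] term. *)
  have frx : f (reflect2 x) = 0.
    by rewrite /f half_extensionE /= oppr_gt0 ltNge ltW.
  rewrite fx in t1; rewrite frx mulr0 sub0r in t2.
  apply: (@differentiable_taylor R _ x _ _ (`|c| * (C1 + C2)) gamma) => //.
    by rewrite mulr_ge0// addr_ge0.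
  move=> d _; have {}t1 := t1 d; have {}t2 := taylor_reflect d t2.
  have := ler_wpM2l (normr_ge0 c) (le_trans (ler_normD _ _) (lerD t1 t2)).
  rewrite -normrM -mulrDl mulrA; apply: le_trans.
  by rewrite /h22 /h11 /h12; apply: eq_ler; congr (`|_|); ring.
(* [G1] and [G2] are Hoelder on the whole plane and [omega] on the closure, so these bounds hold at
   boundary points without any passage to the limit. *)
have hh x y : closure (halfplane R) x -> closure (halfplane R) y ->
    [/\ `|h11 x - h11 y| <= M * A * enorm (x - y) `^ gamma,
        `|h12 x - h12 y| <= M * A * enorm (x - y) `^ gamma &
        `|h22 x - h22 y| <= M * A * enorm (x - y) `^ gamma].
  move=> cx cy; have [i1 i2] := gh x y; have [j1 j2] := gh (reflect2 x) (reflect2 y).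
  have e : enorm (reflect2 x - reflect2 y) = enorm (x - y).
    by rewrite /enorm /=; congr (Num.sqrt (_ + _)); ring.
  rewrite e in j1 j2; have k := oA x y cx cy.
  set E := enorm (x - y) `^ gamma in i1 i2 j1 j2 k *.
  have E0 : 0 <= E by exact: powR_ge0.
  have KE0 : 0 <= `|kappa R| * (A * E) by rewrite !mulr_ge0.
  have b11 : `|h11 x - h11 y| <= `|c| * (K * A * E + K * A * E).
    have := ler_wpM2l (normr_ge0 c) (le_trans (ler_normB _ _) (lerD i1 j1)).
    rewrite -normrM; apply: le_trans.
    by rewrite /h11; apply: eq_ler; congr (`|_|); ring.
  have b12 : `|h12 x - h12 y| <= `|c| * (K * A * E + K * A * E).
    have := ler_wpM2l (normr_ge0 c) (le_trans (ler_normD _ _) (lerD i2 j2)).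
    rewrite -normrM; apply: le_trans.
    by rewrite /h12; apply: eq_ler; congr (`|_|); ring.
  have ME : M * A * E = `|c| * (`|kappa R| * (A * E)) + `|c| * (K * A * E + K * A * E).
    by rewrite /M; ring.
  have c0 : 0 <= `|c| * (`|kappa R| * (A * E)) by rewrite mulr_ge0.
  split.
  - by rewrite ME (le_trans b11)// lerDr.
  - by rewrite ME (le_trans b12)// lerDr.
  - rewrite ME (_ : h22 x - h22 y =
      c * (kappa R * (omega x - omega y)) - (h11 x - h11 y)); last first.
      by rewrite /h22; ring.
    apply: (le_trans (ler_normB _ _)); apply: lerD => //.
    by rewrite !normrM ler_wpM2l// ler_wpM2l.
have MA0 : 0 <= M * A by rewrite mulr_ge0.
rewrite /omega_seminorm hA -EFinM -(mulrA 2).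
split.
- by move=> x _; exact: integrable_green.
- move=> x x2; split.
    by rewrite /Psi stream_log_pot; have [] := log_pot_differentiable c x af.
  move=> i; have [->|->] := ord2_cases i.
    by have [] := D1 x x2.
  by have [] := D2 x x2.
- exists (fun x => mat2 (h11 x) (h12 x) (h12 x) (h22 x)).
  have [cH sH] := @mat2_holder R gamma (M * A) (closure (halfplane R)) h11 h12 h12 h22
    hgamma0 MA0 (fun x y cx cy => let: And3 a b d := hh x y cx cy in And4 a b b d).
  split => //; split => // x x2.
  have [_ p11 p12] := D1 x x2; have [_ p21 p22] := D2 x x2.
  by apply: mat2_eq; rewrite mxE.
(* Up to a sign in the second row, the rows of the Hessian exchanged; the entrywise bounds are the
   same. *)
- exists (fun x => mat2 (h12 x) (h22 x) (- h11 x) (- h12 x)).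
  have NB (a b t : R) : `|a - b| <= t -> `|- a - - b| <= t by rewrite -opprD normrN.
  have [cH sH] := @mat2_holder R gamma (M * A) (closure (halfplane R)) h12 h22
    (fun x => - h11 x) (fun x => - h12 x) hgamma0 MA0
    (fun x y cx cy => let: And3 a b d := hh x y cx cy in And4 b d (NB _ _ _ a) (NB _ _ _ b)).
  split => //; split => // x x2.
  have [d1 p11 p12] := D1 x x2; have [d2 p21 p22] := D2 x x2.
  have N i := partialN i d1.
  apply: mat2_eq; rewrite mxE /u /perp_gradient /coord2 /=.
  + exact: p21.
  + exact: p22.
  + by rewrite N p11.
  + by rewrite N p12.
Qed.
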